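(* Let $n\geq 2$ be an integer and put $b=n-1$. The Danilov-Gizatullin surface $V_n$ is isomorphic to the algebraic quotient $F_n/\!/T=\operatorname{Spec}\mathbb{C}[F_n]^T$, where $F_n\subset\mathbb{C}^4_{(a_1,a_2,a_3,a_4)}$ is the affine threefold given by the equation $$a_1a_4-a_2^ba_3=1$$ and the torus $T\cong\mathbb{C}^*$ acts on $F_n$ via $$t.(a_1,a_2,a_3,a_4)=(t^{-1}a_1,\,ta_2,\,t^{-b}a_3,\,ta_4).$$
   Context: Everything is over $\mathbb{C}$. For $d\geq 0$, $\Sigma_d$ denotes the Hirzebruch surface, with its ruling $\pi:\Sigma_d\to\mathbb{P}^1$ (a $\mathbb{P}^1$-bundle over $\mathbb{P}^1$ containing an irreducible curve of self-intersection $-d$). A Danilov-Gizatullin surface is an affine surface of the form $\Sigma_d\setminus S$, where $S$ is (the image of) a section of the ruling which is ample as a divisor. By a theorem of Danilov and Gizatullin, for ample sections $S\subset\Sigma_d$ and $S'\subset\Sigma_{d'}$, the surfaces $\Sigma_d\setminus S$ and $\Sigma_{d'}\setminus S'$ are isomorphic if and only if $S^2=S'^2$. For $n\geq 2$, $V_n$ denotes the (unique up to isomorphism) surface $\Sigma_d\setminus S$ with $S$ an ample section and $S^2=n$. $\mathbb{C}[F_n]^T$ is the ring of $T$-invariant regular functions on $F_n$. *)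

(* Defs.v *)
From HB Require Import structures.
From mathcomp Require Import all_boot all_order all_algebra generic_quotient.
From mathcomp Require Import boolp classical_sets functions reals complex.
From mathcomp Require Import mpoly.

Set Implicit Arguments.
Unset Strict Implicit.
Unset Printing Implicit Defensive.

Import GRing.Theory.
Local Open Scope quotient_scope.
Local Open Scope classical_set_scope.
Local Open Scope ring_scope.

(* Varieties over an algebraically closed field k are classical varieties:    *)
(* a set of closed points, a (Zariski) topology, and a sheaf of k-valued      *)
(* regular functions. "regular U f" only looks at the values of f on U.       *)
Record space (k : fieldType) := Space {
  carrier :> Type;
  zopen : set (set carrier);
  regular : set carrier -> set (carrier -> k);
  zopenT : zopen setT;
  zopenI : forall U V, zopen U -> zopen V -> zopen (U `&` V);
  zopen_bigcup : forall F : set (set carrier),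
    F `<=` zopen -> zopen (\bigcup_(V in F) V);
  regular_sub : forall U V f, V `<=` U -> regular U f -> regular V f;
  regular_local : forall U f,
    (forall x, U x -> exists V g,
        [/\ zopen V, V x, regular V g & forall y, U y -> V y -> f y = g y]) ->
    regular U f;
  regular_cst : forall U c, regular U (fun=> c);
  regularD : forall U f g,
    regular U f -> regular U g -> regular U (fun x => f x + g x);
  regularM : forall U f g,
    regular U f -> regular U g -> regular U (fun x => f x * g x);
  regularV : forall U f, zopen U -> regular U f ->
    zopen (U `&` [set x | f x != 0]) /\
    regular (U `&` [set x | f x != 0]) (fun x => (f x)^-1)
}.

Definition morphism (k : fieldType) (X Y : space k) (f : X -> Y) : Prop :=
  forall V : set Y, zopen V ->
    zopen (f @^-1` V) /\
    forall g : Y -> k, regular V g -> regular (f @^-1` V) (fun x => g (f x)).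

Definition isomorphism (k : fieldType) (X Y : space k) (f : X -> Y) : Prop :=
  morphism f /\ exists g : Y -> X, [/\ morphism g, cancel f g & cancel g f].

Definition isomorphic (k : fieldType) (X Y : space k) : Prop :=
  exists f : X -> Y, isomorphism f.

Lemma zopen_local (k : fieldType) (X : space k) (U : set X) :
  (forall x, U x -> exists V, [/\ zopen V, V x & V `<=` U]) -> zopen U.
Proof.
move=> H; pose F := [set V : set X | zopen V /\ V `<=` U].
have -> : U = \bigcup_(V in F) V.
  apply/seteqP; split=> [x /H[V [oV Vx VU]]|x [V [_ VU] Vx]]; last exact: VU.
  by exists V.
by apply: zopen_bigcup => V [].
Qed.

(* The space on a set X cut out by a k-algebra A of functions on X: the sets  *)
(* D(b) = {b <> 0} form a basis of the topology, and a function is regular    *)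
(* when it is locally a quotient a / b of elements of A.                      *)
Section FunSpace.
Variables (k : fieldType) (A : comAlgType k) (X : Type).
Variable ev : X -> {lrmorphism A -> k | *%R}.
Implicit Types (U V : set X) (f g : X -> k).

Definition fun_zopen : set (set X) := [set U |
  forall x, U x -> exists2 b : A,
    ev x b != 0 & forall y, ev y b != 0 -> U y].

Definition fun_regular U : set (X -> k) := [set f |
  forall x, U x -> exists a b : A,
    ev x b != 0 /\ forall y, U y -> ev y b != 0 -> f y = ev y a / ev y b].

Lemma fun_zopenT : fun_zopen setT.
Proof. by move=> x _; exists 1; rewrite ?rmorph1 ?oner_eq0. Qed.

Lemma fun_zopenI U V : fun_zopen U -> fun_zopen V -> fun_zopen (U `&` V).
Proof.
move=> oU oV x [/oU[b bx bU] /oV[c cx cV]].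
exists (b * c); first by rewrite rmorphM mulf_neq0.
by move=> y; rewrite rmorphM mulf_eq0 negb_or => /andP[/bU ? /cV ?].
Qed.

Lemma fun_zopen_bigcup (F : set (set X)) :
  F `<=` fun_zopen -> fun_zopen (\bigcup_(V in F) V).
Proof.
move=> oF x [V FV /(oF _ FV)[b bx bV]].
by exists b => // y /bV Vy; exists V.
Qed.

Lemma fun_regular_sub U V f : V `<=` U -> fun_regular U f -> fun_regular V f.
Proof.
move=> VU rf x /VU/rf[a [b [bx ab]]]; exists a, b; split=> // y /VU.
exact: ab.
Qed.

Lemma fun_regular_local U f :
  (forall x, U x -> exists V g, [/\ fun_zopen V, V x, fun_regular V g &
      forall y, U y -> V y -> f y = g y]) ->
  fun_regular U f.
Proof.
move=> H x Ux; have [V [g [oV Vx rg fg]]] := H x Ux.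
have [a [b [bx ab]]] := rg x Vx; have [c cx cV] := oV x Vx.
exists (a * c), (b * c); split; first by rewrite rmorphM mulf_neq0.
move=> y Uy; rewrite !rmorphM mulf_eq0 negb_or => /andP[by0 cy0].
by rewrite (fg _ Uy (cV _ cy0)) (ab _ (cV _ cy0) by0) -mulf_div divff ?mulr1.
Qed.

Lemma fun_regular_cst U c : fun_regular U (fun=> c).
Proof.
move=> x _; exists (c *: 1), 1; rewrite rmorph1 oner_eq0; split=> // y _ _.
by rewrite linearZ /= !rmorph1 mulr1 divr1.
Qed.

Lemma fun_regularD U f g :
  fun_regular U f -> fun_regular U g -> fun_regular U (fun x => f x + g x).
Proof.
move=> rf rg x Ux; have [a [b [bx ab]]] := rf x Ux.
have [a' [b' [bx' ab']]] := rg x Ux.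
exists (a * b' + a' * b), (b * b'); rewrite rmorphM mulf_neq0 //.
split=> // y Uy; rewrite !rmorphD !rmorphM mulf_eq0 negb_or => /andP[by0 by0'].
by rewrite ab // ab' // addf_div.
Qed.

Lemma fun_regularM U f g :
  fun_regular U f -> fun_regular U g -> fun_regular U (fun x => f x * g x).
Proof.
move=> rf rg x Ux; have [a [b [bx ab]]] := rf x Ux.
have [a' [b' [bx' ab']]] := rg x Ux.
exists (a * a'), (b * b'); rewrite rmorphM mulf_neq0 //.
split=> // y Uy; rewrite !rmorphM mulf_eq0 negb_or => /andP[by0 by0'].
by rewrite ab // ab' // mulf_div.
Qed.

Lemma fun_regularV U f : fun_zopen U -> fun_regular U f ->
  fun_zopen (U `&` [set x | f x != 0]) /\
  fun_regular (U `&` [set x | f x != 0]) (fun x => (f x)^-1).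
Proof.
move=> oU rf; split=> x [Ux /= fx0]; have [a [b [bx ab]]] := rf x Ux.
  have ax : ev x a != 0 by apply: contraNneq fx0 => ax; rewrite ab // ax mul0r.
  have [c cx cU] := oU x Ux; exists (c * (a * b)).
    by rewrite !rmorphM !mulf_neq0.
  move=> y; rewrite !rmorphM !mulf_eq0 !negb_or => /and3P[/cU Uy ay by0].
  by split=> //=; rewrite ab // mulf_neq0 // invr_eq0.
have ax : ev x a != 0 by apply: contraNneq fx0 => ax; rewrite ab // ax mul0r.
exists (b * b), (a * b); rewrite rmorphM mulf_neq0 //; split=> // y [Uy _].
rewrite !rmorphM mulf_eq0 negb_or => /andP[ay by0].
by rewrite ab // invf_div -mulf_div divff ?mulr1.
Qed.

Definition fun_space : space k :=
  Space fun_zopenT fun_zopenI fun_zopen_bigcup fun_regular_sub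
    fun_regular_local fun_regular_cst fun_regularD fun_regularM fun_regularV.
End FunSpace.

(* A subset S of X with the induced structure: the regular functions are      *)
(* those that locally extend to X. This covers open and closed subvarieties.  *)
Section SubSpace.
Variables (k : fieldType) (X : space k) (S : set X).
Implicit Types (U V : set S) (f g : S -> k).

Definition sub_zopen : set (set S) := [set U |
  exists2 W : set X, zopen W & U = val @^-1` W].

Definition sub_regular U : set (S -> k) := [set f |
  forall x, U x -> exists (W : set X) (g : X -> k),
    [/\ zopen W, W (val x), regular W g &
        forall y, U y -> W (val y) -> f y = g (val y)]].

Lemma sub_zopenT : sub_zopen setT.
Proof. by exists setT => //; apply: zopenT. Qed.

Lemma sub_zopenI U V : sub_zopen U -> sub_zopen V -> sub_zopen (U `&` V).
Proof.
move=> [W oW ->] [W' oW' ->]; exists (W `&` W') => //; exact: zopenI.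
Qed.

Lemma sub_zopen_bigcup (F : set (set S)) :
  F `<=` sub_zopen -> sub_zopen (\bigcup_(V in F) V).
Proof.
move=> oF.
exists (\bigcup_(W in [set W | zopen W /\ F (val @^-1` W)]) W).
  by apply: zopen_bigcup => W [].
apply/seteqP; split=> x.
  by move=> [V FV Vx]; have [W oW eV] := oF _ FV; subst V; exists W.
by move=> [W [oW FW] Wx]; exists (val @^-1` W).
Qed.

Lemma sub_regular_sub U V f : V `<=` U -> sub_regular U f -> sub_regular V f.
Proof.
move=> VU rf x /VU/rf[W [g [oW Wx rg fg]]]; exists W, g; split=> // y /VU.
exact: fg.
Qed.

Lemma sub_regular_local U f :
  (forall x, U x -> exists V g, [/\ sub_zopen V, V x, sub_regular V g &
      forall y, U y -> V y -> f y = g y]) ->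
  sub_regular U f.
Proof.
move=> H x Ux; have [V [g [[W oW ->] Wx rg fg]]] := H x Ux.
have [W' [g' [oW' Wx' rg' gg']]] := rg x Wx.
exists (W `&` W'), g'; split=> //; first exact: zopenI.
  by apply: regular_sub rg' => y [].
by move=> y Uy [Wy Wy']; rewrite fg // gg'.
Qed.

Lemma sub_regular_cst U c : sub_regular U (fun=> c).
Proof.
move=> x _; exists setT, (fun=> c).
by split=> //; [apply: zopenT|apply: regular_cst].
Qed.

Lemma sub_regular2 (op : k -> k -> k) U f g :
  (forall (W : set X) (f' g' : X -> k), regular W f' -> regular W g' ->
     regular W (fun x => op (f' x) (g' x))) ->
  sub_regular U f -> sub_regular U g -> sub_regular U (fun x => op (f x) (g x)).
Proof.
move=> rop rf rg x Ux; have [W [f' [oW Wx rf' ff']]] := rf x Ux.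
have [W' [g' [oW' Wx' rg' gg']]] := rg x Ux.
exists (W `&` W'), (fun y => op (f' y) (g' y)); split=> //; first exact: zopenI.
  by apply: rop; [apply: regular_sub rf'|apply: regular_sub rg'] => y [].
by move=> y Uy [Wy Wy']; rewrite ff' // gg'.
Qed.

Lemma sub_regularD U f g :
  sub_regular U f -> sub_regular U g -> sub_regular U (fun x => f x + g x).
Proof. by apply: sub_regular2 => *; apply: regularD. Qed.

Lemma sub_regularM U f g :
  sub_regular U f -> sub_regular U g -> sub_regular U (fun x => f x * g x).
Proof. by apply: sub_regular2 => *; apply: regularM. Qed.

Lemma sub_regularV U f : sub_zopen U -> sub_regular U f ->
  sub_zopen (U `&` [set x | f x != 0]) /\
  sub_regular (U `&` [set x | f x != 0]) (fun x => (f x)^-1).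
Proof.
move=> [W oW ->{U}] rf; split.
  exists (\bigcup_(V in [set V | zopen V /\
      forall y : S, V (val y) -> W (val y) /\ f y != 0]) V).
    by apply: zopen_bigcup => V [].
  apply/seteqP; split=> x.
    move=> [Wx fx0]; have [W' [g [oW' Wx' rg fg]]] := rf x Wx.
    have [oD _] := regularV oW' rg.
    exists (W `&` (W' `&` [set y | g y != 0])); last first.
      by split=> //; split=> //=; rewrite -fg.
    split; first exact: zopenI.
    by move=> y [Wy [Wy' gy0]]; rewrite fg.
  by move=> [V [_ H] /H].
move=> x [Wx fx0]; have [W' [g [oW' Wx' rg fg]]] := rf x Wx.
have [oD rD] := regularV oW' rg.
exists (W' `&` [set y | g y != 0]), (fun y => (g y)^-1); split=> //.
  by split=> //=; rewrite -fg.
by move=> y [Wy _] [Wy' _]; rewrite fg.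
Qed.

Definition sub_space : space k :=
  Space sub_zopenT sub_zopenI sub_zopen_bigcup sub_regular_sub
    sub_regular_local sub_regular_cst sub_regularD sub_regularM sub_regularV.
End SubSpace.

Section QuotSpace.
Variables (k : fieldType) (X : space k) (T : Type) (q : X -> T).
Implicit Types (U V : set T) (f g : T -> k).

Definition quot_zopen : set (set T) := [set U | zopen (q @^-1` U)].

Definition quot_regular U : set (T -> k) :=
  [set f : T -> k | regular (q @^-1` U) (fun x => f (q x))].

Lemma quot_zopenT : quot_zopen setT.
Proof. exact: zopenT. Qed.

Lemma quot_zopenI U V : quot_zopen U -> quot_zopen V -> quot_zopen (U `&` V).
Proof. exact: zopenI. Qed.

Lemma quot_zopen_bigcup (F : set (set T)) :
  F `<=` quot_zopen -> quot_zopen (\bigcup_(V in F) V).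
Proof.
move=> oF; apply: zopen_local => x [V FV Vx]; exists (q @^-1` V).
by split=> //; [apply: oF|move=> y Vy; exists V].
Qed.

Lemma quot_regular_sub U V f :
  V `<=` U -> quot_regular U f -> quot_regular V f.
Proof. by move=> VU; apply: regular_sub => x /VU. Qed.

Lemma quot_regular_local U f :
  (forall x, U x -> exists V g, [/\ quot_zopen V, V x, quot_regular V g &
      forall y, U y -> V y -> f y = g y]) ->
  quot_regular U f.
Proof.
move=> H; apply: regular_local => x /H[V [g [oV Vx rg fg]]].
by exists (q @^-1` V), (fun x => g (q x)); split=> // y; apply: fg.
Qed.

Lemma quot_regular_cst U c : quot_regular U (fun=> c).
Proof. exact: regular_cst. Qed.

Lemma quot_regularD U f g :
  quot_regular U f -> quot_regular U g -> quot_regular U (fun x => f x + g x).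
Proof. exact: regularD. Qed.

Lemma quot_regularM U f g :
  quot_regular U f -> quot_regular U g -> quot_regular U (fun x => f x * g x).
Proof. exact: regularM. Qed.

Lemma quot_regularV U f : quot_zopen U -> quot_regular U f ->
  quot_zopen (U `&` [set x | f x != 0]) /\
  quot_regular (U `&` [set x | f x != 0]) (fun x => (f x)^-1).
Proof. by move=> oU /(regularV oU)[]. Qed.

Definition quot_space : space k :=
  Space quot_zopenT quot_zopenI quot_zopen_bigcup quot_regular_sub
    quot_regular_local quot_regular_cst quot_regularD quot_regularM
    quot_regularV.
End QuotSpace.

(* The closed points of Spec A, for A finitely generated over k algebraically *)
(* closed: the k-algebra morphisms A -> k.                                    *)
Definition Spec (k : closedFieldType) (A : comAlgType k) : space k :=
  @fun_space k A {lrmorphism A -> k | *%R} id.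

Definition peval (k : closedFieldType) m (x : 'rV[k]_m) :
  {lrmorphism {mpoly k[m]} -> k | *%R} := meval (fun i => x 0 i).

Definition affine (k : closedFieldType) m : space k := fun_space (@peval k m).

(* P^N is the quotient of k^(N+1) \ {0} by homotheties.                       *)
Section ProjectiveSpace.
Variables (k : closedFieldType) (N : nat).

Definition nzvec : Type := [set x : 'rV[k]_N.+1 | x != 0].
HB.instance Definition _ := Choice.on nzvec.

Definition proportional : rel nzvec :=
  fun x y => `[< exists2 c : k, c != 0 & val y = c *: val x >].

Lemma proportional_refl : reflexive proportional.
Proof. by move=> x; apply/asboolP; exists 1; rewrite ?oner_eq0 ?scale1r. Qed.

Lemma proportional_sym : ssrbool.symmetric proportional.
Proof.
suff H x y : proportional x y -> proportional y x.
  by move=> x y; apply/idP/idP => /H.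
move=> /asboolP[c c0 e]; apply/asboolP; exists c^-1; rewrite ?invr_eq0 //.
by rewrite e scalerA mulVf ?scale1r.
Qed.

Lemma proportional_trans : transitive proportional.
Proof.
move=> y x z /asboolP[c c0 exy] /asboolP[c' c'0 eyz]; apply/asboolP.
by exists (c' * c); rewrite ?mulf_neq0 // eyz exy scalerA.
Qed.

Canonical proportional_equiv :=
  EquivRel proportional proportional_refl proportional_sym proportional_trans.

Definition projpt : Type := {eq_quot proportional_equiv}.
HB.instance Definition _ := Choice.on projpt.
HB.instance Definition _ := EqQuotient.on projpt.

Definition proj_space : space k :=
  quot_space (X := sub_space ([set x | x != 0] : set (affine k N.+1)))
    (fun x => \pi_projpt (x : nzvec)).
End ProjectiveSpace.

Definition row4 (k : fieldType) (a b c d : k) : 'rV[k]_4 :=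
  \row_(i < 4) [:: a; b; c; d]`_i.

(* The Hirzebruch surface of index d in Cox coordinates (x0, x1, y0, y1),     *)
(* stored as entries 0, 1, 2, 3: (k^2 \ 0) x (k^2 \ 0) modulo the action      *)
(* (l, m).(x0, x1, y0, y1) = (l x0, l x1, l^d m y0, m y1) of (k^* )^2. This   *)
(* is the P^1-bundle P(O + O(d)) over P^1; the ruling is [x0 : x1] and        *)
(* the curve y1 = 0 has self-intersection -d.                                 *)
Section Hirzebruch.
Variables (k : closedFieldType) (d : nat).

Definition cox : set 'rV[k]_4 :=
  [set x | (x 0 0, x 0 1) != (0, 0) /\ (x 0 2, x 0 3) != (0, 0)].

Definition coxpt : Type := cox.
HB.instance Definition _ := Choice.on coxpt.

Definition cox_act (l m : k) (x : 'rV[k]_4) : 'rV[k]_4 :=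
  row4 (l * x 0 0) (l * x 0 1) (l ^+ d * m * x 0 2) (m * x 0 3).

Definition cox_rel : rel coxpt := fun x y =>
  `[< exists l m : k, [/\ l != 0, m != 0 & val y = cox_act l m (val x)] >].

Lemma cox_act1 x : cox_act 1 1 x = x.
Proof.
apply/rowP => i; rewrite mxE expr1n !mul1r.
by case: i => [[|[|[|[|//]]]] h] /=; congr (x _ _); apply: val_inj.
Qed.

Lemma cox_actM l m l' m' x :
  cox_act l m (cox_act l' m' x) = cox_act (l * l') (m * m') x.
Proof.
apply/rowP => i; rewrite !mxE /= exprMn !mulrA.
by case: i => [[|[|[|[|//]]]] h] /=; rewrite ?[_ * m * _]mulrAC.
Qed.

Lemma cox_refl : reflexive cox_rel.
Proof.
by move=> x; apply/asboolP; exists 1, 1; rewrite oner_eq0 cox_act1.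
Qed.

Lemma cox_sym : ssrbool.symmetric cox_rel.
Proof.
suff H x y : cox_rel x y -> cox_rel y x.
  by move=> x y; apply/idP/idP => /H.
move=> /asboolP[l [m [l0 m0 e]]]; apply/asboolP; exists l^-1, m^-1.
by rewrite e !invr_eq0 cox_actM !mulVf // cox_act1.
Qed.

Lemma cox_trans : transitive cox_rel.
Proof.
move=> y x z /asboolP[l [m [l0 m0 exy]]] /asboolP[l' [m' [l0' m0' eyz]]].
apply/asboolP; exists (l' * l), (m' * m).
by rewrite !mulf_neq0 // eyz exy cox_actM.
Qed.

Canonical cox_equiv := EquivRel cox_rel cox_refl cox_sym cox_trans.

Definition hirzpt : Type := {eq_quot cox_equiv}.
HB.instance Definition _ := Choice.on hirzpt.
HB.instance Definition _ := EqQuotient.on hirzpt.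

Definition hirzebruch : space k :=
  quot_space (X := sub_space (cox : set (affine k 4)))
    (fun x => \pi_hirzpt (x : coxpt)).

Lemma cox_base_neq0 (x : coxpt) :
  \row_(i < 2) [:: val x 0 0; val x 0 1]`_i \in
    [set v : 'rV[k]_2 | v != 0].
Proof.
have /set_mem[x0 _] := valP x; rewrite inE /=.
apply: contra_neq x0 => /rowP e.
by have := e 0; have := e 1; rewrite !mxE /= => -> ->.
Qed.

Definition cox_base (x : coxpt) : nzvec k 1 :=
  exist (fun v => v \in [set v | v != 0]) _ (cox_base_neq0 x).

Definition ruling (x : hirzebruch) : proj_space k 1 :=
  \pi_(projpt k 1) (cox_base (repr (x : hirzpt))).

Lemma ruling_pi (x : coxpt) :
  ruling (\pi_hirzpt x) = \pi_(projpt k 1) (cox_base x).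
Proof.
apply/eqmodP; apply/asboolP.
have /eqmodP/asboolP[l [m [l0 m0 e]]] : repr (\pi_hirzpt x) = x %[mod hirzpt].
  by rewrite reprK.
exists l => //=; apply/rowP => i; rewrite !mxE /= e !mxE /=.
by case: i => [[|[|//]] h].
Qed.
End Hirzebruch.

(* Curves on a surface X, and divisors supported on them.                     *)
Section Divisors.
Variable k : closedFieldType.

(* h generates on U the ideal sheaf of functions vanishing on S.              *)
Definition local_equation (X : space k) (S : set X) (U : set X) (h : X -> k) :=
  [/\ regular U h, forall x, U x -> S x -> h x = 0 &
      forall (V : set X) (g : X -> k),
        zopen V -> V `<=` U -> regular V g ->
        (forall x, V x -> S x -> g x = 0) ->
        exists q, regular V q /\ forall x, V x -> g x = h x * q x].

Definition closed_immersion (X Y : space k) (f : X -> Y) : Prop :=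
  exists (Z : set Y) (g : X -> sub_space Z),
    [/\ zopen (~` Z), isomorphism g & forall x, val (g x) = f x].

(* The sections f_0, ..., f_N of O_X(m S) are functions on X \ S such that    *)
(* each f_i h^m extends to a regular function g_i on U, for h a local         *)
(* equation of S on U; m S is very ample when such sections define a closed   *)
(* immersion phi = [f_0 : ... : f_N], which is [g_0 : ... : g_N] on U.        *)
Definition very_ample (X : space k) (S : set X) (m : nat) : Prop :=
  exists (N : nat) (f : 'I_N.+1 -> X -> k) (phi : X -> proj_space k N),
    closed_immersion phi /\
    forall x : X, exists (U : set X) (h : X -> k) (g : 'I_N.+1 -> X -> k),
      [/\ zopen U, U x, local_equation S U h,
          forall i, regular U (g i) /\
            (forall y, U y -> ~ S y -> g i y = f i y * h y ^+ m) &
          forall y, U y -> exists v : nzvec k N,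
            phi y = \pi_(projpt k N) v /\ forall i, val v 0 i = g i y].

Definition ample (X : space k) (S : set X) : Prop :=
  exists2 m : nat, (0 < m)%N & very_ample S m.

(* g vanishes to order i at p: near p, g is a unit times the i-th power of a  *)
(* uniformizer t.                                                             *)
Definition vanishing_order (p : proj_space k 1) (g : proj_space k 1 -> k)
    (i : nat) : Prop :=
  exists (U : set (proj_space k 1)) (t e : proj_space k 1 -> k),
    [/\ zopen U, U p, local_equation [set p] U t, regular U e &
        forall q, U q -> e q != 0 /\ g q = t q ^+ i * e q].

Variables (X : space k) (s : proj_space k 1 -> X).

(* Let S be the image of s, f a rational function on X, regular on the dense  *)
(* open set V, and D the divisor S + div f. If the local equation f h of D at *)
(* s p is the fraction a / b, then D meets S at s p with multiplicity         *)
(* ord_p (a o s) - ord_p (b o s); in particular S is not a component of D.    *)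
Definition local_intersection (V : set X) (f : X -> k) (p : proj_space k 1)
    (m : int) : Prop :=
  exists (U : set X) (h a b : X -> k) (i j : nat),
    [/\ [/\ zopen U, U (s p) & local_equation (range s) U h],
        regular U a /\ regular U b,
        forall x, U x -> V x -> f x * h x * b x = a x,
        vanishing_order p (fun q => a (s q)) i /\
        vanishing_order p (fun q => b (s q)) j &
        m = i%:Z - j%:Z].

(* S^2 = n, where S is the image of a closed immersion s : P^1 -> X: n is     *)
(* the intersection number S.D of S with a divisor D = S + div f, linearly    *)
(* equivalent to S, of which S is not a component. Equivalently, n is the     *)
(* degree of s^* O_X(S).                                                      *)
Definition self_intersection (n : int) : Prop :=
  exists (V : set X) (f : X -> k) (mult : projpt k 1 -> int)
      (Z : seq (projpt k 1)),
    [/\ zopen V /\ (forall U : set X, zopen U -> U !=set0 -> U `&` V !=set0),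
        regular V f,
        forall p, local_intersection V f p (mult p),
        uniq Z /\ (forall p, p \notin Z -> mult p = 0) &
        n = \sum_(p <- Z) mult p].
End Divisors.

Definition is_section (k : closedFieldType) d
    (s : proj_space k 1 -> hirzebruch k d) : Prop :=
  morphism s /\ forall p, ruling (s p) = p.

(* mathcomp-classical makes T -> k^o a commutative ring and a k-module; it is *)
(* a k-algebra.                                                               *)
Section FunctionAlgebra.
Variables (T : pointedType) (k : closedFieldType).

Lemma fct_scalerAl (a : k) (u v : T -> k^o) : a *: (u * v) = a *: u * v.
Proof. by apply/funext => x; exact: mulrA. Qed.

Lemma fct_scalerAr (a : k) (u v : T -> k^o) : a *: (u * v) = u * (a *: v).
Proof. by apply/funext => x; exact: mulrCA. Qed.

HB.instance Definition _ :=
  GRing.LSemiModule_isLSemiAlgebra.Build k (T -> k^o) fct_scalerAl.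
HB.instance Definition _ :=
  GRing.LSemiAlgebra_isSemiAlgebra.Build k (T -> k^o) fct_scalerAr.
End FunctionAlgebra.

(* The threefold a1 a4 - a2^b a3 = 1, where a1, ..., a4 are the entries       *)
(* 0, ..., 3, and its coordinate ring: the restrictions of polynomials.       *)
Section Threefold.
Variables (k : closedFieldType) (b : nat).

Definition threefold : set 'rV[k]_4 :=
  [set a | a 0 0 * a 0 3 - a 0 1 ^+ b * a 0 2 = 1].

Definition threefold_pt : Type := threefold.
HB.instance Definition _ := Choice.on threefold_pt.

Lemma threefold_1001 : row4 1 0 0 1 \in threefold.
Proof. by rewrite inE /threefold /= !mxE /= mulr1 mulr0 subr0. Qed.

HB.instance Definition _ := isPointed.Build threefold_pt
  (exist (fun a => a \in threefold) _ threefold_1001).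

Definition torus_act (t : k) (a : 'rV[k]_4) : 'rV[k]_4 :=
  row4 (t^-1 * a 0 0) (t * a 0 1) (t ^- b * a 0 2) (t * a 0 3).

Lemma torus_actP (t : k) (a : 'rV[k]_4) :
  t != 0 -> threefold a -> threefold (torus_act t a).
Proof.
move=> t0; rewrite /threefold /= !mxE /= => <-.
rewrite mulrACA mulVf // mul1r exprMn mulrACA divff ?mul1r //.
by rewrite expf_neq0.
Qed.

Definition polynomial_fun (f : threefold_pt -> k^o) : Prop :=
  exists P : {mpoly k[4]}, forall x, f x = P.@[fun i => val x 0 i].

Definition torus_invariant (f : threefold_pt -> k^o) : Prop :=
  forall t : k, t != 0 ->
  forall x y : threefold_pt, val y = torus_act t (val x) -> f y = f x.

Definition invariants : {pred threefold_pt -> k^o} :=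
  fun f => `[< polynomial_fun f /\ torus_invariant f >].

Lemma invariants_subalg : subalg_closed invariants.
Proof.
split.
- apply/asboolP; split; last by [].
  by exists 1 => x; rewrite meval1.
- move=> c f g /asboolP[[P fP] fT] /asboolP[[Q gQ] gT]; apply/asboolP; split.
    by exists (c *: P + Q) => x; rewrite mevalD mevalZ -fP -gQ.
  move=> t t0 x y e; rewrite /GRing.add /= /GRing.scale /=.
  by rewrite (fT _ t0 _ _ e) (gT _ t0 _ _ e).
- move=> f g /asboolP[[P fP] fT] /asboolP[[Q gQ] gT]; apply/asboolP; split.
    by exists (P * Q) => x; rewrite mevalM -fP -gQ.
  move=> t t0 x y e; rewrite /GRing.mul /=.
  by rewrite (fT _ t0 _ _ e) (gT _ t0 _ _ e).
Qed.

HB.instance Definition _ :=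
  GRing.isSubalgClosed.Build k (threefold_pt -> k^o) invariants
    invariants_subalg.

Definition inv_ring : Type := {f | f \in invariants}.
HB.instance Definition _ := SubChoice.on inv_ring.
HB.instance Definition _ := [SubChoice_isSubAlgebra of inv_ring by <:].
HB.instance Definition _ := [SubNzRing_isSubComNzRing of inv_ring by <:].
End Threefold.

(* Main.v *)
(* A section is [x0 : x1] |-> [x0 : x1 : A : B] with coprime forms A, B of degrees
   e + d and e, so it is the curve G = A y1 - B y0 = 0 and S^2 = d + 2 e = n. If
   e = 0 (or B = 0), a section disjoint from S is contracted by all multiples of
   S, so ampleness forces e > 0.

   On the complement, normalized by G = 1, choose a point tau of P^1 and forms
   C, D of degrees e + d - 1, e - 1 with B C - A D = u^b, u = x0 - tau x1. Then
   a2 = u and a1 = C y1 - D y0 have torus weights 1 and -1. For general tau, D does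
   not vanish at tau; this uses that in characteristic 0 the powers of linear forms
   span all forms. In that case a1 a2 is an A^1-fibration over A^1 whose only
   degenerate fibre consists of the reduced components a1 = 0 and a2 = 0. Modulo
   u^b, a1 x1 is the root rho(a1 a2) of a polynomial equation with a simple root at
   0, which Hensel's lemma provides; hence a4 = x1 / rho(0) + a2 Pi(a1 a2), with Pi
   chosen to cancel the higher terms of rho, satisfies a1 a4 = 1 mod a2^b, and a3
   is the quotient. This identifies the complement of S with F / T, both being
   covered by the affine planes a1 <> 0 and a2 <> 0.

   Finally every character of the ring of invariants is evaluation at a point of
   F, since a1 a4 or a2^b a3 is invertible there and the invariants become
   polynomials in a few fractions after localization. *)
Require Import Defs.
From HB Require Import structures.
From mathcomp Require Import all_boot all_order all_algebra generic_quotient.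
From mathcomp Require Import boolp classical_sets functions reals complex.
From mathcomp Require Import mpoly.
From mathcomp Require Import ring zify.

Set Implicit Arguments.
Unset Strict Implicit.
Unset Printing Implicit Defensive.

Import GRing.Theory.
Local Open Scope quotient_scope.
Local Open Scope classical_set_scope.
Local Open Scope ring_scope.

(** The exponent and the weights are forced by degrees. [G] has weight [l^(e+d) m], so a numerator
    [C y1 - D y0] with coefficients of one degree less gives [a1] the weight [l^-1], and [B C - A D]
    has degree [2 e + d - 1 = n - 1], which is [b]. Cramer's rule for the linear forms [A y1 - B y0]
    and [C y1 - D y0] turns this determinant into [B a1 - D = u^b y1 / G]; rescaled by the torus to
    [a1 = 1], this is the equation that [a1 x1] satisfies modulo a [b]-th power. At [u = 0] it reads
    [a1 x1 = D(tau) / B(tau)]. If [D(tau)] were 0, then [a1] and [a2] would vanish together on that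
    fibre, which is impossible on [F]: hence the search for a general [tau].

    The self-intersection is given only through unspecified local equations and rational functions.
    Such data are restricted to polynomial curves, where a regular function is a fraction [N / E],
    so that geometric statements become identities between polynomials in one variable. *)

Definition function_algebra (k : fieldType) (Y : Type) (C : set (Y -> k)) :=
  [/\ forall c, C (fun=> c),
      forall f g, C f -> C g -> C (fun y => f y + g y) &
      forall f g, C f -> C g -> C (fun y => f y * g y)].

(** * Algebras of functions and polynomial functions *)

Section FunctionAlgebras.
Variables (k : fieldType) (Y : Type) (C : set (Y -> k)).
Hypothesis CA : function_algebra C.

Lemma fa_cst c : C (fun=> c). Proof. by case: CA. Qed.

Lemma fa_add f g : C f -> C g -> C (fun y => f y + g y).
Proof. by case: CA => _ + _; apply. Qed.

Lemma fa_mul f g : C f -> C g -> C (fun y => f y * g y).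
Proof. by case: CA => _ _; apply. Qed.

Lemma fa_opp f : C f -> C (fun y => - f y).
Proof.
move=> Cf; have -> : (fun y => - f y) = (fun y => (-1) * f y).
  by apply/funext => y; rewrite mulN1r.
by apply: fa_mul => //; apply: fa_cst.
Qed.

Lemma fa_sub f g : C f -> C g -> C (fun y => f y - g y).
Proof. by move=> Cf Cg; apply: fa_add => //; apply: fa_opp. Qed.

Lemma fa_exp f n : C f -> C (fun y => f y ^+ n).
Proof.
move=> Cf; elim: n => [|n IHn]; first exact: fa_cst.
have -> : (fun y => f y ^+ n.+1) = (fun y => f y * f y ^+ n).
  by apply/funext => y; rewrite exprS.
exact: fa_mul.
Qed.

Lemma fa_sum (I : Type) (r : seq I) (F : I -> Y -> k) :
  (forall i, C (F i)) -> C (fun y => \sum_(i <- r) F i y).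
Proof.
move=> CF; elim: r => [|i r IHr].
  rewrite (_ : (fun _ => _) = fun=> 0); first exact: fa_cst.
  by apply/funext => y; rewrite big_nil.
rewrite (_ : (fun _ => _) = fun y => F i y + \sum_(j <- r) F j y).
  exact: fa_add.
by apply/funext => y; rewrite big_cons.
Qed.

Lemma fa_prod (I : Type) (r : seq I) (F : I -> Y -> k) :
  (forall i, C (F i)) -> C (fun y => \prod_(i <- r) F i y).
Proof.
move=> CF; elim: r => [|i r IHr].
  rewrite (_ : (fun _ => _) = fun=> 1); first exact: fa_cst.
  by apply/funext => y; rewrite big_nil.
rewrite (_ : (fun _ => _) = fun y => F i y * \prod_(j <- r) F j y).
  exact: fa_mul.
by apply/funext => y; rewrite big_cons.
Qed.

Lemma fa_horner (P : {poly k}) f : C f -> C (fun y => P.[f y]).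
Proof.
move=> Cf; rewrite (_ : (fun _ => _) = fun y => \sum_(i < size P) P`_i * f y ^+ i).
  by apply: fa_sum => i; apply: fa_mul; [apply: fa_cst | apply: fa_exp].
by apply/funext => y; rewrite horner_coef.
Qed.

(** The same closure argument serves polynomial functions of a parameter, regular functions on an
    open set, and the localized functions in [character_at_point]. *)
Lemma fa_meval m (P : {mpoly k[m]}) (a : 'I_m -> Y -> k) :
  (forall i, C (a i)) -> C (fun y => P.@[fun i => a i y]).
Proof.
move=> Ca; rewrite (_ : (fun _ => _) =
    fun y => \sum_(w <- msupp P) P@_w * \prod_i a i y ^+ w i).
  apply: fa_sum => w; apply: fa_mul; first exact: fa_cst.
  by apply: fa_prod => i; apply: fa_exp.
by apply/funext => y; rewrite mevalE.
Qed.
End FunctionAlgebras.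

Lemma regular_fa (k : fieldType) (X : Defs.space k) (U : set X) :
  function_algebra (regular (s := X) U).
Proof.
by split; [apply: regular_cst | apply: regularD | apply: regularM].
Qed.

Definition polyfun (k : fieldType) : set (GRing.Field.sort k -> k) :=
  [set f | exists P : {poly k}, forall x, f x = P.[x]].

Lemma polyfun_fa (k : fieldType) : function_algebra (@polyfun k).
Proof.
split=> [c|f g [P fP] [Q gQ]|f g [P fP] [Q gQ]].
- by exists c%:P => x; rewrite hornerC.
- by exists (P + Q) => x; rewrite hornerD fP gQ.
- by exists (P * Q) => x; rewrite hornerM fP gQ.
Qed.

Lemma polyfun_id (k : fieldType) : @polyfun k id.
Proof. by exists 'X => x; rewrite hornerX. Qed.

Definition mpolyfun (k : closedFieldType) m : set ('rV[k]_m -> k) :=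
  [set f | exists P : {mpoly k[m]}, forall x, f x = peval x P].

Lemma mpolyfun_fa (k : closedFieldType) m : function_algebra (@mpolyfun k m).
Proof.
split=> [c|f g [P fP] [Q gQ]|f g [P fP] [Q gQ]].
- by exists c%:MP => x; rewrite /= mevalC.
- by exists (P + Q) => x; rewrite rmorphD fP gQ.
- by exists (P * Q) => x; rewrite rmorphM fP gQ.
Qed.

Lemma mpolyfun_coord (k : closedFieldType) m (i : 'I_m) :
  mpolyfun (fun x : 'rV[k]_m => x 0 i).
Proof. by exists 'X_i => x; rewrite /= mevalXU. Qed.

(** The product [N * (P - Q)] vanishes at every point. If it were a nonzero polynomial, it would be
    nonconstant, and [N * (P - Q) + 1] would have no root, against algebraic closedness. *)
Lemma poly_eq_cofinite (k : closedFieldType) (P Q N : {poly k}) :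
  N != 0 -> (forall x, N.[x] != 0 -> P.[x] = Q.[x]) -> P = Q.
Proof.
move=> N0 PQ; apply/eqP; rewrite -subr_eq0; apply/negPn/negP => D0.
have ND x : (N * (P - Q)).[x] = 0.
  rewrite hornerM hornerD hornerN; have [->|Nx] := eqVneq N.[x] 0; first by rewrite mul0r.
  by rewrite PQ // subrr mulr0.
have rt1 : size (N * (P - Q) + 1) == 1.
  by apply/negPn/negP => /closed_rootP[x]; rewrite /root hornerD ND hornerC add0r oner_eq0.
move: rt1; have s0 : N * (P - Q) != 0 by rewrite mulf_neq0.
have [/size1_polyC e|sg] := leqP (size (N * (P - Q))) 1.
  have := ND 0; rewrite e hornerC => e0; by move: s0; rewrite e e0 eqxx.
by rewrite size_polyDl ?size_poly1 // => /eqP e; rewrite e in sg.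
Qed.

Lemma polyfun_eq (k : closedFieldType) (f g : k -> k) (N : {poly k}) :
  polyfun f -> polyfun g -> N != 0 ->
  (forall x, N.[x] != 0 -> f x = g x) -> forall x, f x = g x.
Proof.
move=> [P fP] [Q gQ] N0 fg x; rewrite fP gQ.
by rewrite (@poly_eq_cofinite k P Q N) // => y Ny; rewrite -fP -gQ fg.
Qed.

Lemma nonroot (k : closedFieldType) (P : {poly k}) :
  P != 0 -> exists x, P.[x] != 0.
Proof.
move=> P0; have [/size1_polyC e|sP] := leqP (size P) 1.
  by exists 0; rewrite e hornerC; apply: contraNneq P0 => e0; rewrite e e0.
apply: contrapT => H; move/eqP: P0; apply.
apply: (@poly_eq_cofinite k _ _ 1); first exact: oner_neq0.
by move=> x _; rewrite horner0; apply: contrapT => Px; apply: H; exists x; apply/eqP.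
Qed.

(** * Quotients of subsets of affine space, tested by polynomials upstairs *)

Section AffineQuotient.
Variables (k : closedFieldType) (m : nat) (S : set 'rV[k]_m) (T : Type).
Variable q : S -> T.
Let X := quot_space (X := sub_space (S : set (affine k m))) q.

Lemma quot_zopenP (U : set T) : zopen (s := X) U <->
  forall x : S, U (q x) -> exists2 b : {mpoly k[m]},
    peval (val x) b != 0 & forall y : S, peval (val y) b != 0 -> U (q y).
Proof.
split=> [[W oW e] x Ux|H].
  have : (val @^-1` W) x by rewrite -e.
  move=> /oW[b bx bW]; exists b => // y /bW Wy.
  by have : (q @^-1` U) y by rewrite e.
exists [set x | exists2 b : {mpoly k[m]},
    peval x b != 0 & forall y : S, peval (val y) b != 0 -> U (q y)].
  by move=> x [b bx bU]; exists b => // y yb; exists b.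
apply/seteqP; split=> x; first exact: H.
by move=> [b bx]; apply.
Qed.

Lemma quot_regularP (U : set T) (g : T -> k) : regular (s := X) U g <->
  forall x : S, U (q x) -> exists a b : {mpoly k[m]},
    peval (val x) b != 0 /\ forall y : S, U (q y) -> peval (val y) b != 0 ->
      g (q y) = peval (val y) a / peval (val y) b.
Proof.
split=> [H x Ux|H x /H[a [b [bx ab]]]].
  have [W [f [oW Wx rf ff]]] := H x Ux.
  have [a [b [bx ab]]] := rf _ Wx; have [c cx cW] := oW _ Wx.
  exists (a * c), (b * c); split; first by rewrite rmorphM mulf_neq0.
  move=> y Uy; rewrite !rmorphM mulf_eq0 negb_or => /andP[by0 cy0].
  by rewrite -mulf_div divff // mulr1 ff //=; [apply: ab => //|]; apply: cW.
exists [set x | peval x b != 0], (fun x => peval x a / peval x b).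
split.
- by move=> y yb; exists b.
- exact: bx.
- by move=> y yb; exists a, b.
- by move=> y Uy yb; apply: ab.
Qed.
End AffineQuotient.

(** * Morphisms to quotients of quasi-affine varieties and to spectra *)

Lemma affine_zopenI (k : closedFieldType) m (U : set 'rV[k]_m) :
  (forall x, U x -> exists b : 'rV[k]_m -> k,
    [/\ mpolyfun b, b x != 0 & forall y, b y != 0 -> U y]) ->
  zopen (s := affine k m) U.
Proof.
move=> H x /H[b [[B bB] bx bU]]; exists B; first by have := bx; rewrite bB.
by move=> y By; apply: bU; rewrite bB.
Qed.

Section AffineQuotientPoints.
Variables (k : closedFieldType) (m : nat) (S : set 'rV[k]_m) (T : Type).
Variables (q : S -> T) (t0 : T).
Let X := quot_space (X := sub_space (S : set (affine k m))) q.

(** Extending [q] to the whole ambient space, with the junk value [t0] outside [S], allows points to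
    be given by coordinates without carrying membership proofs. *)
Definition qpt (x : 'rV[k]_m) : T :=
  if pselect (S x) is left Sx
  then q (exist (fun x => x \in S) x (mem_set Sx)) else t0.

Lemma qptE (y : S) : qpt (val y) = q y.
Proof.
rewrite /qpt; case: pselect => [Sy|[]]; last exact: set_mem (valP y).
by congr q; apply: val_inj.
Qed.

Lemma qptP (x : 'rV[k]_m) : S x -> exists2 y : S, val y = x & qpt x = q y.
Proof.
move=> Sx; exists (exist (fun x => x \in S) x (mem_set Sx)) => //.
by rewrite -qptE.
Qed.

Lemma quot_regularI (U : set T) (g : T -> k) :
  (forall x, S x -> U (qpt x) -> exists a b : 'rV[k]_m -> k,
    [/\ mpolyfun a, mpolyfun b, b x != 0 &
        forall y, S y -> U (qpt y) -> b y != 0 -> g (qpt y) = a y / b y]) ->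
  regular (s := X) U g.
Proof.
move=> H; apply/quot_regularP => x; rewrite -qptE => Ux.
have [a [b [[A aA] [B bB] bx ab]]] := H _ (set_mem (valP x)) Ux.
exists A, B; split; first by rewrite -bB.
by move=> y; rewrite -qptE -aA -bB => Uy yb; apply: ab => //; apply: set_mem (valP y).
Qed.

Lemma quot_zopenI (U : set T) :
  (forall x, S x -> U (qpt x) -> exists b : 'rV[k]_m -> k,
    [/\ mpolyfun b, b x != 0 & forall y, S y -> b y != 0 -> U (qpt y)]) ->
  zopen (s := X) U.
Proof.
move=> H; apply/quot_zopenP => x; rewrite -qptE => Ux.
have [b [[B bB] bx bU]] := H _ (set_mem (valP x)) Ux.
exists B; first by rewrite -bB.
by move=> y; rewrite -qptE -bB; apply: bU; apply: set_mem (valP y).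
Qed.

(** Substituting the curve into the polynomials that witness openness of [S], openness of [U] and
    regularity of [g] gives polynomials in [t], and one denominator can control all three
    conditions. *)
Lemma quot_curve (U : set T) (g : T -> k) (c : k -> 'rV[k]_m) (s : k) :
  zopen (s := affine k m) S -> zopen (s := X) U -> regular (s := X) U g ->
  (forall i, polyfun (fun t => c t 0 i)) -> S (c s) -> U (qpt (c s)) ->
  exists N E : {poly k}, E.[s] != 0 /\
    forall t, E.[t] != 0 ->
      [/\ S (c t), U (qpt (c t)) & g (qpt (c t)) = N.[t] / E.[t]].
Proof.
move=> oS /quot_zopenP oU /quot_regularP rg cP Sc Uc.
have pc (P : {mpoly k[m]}) : exists Q : {poly k}, forall t, peval (c t) P = Q.[t].
  by have [Q eQ] := fa_meval (polyfun_fa k) P cP; exists Q.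
have [y ey eq] := qptP Sc; rewrite eq in Uc.
have [a [b [bx ab]]] := rg _ Uc; have [e ex eU] := oU _ Uc.
have [w wx wS] := oS _ Sc.
have [[A eA] [[B eB] [[E eE] [W eW]]]] := (pc a, (pc b, (pc e, pc w))).
rewrite ey eB in bx; rewrite ey eE in ex; rewrite eW in wx.
(* The common factor [E * W] leaves the fraction unchanged and makes the denominator detect
   membership in [U] and [S] as well. *)
exists (A * (E * W)), (B * (E * W)); split.
  by rewrite !hornerM !mulf_neq0.
move=> t; rewrite !hornerM !mulf_eq0 !negb_or => /and3P[Bt Et Wt].
have St : S (c t) by apply: wS; rewrite eW.
have [z ez ezq] := qptP St.
have Ut : U (q z) by apply: eU; rewrite ez eE.
rewrite ezq; split=> //.
rewrite ab // ?ez ?eB // eA -mulf_div divff ?mulr1 //.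
by rewrite mulf_neq0.
Qed.

Lemma morphism_to_quot (Y : Defs.space k) (f : Y -> X) :
  (forall y, exists (W : set Y) (a : Y -> 'rV[k]_m),
     [/\ zopen W, W y, forall i, regular W (fun z => a z 0 i) &
         forall z, W z -> S (a z) /\ f z = qpt (a z)]) ->
  morphism f.
Proof.
move=> H V oV.
have ra (W : set Y) (a : Y -> 'rV[k]_m) (P : {mpoly k[m]}) :
    (forall i, regular W (fun z => a z 0 i)) ->
    regular W (fun z => peval (a z) P).
  exact: (fa_meval (regular_fa W)).
split.
  apply: zopen_local => y Vy; have [W [a [oW Wy rW fW]]] := H y.
  have [Sy ey] := fW _ Wy; have [z ez eqz] := qptP Sy.
  have Vz : V (q z) by rewrite -eqz -ey.
  have [b bz bV] := (quot_zopenP _ _).1 oV _ Vz.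
  exists (W `&` [set z | peval (a z) b != 0]); split.
  - exact: (regularV oW (ra _ _ b rW)).1.
  - by split=> //=; rewrite -ez.
  - move=> u [Wu bu]; have [Su eu] := fW _ Wu; have [v ev eqv] := qptP Su.
    by rewrite /= eu eqv; apply: bV; rewrite ev.
move=> g rg; apply: regular_local => y Vy; have [W [a [oW Wy rW fW]]] := H y.
have [Sy ey] := fW _ Wy; have [z ez eqz] := qptP Sy.
have Vz : V (q z) by rewrite -eqz -ey.
have [n [b [bz nb]]] := (quot_regularP _ _ _).1 rg _ Vz.
have [oW' rW'] := regularV oW (ra _ _ b rW).
exists (W `&` [set z | peval (a z) b != 0]),
  (fun z => peval (a z) n * (peval (a z) b)^-1); split=> //.
- by split=> //=; rewrite -ez.
- by apply: regularM rW'; apply: regular_sub (ra _ _ n rW) => u [].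
- move=> u Vu [Wu bu]; have [Su eu] := fW _ Wu; have [v ev eqv] := qptP Su.
  by rewrite eu eqv nb ?ev // -eqv -eu.
Qed.
End AffineQuotientPoints.

Lemma morphism_sub (k : fieldType) (X Y : Defs.space k) (S : set X)
    (f : Y -> sub_space S) :
  morphism (fun y => val (f y) : X) -> morphism f.
Proof.
move=> mf V [W oW ->]; split; first exact: (mf _ oW).1.
move=> g rg; apply: regular_local => y Vy.
have [W' [h [oW' Wy rh gh]]] := rg _ Vy.
have [oP rP] := mf _ oW'.
exists ((fun y => val (f y) : X) @^-1` W'), (fun y => h (val (f y))); split=> //.
  exact: rP.
by move=> z Vz Wz; apply: gh.
Qed.

Lemma morphism_Spec (k : closedFieldType) (A : comAlgType k) (Y : Defs.space k)
    (f : Y -> Spec A) :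
  (forall a : A, regular setT (fun y => f y a)) -> morphism f.
Proof.
move=> rf V oV; have H (a : A) : zopen [set y | f y a != 0] /\
    regular [set y | f y a != 0] (fun y => (f y a)^-1).
  by have := regularV (zopenT Y) (rf a); rewrite setTI.
split.
  apply: zopen_local => y /oV[b by0 bV].
  by exists [set y | f y b != 0]; split=> //; [apply: (H b).1 | move=> z; apply: bV].
move=> g rg; apply: regular_local => y Vy; have [a [b [by0 ab]]] := rg _ Vy.
exists [set y | f y b != 0], (fun y => f y a * (f y b)^-1); split=> //.
- exact: (H b).1.
- by apply: regularM (H b).2; apply: regular_sub (rf a).
- by move=> z Vz; apply: ab.
Qed.

(** * Homogeneous coordinates *)

Section Points.
Variable k : closedFieldType.
Implicit Types a b c l t : k.

Definition row2 a b : 'rV[k]_2 := \row_(i < 2) [:: a; b]`_i.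

Lemma row2E (v : 'rV[k]_2) : v = row2 (v 0 0) (v 0 1).
Proof.
apply/rowP => i; rewrite mxE.
by case: i => [[|[|//]] h] /=; congr (v _ _); apply: val_inj.
Qed.

Lemma row4E (x : 'rV[k]_4) : x = row4 (x 0 0) (x 0 1) (x 0 2) (x 0 3).
Proof.
apply/rowP => i; rewrite mxE.
by case: i => [[|[|[|[|//]]]] h] /=; congr (x _ _); apply: val_inj.
Qed.

Lemma row2_0 a b : row2 a b 0 0 = a. Proof. by rewrite mxE. Qed.
Lemma row2_1 a b : row2 a b 0 1 = b. Proof. by rewrite mxE. Qed.

Lemma row2_neq0 a b : (row2 a b != 0) = ((a, b) != (0, 0)).
Proof.
congr (~~ _); apply/eqP/eqP => [e|[-> ->]].
  by have := row2_0 a b; have := row2_1 a b; rewrite e !mxE => <- <-.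
by apply/rowP => i; rewrite !mxE; case: i => [[|[|]]].
Qed.

Lemma pair_neq0 a b : ((a, b) != (0, 0)) = (a != 0) || (b != 0).
Proof. by rewrite xpair_eqE negb_and. Qed.

Lemma row4_0 a b c l : row4 a b c l 0 0 = a. Proof. by rewrite mxE. Qed.
Lemma row4_1 a b c l : row4 a b c l 0 1 = b. Proof. by rewrite mxE. Qed.
Lemma row4_2 a b c l : row4 a b c l 0 2 = c. Proof. by rewrite mxE. Qed.
Lemma row4_3 a b c l : row4 a b c l 0 3 = l. Proof. by rewrite mxE. Qed.
Definition row4C := (row4_0, row4_1, row4_2, row4_3).

Let P1set : set 'rV[k]_2 := [set x | x != 0].

Lemma P1set_row2 a b : P1set (row2 a b) = ((a, b) != (0, 0)).
Proof. by rewrite /P1set /= row2_neq0. Qed.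

Lemma row2_10_in : row2 1 0 \in P1set.
Proof. by rewrite inE P1set_row2 pair_neq0 oner_eq0. Qed.

Definition P1pt a b : proj_space k 1 :=
  qpt (fun v : nzvec k 1 => \pi_(projpt k 1) v)
    (\pi_(projpt k 1) (exist (fun v => v \in P1set) _ row2_10_in : nzvec k 1))
    (row2 a b).

Lemma P1ptE (v : nzvec k 1) : P1pt (val v 0 0) (val v 0 1) = \pi_(projpt k 1) v.
Proof. by rewrite /P1pt -row2E qptE. Qed.

Lemma P1ptP a b : (a, b) != (0, 0) ->
  exists2 v : nzvec k 1, val v = row2 a b & P1pt a b = \pi_(projpt k 1) v.
Proof. by move=> ab; apply: qptP; rewrite /= row2_neq0. Qed.

Lemma P1pt_surj (p : proj_space k 1) :
  exists a b, (a, b) != (0, 0) /\ p = P1pt a b.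
Proof.
exists (val (repr (p : projpt k 1)) 0 0), (val (repr (p : projpt k 1)) 0 1).
split; last by rewrite P1ptE reprK.
by rewrite -row2_neq0 -row2E; have /set_mem := valP (repr (p : projpt k 1)).
Qed.

Lemma P1pt_eq a b a' b' : (a, b) != (0, 0) -> (a', b') != (0, 0) ->
  P1pt a b = P1pt a' b' <-> exists2 c, c != 0 & a' = c * a /\ b' = c * b.
Proof.
move=> /P1ptP[v ev ->] /P1ptP[v' ev' ->]; split.
  move=> /eqmodP/asboolP[c c0]; rewrite ev ev' => e.
  exists c => //.
  by have := row2_0 a' b'; have := row2_1 a' b'; rewrite e !mxE => <- <-.
move=> [c c0 [ea eb]]; apply/eqmodP/asboolP; exists c => //.
by apply/rowP => i; rewrite ev ev' ea eb !mxE; case: i => [[|[|//]] h].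
Qed.

Lemma P1pt_scale a b c : c != 0 -> (a, b) != (0, 0) ->
  P1pt (c * a) (c * b) = P1pt a b.
Proof.
move=> c0 ab; apply/esym/P1pt_eq => //; last by exists c.
by move: ab; rewrite !pair_neq0 !mulf_eq0 (negPf c0).
Qed.

Variable d : nat.

Definition coxp a b c l : bool := ((a, b) != (0, 0)) && ((c, l) != (0, 0)).

Lemma cox_row4 a b c l : @cox k (row4 a b c l) <-> coxp a b c l.
Proof. by rewrite /cox /= !row4C; split=> [[? ?]|/andP[]]; first exact/andP. Qed.

Lemma row4_1001_in : row4 1 0 0 1 \in @cox k.
Proof. by apply/mem_set/cox_row4; rewrite /coxp !pair_neq0 oner_eq0 orbT. Qed.

Definition Hq (x : 'rV[k]_4) : hirzebruch k d :=
  qpt (fun x : coxpt k => \pi_(hirzpt k d) x)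
    (\pi_(hirzpt k d) (exist (fun x => x \in @cox k) _ row4_1001_in : coxpt k)) x.

Definition Hpt a b c l : hirzebruch k d := Hq (row4 a b c l).

Lemma HptE (v : coxpt k) :
  Hpt (val v 0 0) (val v 0 1) (val v 0 2) (val v 0 3) = \pi_(hirzpt k d) v.
Proof. by rewrite /Hpt -row4E /Hq qptE. Qed.

Lemma HptP a b c l : coxp a b c l ->
  exists2 v : coxpt k, val v = row4 a b c l & Hpt a b c l = \pi_(hirzpt k d) v.
Proof. by move=> /cox_row4 ab; apply: qptP. Qed.

Lemma Hpt_surj (p : hirzebruch k d) :
  exists x0 x1 y0 y1, coxp x0 x1 y0 y1 /\ p = Hpt x0 x1 y0 y1.
Proof.
set v := repr (p : hirzpt k d).
exists (val v 0 0), (val v 0 1), (val v 0 2), (val v 0 3).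
split; last by rewrite HptE reprK.
by apply/cox_row4; rewrite -row4E; apply/set_mem/(valP v).
Qed.

Lemma coxp_act x0 x1 y0 y1 l m : l != 0 -> m != 0 ->
  coxp (l * x0) (l * x1) (l ^+ d * m * y0) (m * y1) = coxp x0 x1 y0 y1.
Proof.
move=> l0 m0; rewrite /coxp !pair_neq0 !mulf_eq0 (negPf l0) (negPf m0).
by rewrite expf_eq0 (negPf l0) andbF.
Qed.

Lemma Hpt_eq x0 x1 y0 y1 x0' x1' y0' y1' :
  coxp x0 x1 y0 y1 -> coxp x0' x1' y0' y1' ->
  Hpt x0 x1 y0 y1 = Hpt x0' x1' y0' y1' <->
  exists l m, [/\ l != 0, m != 0 & [/\ x0' = l * x0, x1' = l * x1,
     y0' = l ^+ d * m * y0 & y1' = m * y1]].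
Proof.
move=> /HptP[v ev ->] /HptP[v' ev' ->]; split.
  move=> /eqmodP/asboolP[l [m [l0 m0]]]; rewrite ev ev' => e.
  exists l, m; split=> //.
  have := row4_0 x0' x1' y0' y1'; have := row4_1 x0' x1' y0' y1'.
  have := row4_2 x0' x1' y0' y1'; have := row4_3 x0' x1' y0' y1'.
  by rewrite e !row4C => <- <- <- <-; split.
move=> [l [m [l0 m0 [e0 e1 e2 e3]]]]; apply/eqmodP/asboolP; exists l, m.
by split=> //; rewrite ev ev' e0 e1 e2 e3 /cox_act !row4C.
Qed.

Lemma Hpt_act x0 x1 y0 y1 l m : l != 0 -> m != 0 -> coxp x0 x1 y0 y1 ->
  Hpt (l * x0) (l * x1) (l ^+ d * m * y0) (m * y1) = Hpt x0 x1 y0 y1.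
Proof.
move=> l0 m0 cx; apply/esym/Hpt_eq => //; first by rewrite coxp_act.
by exists l, m.
Qed.

Lemma ruling_Hpt x0 x1 y0 y1 : coxp x0 x1 y0 y1 ->
  ruling (Hpt x0 x1 y0 y1) = P1pt x0 x1.
Proof.
move=> /HptP[v ev ->]; rewrite ruling_pi -P1ptE.
by congr P1pt; rewrite mxE /= ev mxE.
Qed.

Lemma zopen_coord_pair m (i j : 'I_m) :
  zopen (s := affine k m) [set x | (x 0 i, x 0 j) != (0, 0)].
Proof.
apply: affine_zopenI => x /=; rewrite pair_neq0 => /orP[] x0.
  exists (fun x => x 0 i); split=> //; first exact: mpolyfun_coord.
  by move=> y y0; rewrite /= pair_neq0 y0.
exists (fun x => x 0 j); split=> //; first exact: mpolyfun_coord.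
by move=> y y0; rewrite /= pair_neq0 y0 orbT.
Qed.

Lemma zopen_P1set : zopen (s := affine k 2) P1set.
Proof.
have := @zopen_coord_pair 2 0 1; congr zopen; apply/funext => x /=.
by rewrite {3}(row2E x) P1set_row2.
Qed.

Lemma zopen_cox : zopen (s := affine k 4) (@cox k).
Proof.
by have := zopenI (@zopen_coord_pair 4 0 1) (@zopen_coord_pair 4 2 3).
Qed.

Lemma P1_curve (U : set (proj_space k 1)) (g : proj_space k 1 -> k)
    (p0 p1 : k -> k) (s : k) :
  zopen U -> regular U g -> polyfun p0 -> polyfun p1 ->
  (p0 s, p1 s) != (0, 0) -> U (P1pt (p0 s) (p1 s)) ->
  exists N E : {poly k}, E.[s] != 0 /\
    forall t, E.[t] != 0 -> [/\ (p0 t, p1 t) != (0, 0), U (P1pt (p0 t) (p1 t)) &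
      g (P1pt (p0 t) (p1 t)) = N.[t] / E.[t]].
Proof.
move=> oU rg P0 P1 nz Us.
have cP i : polyfun (fun t => row2 (p0 t) (p1 t) 0 i).
  have [->|->] : i = 0 \/ i = 1.
    by case: i => [[|[|//]] h]; [left|right]; apply: val_inj.
    by under eq_fun do rewrite row2_0.
  by under eq_fun do rewrite row2_1.
have [] := quot_curve zopen_P1set oU rg cP _ Us; first by rewrite P1set_row2.
move=> N [E [Es NE]]; exists N, E; split=> // t /NE[].
by rewrite P1set_row2.
Qed.

Lemma H_curve (U : set (hirzebruch k d)) (g : hirzebruch k d -> k)
    (p0 p1 p2 p3 : k -> k) (s : k) :
  zopen U -> regular U g ->
  polyfun p0 -> polyfun p1 -> polyfun p2 -> polyfun p3 ->
  coxp (p0 s) (p1 s) (p2 s) (p3 s) -> U (Hpt (p0 s) (p1 s) (p2 s) (p3 s)) ->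
  exists N E : {poly k}, E.[s] != 0 /\
    forall t, E.[t] != 0 -> [/\ coxp (p0 t) (p1 t) (p2 t) (p3 t),
      U (Hpt (p0 t) (p1 t) (p2 t) (p3 t)) &
      g (Hpt (p0 t) (p1 t) (p2 t) (p3 t)) = N.[t] / E.[t]].
Proof.
move=> oU rg P0 P1 P2 P3 nz Us.
have cP i : polyfun (fun t => row4 (p0 t) (p1 t) (p2 t) (p3 t) 0 i).
  have [->|[->|[->|->]]] : i = 0 \/ i = 1 \/ i = 2 \/ i = 3.
  - case: i => [[|[|[|[|//]]]] h]; [left|right;left|do 2!right;left|do 3!right];
      exact: val_inj.
  - by under eq_fun do rewrite row4_0.
  - by under eq_fun do rewrite row4_1.
  - by under eq_fun do rewrite row4_2.
  - by under eq_fun do rewrite row4_3.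
have [] := quot_curve zopen_cox oU rg cP _ Us; first exact/cox_row4.
move=> N [E [Es NE]]; exists N, E; split=> // t /NE[].
by move/cox_row4.
Qed.
End Points.

Ltac fa CA := repeat first
  [ exact: mpolyfun_coord | exact: polyfun_id | assumption
  | exact: (fa_cst CA) | apply: (fa_add CA) | apply: (fa_mul CA)
  | apply: (fa_opp CA) | apply: (fa_exp CA) | apply: (fa_horner CA) ].

(** * Functions on the Hirzebruch surface in Cox coordinates *)

Section HirzebruchFunctions.
Variables (k : closedFieldType) (d : nat).
Implicit Types (p : hirzebruch k d).

(** Evaluation at the chosen representative of the class: the value is canonical only when [F] is
    invariant, as in [HliftE]. *)
Definition Hlift (T : Type) (F : k -> k -> k -> k -> T) p : T :=
  let v := val (repr (p : hirzpt k d)) in F (v 0 0) (v 0 1) (v 0 2) (v 0 3).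

Definition cox_invariant (T : Type) (F : k -> k -> k -> k -> T) :=
  forall l m x0 x1 y0 y1, l != 0 -> m != 0 -> coxp x0 x1 y0 y1 ->
    F (l * x0) (l * x1) (l ^+ d * m * y0) (m * y1) = F x0 x1 y0 y1.

Lemma HliftE T (F : k -> k -> k -> k -> T) x0 x1 y0 y1 :
  cox_invariant F -> coxp x0 x1 y0 y1 ->
  Hlift F (Hpt d x0 x1 y0 y1) = F x0 x1 y0 y1.
Proof.
move=> iF cx; have [v ev eq] := HptP d cx; rewrite eq /Hlift.
set w := repr _; have cw : coxp (val w 0 0) (val w 0 1) (val w 0 2) (val w 0 3).
  by apply/cox_row4; rewrite -row4E; apply/set_mem/(valP w).
have [|l [m [l0 m0 [-> -> -> ->]]]] := (Hpt_eq d cx cw).1; last by rewrite iF.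
by rewrite HptE reprK eq.
Qed.

Definition mpolyfun4 (F : k -> k -> k -> k -> k) :=
  mpolyfun (fun x : 'rV[k]_4 => F (x 0 0) (x 0 1) (x 0 2) (x 0 3)).

Lemma H_zopenI (U : set (hirzebruch k d)) :
  (forall x0 x1 y0 y1, coxp x0 x1 y0 y1 -> U (Hpt d x0 x1 y0 y1) ->
     exists b, [/\ mpolyfun4 b, b x0 x1 y0 y1 != 0 &
       forall z0 z1 w0 w1, coxp z0 z1 w0 w1 -> b z0 z1 w0 w1 != 0 ->
         U (Hpt d z0 z1 w0 w1)]) ->
  zopen U.
Proof.
move=> H; apply: (@quot_zopenI k 4 (@cox k) (hirzpt k d)
  (fun x : coxpt k => \pi_(hirzpt k d) x) (Hpt d 1 0 0 1)) => x Sx.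
have [z ez ->] := qptP (fun x : coxpt k => \pi_(hirzpt k d) x) (Hpt d 1 0 0 1) Sx.
rewrite -HptE ez => Ux; have [|b [pb bx bU]] := H _ _ _ _ _ Ux.
  by apply/cox_row4; rewrite -row4E.
exists (fun x => b (x 0 0) (x 0 1) (x 0 2) (x 0 3)); split=> // y Sy Dy.
have [w ew ->] := qptP (fun x : coxpt k => \pi_(hirzpt k d) x) (Hpt d 1 0 0 1) Sy.
by rewrite -HptE ew; apply: bU => //; apply/cox_row4; rewrite -row4E.
Qed.

Lemma H_regularI (U : set (hirzebruch k d)) (g : hirzebruch k d -> k) :
  (forall x0 x1 y0 y1, coxp x0 x1 y0 y1 -> U (Hpt d x0 x1 y0 y1) ->
     exists a b, [/\ mpolyfun4 a, mpolyfun4 b, b x0 x1 y0 y1 != 0 &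
       forall z0 z1 w0 w1, coxp z0 z1 w0 w1 -> U (Hpt d z0 z1 w0 w1) ->
         b z0 z1 w0 w1 != 0 ->
         g (Hpt d z0 z1 w0 w1) = a z0 z1 w0 w1 / b z0 z1 w0 w1]) ->
  regular U g.
Proof.
move=> H; apply: (@quot_regularI k 4 (@cox k) (hirzpt k d)
  (fun x : coxpt k => \pi_(hirzpt k d) x) (Hpt d 1 0 0 1)) => x Sx.
have [z ez ->] := qptP (fun x : coxpt k => \pi_(hirzpt k d) x) (Hpt d 1 0 0 1) Sx.
rewrite -HptE ez => Ux; have [|a [b [pa pb bx ab]]] := H _ _ _ _ _ Ux.
  by apply/cox_row4; rewrite -row4E.
exists (fun x => a (x 0 0) (x 0 1) (x 0 2) (x 0 3)).
exists (fun x => b (x 0 0) (x 0 1) (x 0 2) (x 0 3)); split=> // y Sy.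
have [w ew ->] := qptP (fun x : coxpt k => \pi_(hirzpt k d) x) (Hpt d 1 0 0 1) Sy.
by rewrite -HptE ew; apply: ab => //; apply/cox_row4; rewrite -row4E.
Qed.

Lemma Hlift_zopen (D : k -> k -> k -> k -> k) :
  cox_invariant (fun x0 x1 y0 y1 => D x0 x1 y0 y1 != 0) -> mpolyfun4 D ->
  zopen [set p | Hlift (fun x0 x1 y0 y1 => D x0 x1 y0 y1 != 0) p].
Proof.
move=> iD pD; apply: H_zopenI => x0 x1 y0 y1 cx; rewrite /= HliftE // => Dx.
by exists D; split=> // z0 z1 w0 w1 cz Dz; rewrite HliftE.
Qed.

Lemma Hlift_regular (W : set (hirzebruch k d)) (F N D : k -> k -> k -> k -> k) :
  cox_invariant F -> mpolyfun4 N -> mpolyfun4 D ->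
  (forall x0 x1 y0 y1, coxp x0 x1 y0 y1 -> W (Hpt d x0 x1 y0 y1) ->
     D x0 x1 y0 y1 != 0 /\ F x0 x1 y0 y1 = N x0 x1 y0 y1 / D x0 x1 y0 y1) ->
  regular W (Hlift F).
Proof.
move=> iF pN pD FND; apply: H_regularI => x0 x1 y0 y1 cx Wx.
exists N, D; split=> //; first by case: (FND _ _ _ _ cx Wx).
by move=> z0 z1 w0 w1 cz Wz _; rewrite HliftE //; case: (FND _ _ _ _ cz Wz).
Qed.
End HirzebruchFunctions.

(** * Binary forms *)

Section Forms.
Variable k : closedFieldType.
Implicit Types (P Q : {poly k}) (x y : k).

(** The homogenization of [P] to degree [m]. Coefficients of [P] above [m] are dropped, whence the
    size bounds in the evaluation lemmas. *)
Definition bform (m : nat) P x y := \sum_(i < m.+1) P`_i * x ^+ i * y ^+ (m - i).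

Lemma bform_scale m P l x y : bform m P (l * x) (l * y) = l ^+ m * bform m P x y.
Proof.
rewrite /bform mulr_sumr; apply: eq_bigr => i _; rewrite !exprMn.
have -> : l ^+ m = l ^+ i * l ^+ (m - i) by rewrite -exprD subnKC // -ltnS.
by ring.
Qed.

Lemma bform_x1 m P x : (size P <= m.+1)%N -> bform m P x 1 = P.[x].
Proof.
move=> sP; rewrite (horner_coef_wide _ sP).
by apply: eq_bigr => i _; rewrite expr1n mulr1.
Qed.

Lemma bformE m P x y : (size P <= m.+1)%N -> y != 0 ->
  bform m P x y = y ^+ m * P.[x / y].
Proof.
by move=> sP y0; rewrite -(bform_x1 _ sP) -bform_scale mulr1 mulrCA divff ?mulr1.
Qed.

Lemma bform_x0 m P x : bform m P x 0 = P`_m * x ^+ m.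
Proof.
rewrite /bform big_ord_recr /= subnn expr0 mulr1 big1 ?add0r // => i _.
by rewrite expr0n subn_eq0 leqNgt ltn_ord mulr0.
Qed.

Lemma fa_bform (Y : Type) (C : set (Y -> k)) m P (f g : Y -> k) :
  function_algebra C -> C f -> C g -> C (fun z : Y => bform m P (f z) (g z)).
Proof.
move=> CA Cf Cg; apply: (fa_sum CA) => i.
by apply: (fa_mul CA); [apply: (fa_mul CA); [apply: (fa_cst CA)|]|]; apply: fa_exp.
Qed.

Lemma proportional2 x y x' y' : (x, y) != (0, 0) -> (x', y') != (0, 0) ->
  x * y' = x' * y -> exists2 c, c != 0 & x' = c * x /\ y' = c * y.
Proof.
rewrite !pair_neq0 => nz nz' e; have [x0|x0] := eqVneq x 0.
  have y0 : y != 0 by move: nz; rewrite x0 eqxx.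
  have x0' : x' = 0.
    by move/eqP: e; rewrite x0 mul0r eq_sym mulf_eq0 (negPf y0) orbF => /eqP.
  have y0' : y' != 0 by move: nz'; rewrite x0' eqxx.
  exists (y' / y); first by rewrite mulf_neq0 ?invr_eq0.
  by rewrite x0 x0' mulr0 divfK.
have x0' : x' != 0.
  apply: contraTneq nz' => x0'; move/eqP: e; rewrite x0' mul0r mulf_eq0 (negPf x0) /=.
  by move=> /eqP ->; rewrite eqxx.
exists (x' / x); first by rewrite mulf_neq0 ?invr_eq0.
by rewrite divfK //; split=> //; rewrite mulrAC -e mulrAC divff // mul1r.
Qed.
End Forms.

(** * Sections of the ruling *)

Section SectionForm.
Variables (k : closedFieldType) (d : nat).
Variable s : proj_space k 1 -> hirzebruch k d.
Hypothesis hs : is_section s.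

Lemma section_fibre (x0 x1 : k) : (x0, x1) != (0, 0) ->
  exists y0 y1 : k, (y0, y1) != (0, 0) /\ s (P1pt x0 x1) = Hpt d x0 x1 y0 y1.
Proof.
move=> nz; have [z0 [z1 [y0 [y1 [cz e]]]]] := Hpt_surj (s (P1pt x0 x1)).
have := hs.2 (P1pt x0 x1); rewrite e ruling_Hpt //.
have /andP[nz' ny] := cz.
move=> /(P1pt_eq nz' nz)[l l0 [-> ->]].
exists (l ^+ d * 1 * y0), (1 * y1); split; last by rewrite Hpt_act // oner_eq0.
by move: ny; rewrite !pair_neq0 mul1r mulr1 mulf_eq0 expf_eq0 (negPf l0) andbF.
Qed.

(** Since the base coordinates are the same nonzero pair, the first torus parameter must be 1, and
    only proportionality in the fibre remains. *)
Lemma Hpt_eq_fibre (x0 x1 y0 y1 w0 w1 : k) : (x0, x1) != (0, 0) ->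
  (y0, y1) != (0, 0) -> (w0, w1) != (0, 0) ->
  Hpt d x0 x1 y0 y1 = Hpt d x0 x1 w0 w1 <-> y0 * w1 = w0 * y1.
Proof.
move=> nx ny nw; have cy : coxp x0 x1 y0 y1 by rewrite /coxp nx.
have cw : coxp x0 x1 w0 w1 by rewrite /coxp nx.
split=> [/(Hpt_eq _ cy cw)[l [m [l0 m0 [e0 e1 -> ->]]]]|].
  have -> : l = 1.
    have [x00|x00] := eqVneq x0 0.
      move: nx; rewrite pair_neq0 x00 eqxx /= => x10.
      by apply: (mulIf x10); rewrite -e1 mul1r.
    by apply: (mulIf x00); rewrite -e0 mul1r.
  by rewrite expr1n; ring.
move=> /(proportional2 ny nw)[m m0 [ew0 ew1]].
by apply/(Hpt_eq _ cy cw); exists 1, m; rewrite oner_eq0 expr1n !mul1r.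
Qed.

(** One of [y0 / y1] and [y1 / y0], made weightless by [x_i ^ d], is regular near the point. Pulled
    back by [s] and along the curve it becomes a fraction, from which fibre coordinates are read. *)
Lemma section_local (p0 p1 : k -> k) (t0 : k) : polyfun p0 -> polyfun p1 ->
  (p0 t0, p1 t0) != (0, 0) -> exists a b E : {poly k}, E.[t0] != 0 /\
    forall t, E.[t] != 0 -> [/\ (p0 t, p1 t) != (0, 0),
      (a.[t], b.[t]) != (0, 0) &
      s (P1pt (p0 t) (p1 t)) = Hpt d (p0 t) (p1 t) a.[t] b.[t]].
Proof.
move=> P0 P1 nz; pose x (i : bool) (x0 x1 : k) := if i then x1 else x0.
have [i xi0] : exists i, x i (p0 t0) (p1 t0) != 0.
  by move: nz; rewrite pair_neq0 => /orP[]; [exists false | exists true].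
have x_scale (l x0 x1 : k) : x i (l * x0) (l * x1) = l * x i x0 x1 by rewrite /x; case: (i).
have px : mpolyfun4 (fun x0 x1 y0 y1 : k => x i x0 x1).
  by rewrite /x; case: (i); apply: mpolyfun_coord.
have [pi ppi] : polyfun (fun t => x i (p0 t) (p1 t)) by rewrite /x; case: (i).
have MA := @mpolyfun_fa k 4.
have [y0 [y1 [ny ey]]] := section_fibre nz.
have cx : coxp (p0 t0) (p1 t0) y0 y1 by rewrite /coxp nz.
have hf t := @section_fibre (p0 t) (p1 t).
have [y10|y10] := eqVneq y1 0.
  have y00 : y0 != 0 by move: ny; rewrite pair_neq0 y10 eqxx orbF.
  pose D (x0 x1 y0 y1 : k) := x i x0 x1 * y0.
  pose F (x0 x1 y0 y1 : k) := x i x0 x1 ^+ d * y1 / y0.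
  have iD : cox_invariant d (fun x0 x1 y0 y1 => D x0 x1 y0 y1 != 0).
    move=> l m x0 x1 z0 z1 l0 m0 _; rewrite /D x_scale !mulf_eq0 expf_eq0.
    by rewrite (negPf l0) (negPf m0) andbF.
  have iF : cox_invariant d F.
    move=> l m x0 x1 z0 z1 l0 m0 _; rewrite /F x_scale exprMn mulrACA -mulf_div.
    by rewrite divff ?mul1r // mulf_neq0 // expf_neq0.
  have oU := Hlift_zopen iD (fa_mul MA px (@mpolyfun_coord k 4 2)).
  have rF : regular [set p : hirzebruch k d |
      Hlift (fun x0 x1 y0 y1 => D x0 x1 y0 y1 != 0) p] (Hlift F).
    apply: (@Hlift_regular k d _ F (fun x0 x1 y0 y1 => x i x0 x1 ^+ d * y1)
      (fun x0 x1 y0 y1 => y0) iF).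
    - by rewrite /mpolyfun4; fa MA.
    - exact: mpolyfun_coord.
    - move=> x0 x1 z0 z1 cz; rewrite /= HliftE // /D mulf_eq0 negb_or.
      by move=> /andP[].
  have [osU /(_ _ rF)rsF] := hs.1 _ oU.
  have [|N [E [E0 NE]]] := P1_curve osU rsF P0 P1 nz.
    by rewrite /= ey HliftE // /D mulf_neq0.
  (* From [x_i ^ d * y1 / y0 = N / E] one gets [[y0 : y1] = [x_i ^ d * E : N]]. *)
  exists (pi ^+ d * E), N, (E * pi); split.
    by rewrite hornerM mulf_neq0 // -ppi.
  move=> t; rewrite hornerM mulf_eq0 negb_or => /andP[Et pit].
  have [nt Ut Ft] := NE t Et; have [w0 [w1 [nw ew]]] := hf t nt.
  have cw : coxp (p0 t) (p1 t) w0 w1 by rewrite /coxp nt.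
  move: Ut Ft; rewrite /= ew !HliftE // /D mulf_eq0 negb_or => /andP[xt0 w00] FNE.
  have nn : ((pi ^+ d * E).[t], N.[t]) != (0, 0).
    by rewrite pair_neq0 hornerM mulf_neq0 // horner_exp expf_neq0.
  split=> //; apply/Hpt_eq_fibre => //.
  move: FNE; rewrite /F ppi hornerM horner_exp => /eqP.
  by rewrite eqr_div // => /eqP H; rewrite mulrC -H; ring.
pose D (x0 x1 y0 y1 : k) := x i x0 x1 * y1.
pose F (x0 x1 y0 y1 : k) := y0 / (x i x0 x1 ^+ d * y1).
have iD : cox_invariant d (fun x0 x1 y0 y1 => D x0 x1 y0 y1 != 0).
  move=> l m x0 x1 z0 z1 l0 m0 _; rewrite /D x_scale !mulf_eq0.
  by rewrite (negPf l0) (negPf m0).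
have iF : cox_invariant d F.
  move=> l m x0 x1 z0 z1 l0 m0 _; rewrite /F x_scale exprMn mulrACA -mulf_div.
  by rewrite divff ?mul1r // mulf_neq0 // expf_neq0.
have oU := Hlift_zopen iD (fa_mul MA px (@mpolyfun_coord k 4 3)).
have rF : regular [set p : hirzebruch k d |
      Hlift (fun x0 x1 y0 y1 => D x0 x1 y0 y1 != 0) p] (Hlift F).
  apply: (@Hlift_regular k d _ F (fun x0 x1 y0 y1 => y0)
    (fun x0 x1 y0 y1 => x i x0 x1 ^+ d * y1) iF).
  - exact: mpolyfun_coord.
  - by rewrite /mpolyfun4; fa MA.
  - move=> x0 x1 z0 z1 cz; rewrite /= HliftE // /D mulf_eq0 negb_or.
    by move=> /andP[? ?]; rewrite mulf_neq0 // expf_neq0.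
have [osU /(_ _ rF)rsF] := hs.1 _ oU.
have [|N [E [E0 NE]]] := P1_curve osU rsF P0 P1 nz.
  by rewrite /= ey HliftE // /D mulf_neq0.
exists (pi ^+ d * N), E, (E * pi); split.
  by rewrite hornerM mulf_neq0 // -ppi.
move=> t; rewrite hornerM mulf_eq0 negb_or => /andP[Et pit].
have [nt Ut Ft] := NE t Et; have [w0 [w1 [nw ew]]] := hf t nt.
have cw : coxp (p0 t) (p1 t) w0 w1 by rewrite /coxp nt.
move: Ut Ft; rewrite /= ew !HliftE // /D mulf_eq0 negb_or => /andP[xt0 w10] FNE.
have nn : ((pi ^+ d * N).[t], E.[t]) != (0, 0) by rewrite pair_neq0 Et orbT.
split=> //; apply/Hpt_eq_fibre => //.
move: FNE; rewrite /F ppi hornerM horner_exp => /eqP.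
rewrite eqr_div // ?mulf_neq0 ?expf_neq0 // => /eqP ->; by ring.
Qed.

(** The fraction found near 0, in lowest terms, is valid everywhere: a local pair at [c] satisfies
    [A * b' = a' * B], so by Bezout it is [q * (A, B)], and [q] cannot vanish at [c] because the
    pair does not. *)
Lemma section_affine : exists A B : {poly k}, coprimep A B /\
  forall x, s (P1pt x 1) = Hpt d x 1 A.[x] B.[x].
Proof.
have nz (x : k) : (x, 1) != (0, 0) :> k * k by rewrite pair_neq0 oner_eq0 orbT.
have loc := fun c => @section_local id (fun=> 1) c (polyfun_id k)
  (fa_cst (polyfun_fa k) 1) (nz c).
have [a [b [E [E0 sE]]]] := loc 0.
have g0 : gcdp a b != 0.
  rewrite gcdp_eq0; apply/negP => /andP[/eqP a0 /eqP b0].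
  by have [_ /negP[]] := sE 0 E0; rewrite a0 b0 !horner0.
pose A := a %/ gcdp a b; pose B := b %/ gcdp a b.
have eA : a = A * gcdp a b by rewrite divpK // dvdp_gcdl.
have eB : b = B * gcdp a b by rewrite divpK // dvdp_gcdr.
have cAB : coprimep A B.
  apply: coprimep_div_gcd; rewrite -negb_and; move: g0; by rewrite gcdp_eq0.
exists A, B; split=> // c.
have [[u v] /= uv] := Bezout_eq1_coprimepP _ _ cAB.
have [a' [b' [E' [E0' sE']]]] := loc c.
have EN0 : E * E' * gcdp a b != 0.
  by rewrite !mulf_neq0 //; apply: contraNneq E0 => e; [|move: E0'];
     rewrite ?e ?horner0 ?eqxx //; move: E0; rewrite e horner0 eqxx.
have ab' : A * b' = a' * B.
  apply: (poly_eq_cofinite EN0) => x; rewrite !hornerM !mulf_eq0 !negb_or.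
  move=> /andP[/andP[Ex Ex'] gx].
  have [_ nab sab] := sE x Ex; have [_ nab' sab'] := sE' x Ex'.
  have := sab'; rewrite sab => /(Hpt_eq_fibre (nz x) nab nab').
  rewrite {1}eA {2}eB !hornerM => H.
  by apply: (mulIf gx); rewrite mulrAC H mulrA.
pose q := u * a' + v * b'.
have ea' : a' = q * A.
  rewrite /q mulrDl -(mulrA v) (mulrC b') ab' -[LHS]mulr1 -uv; ring.
have eb' : b' = q * B.
  rewrite /q mulrDl -(mulrA u) -ab' -[LHS]mulr1 -uv; ring.
have [_ nab ->] := sE' c E0'.
have nAB : (A.[c], B.[c]) != (0, 0).
  move: nab; rewrite ea' eb' !hornerM !pair_neq0 !mulf_eq0.
  by rewrite !negb_or -andb_orr => /andP[].
apply/Hpt_eq_fibre => //; rewrite ea' eb' !hornerM; ring.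
Qed.
End SectionForm.

Section SectionForm2.
Variables (k : closedFieldType) (d : nat).
Variable s : proj_space k 1 -> hirzebruch k d.
Hypothesis hs : is_section s.

(** Along [[1 : t]] equality of fibre points is an identity of polynomials in [t], so it passes from
    [t != 0] to the point at infinity. The free factor [m] covers both a pair of forms and the
    constant pair [(1, 0)], for which [m = l ^- d]. *)
Lemma section_extend (FA FB : k -> k -> k) :
  (forall l : k, l != 0 -> exists2 m : k, m != 0 & forall x y : k,
    FA (l * x) (l * y) = l ^+ d * m * FA x y /\ FB (l * x) (l * y) = m * FB x y) ->
  (forall x : k, (FA x 1, FB x 1) != (0, 0)) -> (FA 1 0, FB 1 0) != (0, 0) ->
  polyfun (FA 1) -> polyfun (FB 1) ->
  (forall x : k, s (P1pt x 1) = Hpt d x 1 (FA x 1) (FB x 1)) ->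
  forall x0 x1 : k, (x0, x1) != (0, 0) -> (FA x0 x1, FB x0 x1) != (0, 0) /\
    s (P1pt x0 x1) = Hpt d x0 x1 (FA x0 x1) (FB x0 x1).
Proof.
move=> hF nzx nz0 pA pB sx.
have scale (l x0 x1 : k) : l != 0 -> (x0, x1) != (0, 0) ->
    (FA x0 x1, FB x0 x1) != (0, 0) /\
      s (P1pt x0 x1) = Hpt d x0 x1 (FA x0 x1) (FB x0 x1) ->
    (FA (l * x0) (l * x1), FB (l * x0) (l * x1)) != (0, 0) /\
    s (P1pt (l * x0) (l * x1)) =
      Hpt d (l * x0) (l * x1) (FA (l * x0) (l * x1)) (FB (l * x0) (l * x1)).
  move=> l0 nx [nF e]; have [m m0 mF] := hF l l0; have [-> ->] := mF x0 x1.
  split.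
    by move: nF; rewrite !pair_neq0 !mulf_eq0 expf_eq0 (negPf m0) (negPf l0) andbF.
  by rewrite P1pt_scale // e Hpt_act // /coxp nx.
have n1 (x : k) : (x, 1) != (0, 0) :> k * k by rewrite pair_neq0 oner_eq0 orbT.
have n2 (x : k) : (1, x) != (0, 0) :> k * k by rewrite pair_neq0 oner_eq0.
have aff (x0 x1 : k) : x1 != 0 -> (FA x0 x1, FB x0 x1) != (0, 0) /\
    s (P1pt x0 x1) = Hpt d x0 x1 (FA x0 x1) (FB x0 x1).
  move=> x10; have := @scale x1 (x0 / x1) 1 x10 (n1 _).
  by rewrite mulr1 mulrCA divff // mulr1; apply.
suff inf : s (P1pt 1 0) = Hpt d 1 0 (FA 1 0) (FB 1 0).
  move=> x0 x1 nx; have [x10|/aff //] := eqVneq x1 0.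
  have x00 : x0 != 0 by move: nx; rewrite x10 pair_neq0 eqxx orbF.
  by have := @scale x0 1 0 x00; rewrite x10 mulr1 mulr0; apply.
have [||a [b [E [E0 sE]]]] := @section_local k d s hs (fun=> 1) id 0 _ (polyfun_id k).
- exact: (fa_cst (polyfun_fa k)).
- exact: n2.
have [[pa ea] [pb eb]] := (pA, pB).
have ab : pa * b = a * pb.
  apply: (@poly_eq_cofinite k _ _ (E * 'X)).
    rewrite mulf_neq0 ?polyX_eq0 //; apply: contraNneq E0 => ->.
    by rewrite horner0.
  move=> t; rewrite !hornerM hornerX mulf_eq0 negb_or => /andP[Et t0].
  have [_ nab] := sE t Et; have [nF ->] := aff 1 t t0.
  by move/(Hpt_eq_fibre d (n2 t) nF nab); rewrite ea eb.
have [_ nab ->] := sE 0 E0; apply/Hpt_eq_fibre => //.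
by rewrite ea eb -!hornerM ab.
Qed.

Theorem section_form :
  (exists (A B : {poly k}) (e : nat),
    [/\ coprimep A B, B != 0, (size B <= e.+1)%N /\ (size A <= (e + d).+1)%N,
        (size B == e.+1) || (size A == (e + d).+1) &
    forall x0 x1 : k, (x0, x1) != (0, 0) ->
      (bform (e + d) A x0 x1, bform e B x0 x1) != (0, 0) /\
      s (P1pt x0 x1) = Hpt d x0 x1 (bform (e + d) A x0 x1) (bform e B x0 x1)]) \/
  (forall x0 x1 : k, (x0, x1) != (0, 0) -> s (P1pt x0 x1) = Hpt d x0 x1 1 0).
Proof.
have n10 : (1, 0) != (0, 0) :> k * k by rewrite pair_neq0 oner_eq0.
have n1 (x : k) : (x, 1) != (0, 0) :> k * k by rewrite pair_neq0 oner_eq0 orbT.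
have [A [B [cAB sAB]]] := section_affine hs.
have [B0|B0] := eqVneq B 0.
  right=> x0 x1; move=> nx.
  apply: (proj2 (@section_extend (fun _ _ => 1) (fun _ _ => 0) _ _ _ _ _ _ x0 x1 nx)) => //.
  - move=> l l0; exists (l ^- d); first by rewrite invr_eq0 expf_neq0.
    by move=> _ _; rewrite divff ?expf_neq0 // mulr1 mulr0.
  - exact: (fa_cst (polyfun_fa k)).
  - exact: (fa_cst (polyfun_fa k)).
  - move=> x; rewrite sAB; apply/Hpt_eq_fibre => //; last by rewrite B0 horner0; ring.
    move: cAB; rewrite B0 coprimep0 => /eqp_size; rewrite size_poly1.
    move=> /eqP/size_poly1P[c c0 ->].
    by rewrite hornerC horner0 pair_neq0 c0.
(* The least degree into which both polynomials fit. One of the two bounds is attained, which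
   excludes a common zero at infinity. *)
left; pose e := maxn (size B).-1 ((size A).-1 - d); exists A, B, e.
have sB : (size B <= e.+1)%N by rewrite /e; lia.
have sA : (size A <= (e + d).+1)%N.
  by rewrite /e; lia.
have sAB' : (size B == e.+1) || (size A == (e + d).+1).
  have : (0 < size B)%N by rewrite size_poly_gt0.
  by rewrite /e; lia.
split=> //; apply: section_extend.
- move=> l l0; exists (l ^+ e); first by rewrite expf_neq0.
  by move=> x y; rewrite !bform_scale -exprD addnC.
- move=> x; rewrite !bform_x1 // pair_neq0 -negb_and; apply/negP => /andP[/eqP Ax /eqP Bx].
  have [[u v] /= /(congr1 (horner^~ x))] := Bezout_eq1_coprimepP _ _ cAB.
  rewrite hornerD !hornerM hornerC Ax Bx !mulr0 addr0 => /eqP.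
  by rewrite eq_sym oner_eq0.
- rewrite !bform_x0 !expr1n !mulr1 pair_neq0.
  case/orP: sAB' => /eqP sz; apply/orP; [right|left].
    by have := B0; rewrite -lead_coef_eq0 /lead_coef sz.
  by rewrite -[(e + d)%N]/((e + d).+1.-1) -sz -/(lead_coef A)
    lead_coef_eq0 -size_poly_gt0 sz.
- apply: (fa_bform _ _ (polyfun_fa k)); last exact: polyfun_id.
  exact: (fa_cst (polyfun_fa k)).
- apply: (fa_bform _ _ (polyfun_fa k)); last exact: polyfun_id.
  exact: (fa_cst (polyfun_fa k)).
- by move=> x; rewrite !bform_x1.
Qed.
End SectionForm2.

(** * Ampleness *)

Section Ample.
Variable k : closedFieldType.

Definition locally_fraction (f : k -> k) c := exists N E : {poly k},
  E.[c] != 0 /\ forall x, E.[x] != 0 -> f x = N.[x] / E.[x].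

(** Put the fraction at 0 in lowest terms [N / E]. Comparison with the fraction at [c] gives
    [N * E' = N' * E]; a root [c] of [E] would then be a root of [N], against coprimality. So [E] is
    constant. *)
Lemma locally_fraction_poly (f : k -> k) :
  (forall c, locally_fraction f c) -> polyfun f.
Proof.
move=> fl; have [N0 [E0 [E00 fNE0]]] := fl 0.
have E0n : E0 != 0 by apply: contraNneq E00 => ->; rewrite horner0.
pose N := N0 %/ gcdp N0 E0; pose E := E0 %/ gcdp N0 E0.
have g0 : gcdp N0 E0 != 0 by rewrite gcdp_eq0 (negPf E0n) andbF.
have eN : N0 = N * gcdp N0 E0 by rewrite divpK // dvdp_gcdl.
have eE : E0 = E * gcdp N0 E0 by rewrite divpK // dvdp_gcdr.
have cNE : coprimep N E by apply: coprimep_div_gcd; rewrite E0n orbT.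
have cross c : exists N' E' : {poly k}, [/\ E'.[c] != 0,
    forall x, E'.[x] != 0 -> f x = N'.[x] / E'.[x] & N * E' = N' * E].
  have [N' [E' [E'c fNE]]] := fl c; exists N', E'; split=> //.
  have E'n : E' != 0 by apply: contraNneq E'c => ->; rewrite horner0.
  apply: (@poly_eq_cofinite k _ _ (E' * E0)); first by rewrite mulf_neq0.
  move=> x; rewrite !hornerM mulf_eq0 negb_or => /andP[E'x E0x].
  have := fNE0 x E0x; rewrite fNE // => /eqP; rewrite eqr_div // => /eqP.
  have -> : E0.[x] = E.[x] * (gcdp N0 E0).[x] by rewrite {1}eE hornerM.
  have -> : N0.[x] = N.[x] * (gcdp N0 E0).[x] by rewrite {1}eN hornerM.
  have gx : (gcdp N0 E0).[x] != 0.
    by apply: contraNneq E0x => gx; rewrite eE hornerM gx mulr0.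
  by move=> H; apply: (mulIf gx); rewrite -[RHS]mulrA H; ring.
have Er c : E.[c] != 0.
  apply/eqP => Ec; have [N' [E' [E'c _ /(congr1 (horner^~ c))]]] := cross c.
  rewrite !hornerM Ec mulr0 => /eqP; rewrite mulf_eq0 (negPf E'c) orbF => /eqP Nc.
  have [[u v] /= /(congr1 (horner^~ c))] := Bezout_eq1_coprimepP _ _ cNE.
  rewrite hornerD !hornerM hornerC Ec Nc !mulr0 addr0 => /eqP.
  by rewrite eq_sym oner_eq0.
have sE : size E == 1 by apply/negPn/negP => /closed_rootP[c]; rewrite /root (negPf (Er c)).
have [e e0 eEe] := size_poly1P _ sE.
exists (e^-1 *: N) => x; have [N' [E' [E'x fx /(congr1 (horner^~ x))]]] := cross x.
rewrite fx // hornerZ !hornerM eEe hornerC => H.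
by apply: (mulIf (mulf_neq0 E'x e0)); rewrite mulrA divfK // -H; field.
Qed.

(** Regular functions on the projective line are constant: a polynomial of positive degree has a
    pole at infinity, seen here by evaluating [t ^ deg P * P(1 / t)] at 0, where it is the leading
    coefficient. *)
Lemma locally_fraction_P1 (f g : k -> k) :
  (forall c, locally_fraction f c) -> locally_fraction g 0 ->
  (forall t : k, t != 0 -> g t = f t^-1) -> forall x y, f x = f y.
Proof.
move=> /locally_fraction_poly[P fP] [N [E [E0 gNE]]] gf.
have [/size1_polyC eP x y|sP] := leqP (size P) 1.
  by rewrite !fP eP !hornerC.
have [Q eQ] : polyfun (fun t => bform (size P).-1 P 1 t).
  apply: (fa_bform _ _ (polyfun_fa k)); last exact: polyfun_id.
  exact: (fa_cst (polyfun_fa k)).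
have En : E != 0 by apply: contraNneq E0 => ->; rewrite horner0.
have /(congr1 (horner^~ 0)) : Q * E = 'X^((size P).-1) * N.
  apply: (@poly_eq_cofinite k _ _ (E * 'X)); first by rewrite mulf_neq0 ?polyX_eq0.
  move=> t; rewrite !hornerM hornerX mulf_eq0 negb_or => /andP[Et t0].
  have sP' : (size P <= (size P).-1.+1)%N by lia.
  rewrite -eQ hornerXn bformE //.
  by rewrite div1r -fP -gf // gNE // -mulrA divfK.
rewrite !hornerM hornerXn -eQ bform_x0 expr1n mulr1 expr0n.
have -> : ((size P).-1 == 0)%N = false by lia.
rewrite mul0r => /eqP; rewrite mulf_eq0 (negPf E0) orbF -/(lead_coef P) lead_coef_eq0.
by move=> /eqP P0; rewrite P0 size_poly0 in sP.
Qed.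

Variable d : nat.

(* A section disjoint from S is contracted by every map defined by sections of
   O(m S), because these restrict to regular functions on P^1. *)
Lemma ample_meets (S : set (hirzebruch k d)) (c0 c1 : k) : zopen (~` S) ->
  (c0, c1) != (0, 0) ->
  (forall l x0 x1 : k, l != 0 -> (x0, x1) != (0, 0) ->
     Hpt d (l * x0) (l * x1) c0 c1 = Hpt d x0 x1 c0 c1) ->
  (forall x0 x1 : k, (x0, x1) != (0, 0) -> ~ S (Hpt d x0 x1 c0 c1)) ->
  ~ ample S.
Proof.
move=> oS nc scale disj [m m0 [N [f [phi [[Z [g [oZ [_ [g' [_ gK _]]] gphi]]] H]]]]].
have phi_inj x y : phi x = phi y -> x = y.
  by rewrite -!gphi => /val_inj e; rewrite -(gK x) e gK.
have n1 (x : k) : (x, 1) != (0, 0) :> k * k by rewrite pair_neq0 oner_eq0 orbT.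
have n2 (x : k) : (1, x) != (0, 0) :> k * k by rewrite pair_neq0 oner_eq0.
(* A local equation is invertible off [S], because on [U] minus [S] it must divide the constant
   1. *)
have hne (U : set (hirzebruch k d)) h x : zopen U -> local_equation S U h ->
    U x -> ~ S x -> h x != 0.
  move=> oU [_ _ gen] Ux Sx.
  have [||//||q [_ hq]] := gen (U `&` ~` S) (fun=> 1); last first.
  - have := hq x (conj Ux Sx); apply: contra_eq_neq => ->.
    by rewrite mul0r oner_eq0.
  - by move=> y [_ nSy] /nSy.
  - exact: regular_cst.
  - by move=> y [].
  - exact: zopenI.
have lf i (p0 p1 : k -> k) c : polyfun p0 -> polyfun p1 ->
    (forall t, (p0 t, p1 t) != (0, 0)) ->
    locally_fraction (fun t => f i (Hpt d (p0 t) (p1 t) c0 c1)) c.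
  move=> P0 P1 np; have [U [h [G [oU Ux eqh hG _]]]] := H (Hpt d (p0 c) (p1 c) c0 c1).
  have [rG fG] := hG i; have rh : regular U h by case: eqh.
  have [oV rV] := regularV oU (fa_exp (regular_fa U) m rh).
  set V := U `&` _ in oV rV.
  have rF : regular V (fun y => G i y * (h y ^+ m)^-1).
    by apply: regularM => //; apply: regular_sub rG => y [].
  have [||||A [E [Ec AE]]] := @H_curve k d _ _ p0 p1 (fun=> c0) (fun=> c1) c
      (zopenI oV oS) (regular_sub (fun y (h : (V `&` ~` S) y) => h.1) rF) P0 P1.
  - exact: (fa_cst (polyfun_fa k)).
  - exact: (fa_cst (polyfun_fa k)).
  - by rewrite /coxp np.
  - split; last exact: disj.
    by split=> //=; rewrite expf_neq0 // (hne U) //; apply: disj.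
  exists A, E; split=> // t /AE[_ [[Ut ht] St] <-].
  by rewrite fG // mulfK.
have fc i (x y : k) : f i (Hpt d x 1 c0 c1) = f i (Hpt d y 1 c0 c1).
  apply: (@locally_fraction_P1 (fun x => f i (Hpt d x 1 c0 c1))
    (fun t => f i (Hpt d 1 t c0 c1))).
  - move=> c; apply: (lf i id (fun=> 1)) => //; first exact: polyfun_id.
    exact: (fa_cst (polyfun_fa k)).
  - apply: (lf i (fun=> 1) id) => //; last exact: polyfun_id.
    exact: (fa_cst (polyfun_fa k)).
  - by move=> t t0; rewrite -(scale t t^-1 1) ?n1 // mulr1 divff.
(* The coordinates of both images are the values [f i], equal at the two points, times a power of a
   local equation that does not depend on [i]. Hence [phi] identifies points lying over 0 and 1. *)
have : phi (Hpt d 0 1 c0 c1) = phi (Hpt d 1 1 c0 c1).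
  have [U [h [G [oU Ux eqh hG hv]]]] := H (Hpt d 0 1 c0 c1).
  have [U' [h' [G' [oU' Ux' eqh' hG' hv']]]] := H (Hpt d 1 1 c0 c1).
  have [v [-> ev]] := hv _ Ux; have [v' [-> ev']] := hv' _ Ux'.
  have nh := hne _ _ _ oU eqh Ux (disj _ _ (n1 0)).
  have nh' := hne _ _ _ oU' eqh' Ux' (disj _ _ (n1 1)).
  apply/eqmodP/asboolP.
  exists (h' (Hpt d 1 1 c0 c1) ^+ m / h (Hpt d 0 1 c0 c1) ^+ m).
    by rewrite mulf_neq0 ?invr_eq0 ?expf_neq0.
  apply/rowP => i; rewrite mxE ev ev' (hG i).2 ?(hG' i).2 //; try exact: disj.
  by rewrite (fc i 0 1) mulrCA divfK ?expf_neq0.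
move=> /phi_inj /(congr1 (@ruling k d)); rewrite !ruling_Hpt /coxp ?n1 ?nc //.
move=> /(P1pt_eq (n1 0) (n1 1))[l _ []]; rewrite mulr0 => /eqP.
by rewrite oner_eq0.
Qed.
End Ample.

(** * Self-intersection of a section *)

Section P1Functions.
Variable k : closedFieldType.
Implicit Types (p : proj_space k 1).

Definition P1lift (T : Type) (F : k -> k -> T) p : T :=
  let v := val (repr (p : projpt k 1)) in F (v 0 0) (v 0 1).

Definition P1_invariant (T : Type) (F : k -> k -> T) :=
  forall l x0 x1, l != 0 -> F (l * x0) (l * x1) = F x0 x1.

Lemma P1liftE T (F : k -> k -> T) (x0 x1 : k) :
  P1_invariant F -> (x0, x1) != (0, 0) -> P1lift F (P1pt x0 x1) = F x0 x1.
Proof.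
move=> iF nx; have [v ev eq] := P1ptP nx; rewrite eq /P1lift.
set w := repr _; have nw : (val w 0 0, val w 0 1) != (0, 0).
  by rewrite -row2_neq0 -row2E; have /set_mem := valP w.
have [|l l0 [-> ->]] := (P1pt_eq nx nw).1; last by rewrite iF.
by rewrite P1ptE reprK eq.
Qed.

Definition mpolyfun2 (F : k -> k -> k) :=
  mpolyfun (fun x : 'rV[k]_2 => F (x 0 0) (x 0 1)).

Lemma P1lift_zopen (D : k -> k -> k) :
  P1_invariant (fun x0 x1 => D x0 x1 != 0) -> mpolyfun2 D ->
  zopen [set p : proj_space k 1 | P1lift (fun x0 x1 => D x0 x1 != 0) p].
Proof.
move=> iD pD; pose q (v : nzvec k 1) := \pi_(projpt k 1) v.
apply: (@quot_zopenI k 2 _ (projpt k 1) q (P1pt 1 0)) => x Sx.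
have [z ez ->] := qptP q (P1pt 1 0) Sx; rewrite -[q z]P1ptE ez /= P1liftE //; last first.
  by rewrite -row2_neq0 -row2E.
move=> Dx; exists (fun x => D (x 0 0) (x 0 1)); split=> // y Sy Dy.
have [w ew ->] := qptP q (P1pt 1 0) Sy; rewrite -[q w]P1ptE ew P1liftE //.
by rewrite -row2_neq0 -row2E.
Qed.

Lemma P1lift_regular (W : set (proj_space k 1)) (F N D : k -> k -> k) :
  P1_invariant F -> mpolyfun2 N -> mpolyfun2 D ->
  (forall x0 x1 : k, (x0, x1) != (0, 0) -> W (P1pt x0 x1) ->
     D x0 x1 != 0 /\ F x0 x1 = N x0 x1 / D x0 x1) ->
  regular W (P1lift F).
Proof.
move=> iF pN pD FND; pose q (v : nzvec k 1) := \pi_(projpt k 1) v.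
have nz (x : 'rV[k]_2) : x != 0 -> (x 0 0, x 0 1) != (0, 0).
  by rewrite -row2_neq0 -row2E.
apply: (@quot_regularI k 2 _ (projpt k 1) q (P1pt 1 0)) => x Sx.
have [z ez ->] := qptP q (P1pt 1 0) Sx; rewrite -[q z]P1ptE ez => Wx.
have [Dx _] := FND _ _ (nz _ Sx) Wx.
exists (fun x => N (x 0 0) (x 0 1)), (fun x => D (x 0 0) (x 0 1)); split=> //.
move=> y Sy; have [w ew ->] := qptP q (P1pt 1 0) Sy; rewrite -[q w]P1ptE ew => Wy _.
by rewrite P1liftE ?nz //; case: (FND _ _ (nz _ Sy) Wy).
Qed.

(** The linear fraction [L1 / L2] equals [t - c] on the curve and vanishes at [p], hence is a
    multiple of the uniformizer. This forces the uniformizer to have a simple zero in the parameter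
    [t]. *)
Lemma vanishing_order_curve (p : proj_space k 1) (g : proj_space k 1 -> k)
    (i : nat) (p0 p1 : k -> k) (c a0 a1 b0 b1 : k) :
  polyfun p0 -> polyfun p1 -> (forall t, (p0 t, p1 t) != (0, 0)) ->
  (forall t, a0 * p0 t + a1 * p1 t = t - c) ->
  (forall t, b0 * p0 t + b1 * p1 t = 1) ->
  p = P1pt (p0 c) (p1 c) -> vanishing_order p g i ->
  exists N E : {poly k}, [/\ N.[c] != 0, E.[c] != 0 &
    forall t, E.[t] != 0 ->
      g (P1pt (p0 t) (p1 t)) = (t - c) ^+ i * (N.[t] / E.[t])].
Proof.
move=> P0 P1 np eL1 eL2 ep [U [u [h [oU Up [ru u0 gen] rh gh]]]].
pose L1 (x0 x1 : k) := a0 * x0 + a1 * x1; pose L2 (x0 x1 : k) := b0 * x0 + b1 * x1.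
have L_scale l x0 x1 : L1 (l * x0) (l * x1) = l * L1 x0 x1 /\
    L2 (l * x0) (l * x1) = l * L2 x0 x1 by rewrite /L1 /L2; split; ring.
have MA := @mpolyfun_fa k 2.
have pL1 : mpolyfun2 L1 by rewrite /mpolyfun2 /L1; fa MA.
have pL2 : mpolyfun2 L2 by rewrite /mpolyfun2 /L2; fa MA.
have i2 : P1_invariant (fun x0 x1 => L2 x0 x1 != 0).
  by move=> l x0 x1 l0; rewrite (L_scale l x0 x1).2 mulf_eq0 (negPf l0).
have iw : P1_invariant (fun x0 x1 => L1 x0 x1 / L2 x0 x1).
  move=> l x0 x1 l0; rewrite (L_scale l x0 x1).1 (L_scale l x0 x1).2.
  by rewrite -mulf_div divff // mul1r.
have oW := P1lift_zopen i2 pL2.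
set W := [set p | _] in oW.
have rw : regular W (P1lift (fun x0 x1 => L1 x0 x1 / L2 x0 x1)).
  apply: (@P1lift_regular _ _ L1 L2) => // x0 x1 nx; rewrite /W /= P1liftE //.
have Wc t : W (P1pt (p0 t) (p1 t)) by rewrite /W /= P1liftE // /L2 eL2 oner_eq0.
have wc t : P1lift (fun x0 x1 => L1 x0 x1 / L2 x0 x1) (P1pt (p0 t) (p1 t)) = t - c.
  by rewrite P1liftE // /L1 /L2 eL1 eL2 divr1.
have oUW := zopenI oU oW.
have [||||q [rq wuq]] := gen (U `&` W) (P1lift (fun x0 x1 => L1 x0 x1 / L2 x0 x1)) => //.
- by apply: regular_sub rw => x [].
- by move=> x _ ->; rewrite ep wc subrr.
have UWc : (U `&` W) (P1pt (p0 c) (p1 c)) by split=> //; rewrite -ep.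
have rsub f : regular U f -> regular (U `&` W) f by apply: regular_sub => x [].
have [Nu [Eu [Eu0 uE]]] := P1_curve oUW (rsub _ ru) P0 P1 (np c) UWc.
have [Nq [Eq [Eq0 qE]]] := P1_curve oUW rq P0 P1 (np c) UWc.
have [Nh [Eh [Eh0 hE]]] := P1_curve oUW (rsub _ rh) P0 P1 (np c) UWc.
have hp : Nh.[c] != 0.
  have [_ _ e] := hE c Eh0; have := (gh p Up).1.
  by rewrite ep e mulf_eq0 negb_or => /andP[].
have /factor_theorem[N1 eN1] : root Nu c.
  have [_ _ e] := uE c Eu0; have := u0 p Up erefl.
  by rewrite ep e /root => /eqP; rewrite mulf_eq0 invr_eq0 (negPf Eu0) orbF.
have nzp (F : {poly k}) : F.[c] != 0 -> F != 0.
  by move=> Fc; apply: contraNneq Fc => ->; rewrite horner0.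
(* The relation between [t - c] and the uniformizer, with [t - c] cancelled. At [c] the left side is
   nonzero, so [N1] is too. *)
have eUQ : Eu * Eq = N1 * Nq.
  apply: (@poly_eq_cofinite k _ _ (Eu * Eq * ('X - c%:P))).
    by rewrite !mulf_neq0 ?polyXsubC_eq0 ?nzp.
  move=> t; rewrite !hornerM hornerXsubC !mulf_eq0 !negb_or.
  move=> /andP[/andP[ut qt] tc]; have [_ Ut eu] := uE t ut; have [_ _ eq] := qE t qt.
  have := wuq _ Ut; rewrite wc eu eq eN1 hornerM hornerXsubC => H.
  by apply: (mulIf tc); rewrite [in LHS]H; field; rewrite ut qt.
have N10 : N1.[c] != 0.
  have := congr1 (horner^~ c) eUQ; rewrite /= !hornerM => H.
  by have := mulf_neq0 Eu0 Eq0; rewrite H mulf_eq0 negb_or => /andP[].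
exists (N1 ^+ i * Nh), (Eu ^+ i * Eh).
split; try by rewrite hornerM horner_exp mulf_neq0 // expf_neq0.
move=> t; rewrite !hornerM !horner_exp mulf_eq0 negb_or.
(* For [i = 0] the condition on [Eu ^+ i] is void, but then the uniformizer does not occur
   either. *)
case: (posnP i) => [i0 /andP[_ ht]|i0 /andP[ut ht]].
  have [_ UWt eh] := hE t ht; have Ut := UWt.1.
  by rewrite (gh _ Ut).2 i0 !expr0 !mul1r eh.
have {}ut : Eu.[t] != 0 by move: ut; rewrite expf_eq0 i0.
have [_ UWt eu] := uE t ut; have Ut := UWt.1; have [_ _ eh] := hE t ht.
rewrite (gh _ Ut).2 eu eh eN1 hornerM hornerXsubC expr_div_n exprMn.
by field; rewrite ?expf_neq0 ?ht ?ut.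
Qed.
End P1Functions.

Section SectionCurve.
Variables (k : closedFieldType) (d e : nat) (A B : {poly k}).
Variable s : proj_space k 1 -> hirzebruch k d.
Let FA := bform (e + d) A.
Let FB := bform e B.
Hypothesis sE : forall x0 x1 : k, (x0, x1) != (0, 0) ->
  (FA x0 x1, FB x0 x1) != (0, 0) /\
  s (P1pt x0 x1) = Hpt d x0 x1 (FA x0 x1) (FB x0 x1).

Definition sec_eq x0 x1 y0 y1 := FA x0 x1 * y1 - FB x0 x1 * y0.

Lemma sec_eq_act l m x0 x1 y0 y1 :
  sec_eq (l * x0) (l * x1) (l ^+ d * m * y0) (m * y1) =
  l ^+ (e + d) * m * sec_eq x0 x1 y0 y1.
Proof. by rewrite /sec_eq /FA /FB !bform_scale exprD; ring. Qed.

Lemma range_section x0 x1 y0 y1 : coxp x0 x1 y0 y1 ->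
  range s (Hpt d x0 x1 y0 y1) <-> sec_eq x0 x1 y0 y1 = 0.
Proof.
move=> cx; have /andP[nx ny] := cx; split.
  move=> [p _ ep]; have [a [b [nab eab]]] := P1pt_surj p.
  have [nF sab] := sE nab; move: ep; rewrite eab sab => H.
  have [|l [m [l0 m0 [-> -> -> ->]]]] := (Hpt_eq d _ cx).1 H.
    by rewrite /coxp nab.
  by rewrite sec_eq_act /sec_eq (mulrC (FA a b)) subrr mulr0.
move=> /eqP; rewrite subr_eq0 => /eqP H; exists (P1pt x0 x1) => //.
have [nF ->] := sE nx; apply/Hpt_eq_fibre => //.
by rewrite H mulrC.
Qed.

Lemma sec_eq_polyfun4 : mpolyfun4 sec_eq.
Proof.
have MA := @mpolyfun_fa k 4; rewrite /mpolyfun4 /sec_eq.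
have FP m P : mpolyfun (fun x : 'rV[k]_4 => bform m P (x 0 0) (x 0 1)).
  by apply: (fa_bform _ _ MA); apply: mpolyfun_coord.
by fa MA; apply: FP.
Qed.

Lemma sec_eq_invariant : cox_invariant d (fun x0 x1 y0 y1 => sec_eq x0 x1 y0 y1 != 0).
Proof.
move=> l m x0 x1 y0 y1 l0 m0 _; rewrite sec_eq_act mulf_eq0 negb_or.
by rewrite mulf_neq0 // expf_neq0.
Qed.

Lemma zopen_compl_section : zopen (~` range s).
Proof.
have := Hlift_zopen sec_eq_invariant sec_eq_polyfun4; congr zopen.
apply/funext => p; apply/propext.
have [x0 [x1 [y0 [y1 [cx ->]]]]] := Hpt_surj p.
rewrite /= HliftE //; last exact: sec_eq_invariant.
split; first by move/eqP => H /range_section-/(_ cx).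
by move=> H; apply/eqP => /range_section-/(_ cx).
Qed.

(** Supplies a direction in the fibre along which [G] is linear with nonzero slope. *)
Lemma section_transversal x0 x1 : (x0, x1) != (0, 0) -> exists r0 r1 : k,
  FA x0 x1 * r1 - FB x0 x1 * r0 != 0.
Proof.
move=> /sE[]; rewrite pair_neq0 => /orP[] F0 _.
  by exists 0, 1; rewrite mulr1 mulr0 subr0.
by exists 1, 0; rewrite mulr1 mulr0 sub0r oppr_eq0.
Qed.

Lemma line_polyfun (y r : k) : polyfun (fun t => y + t * r).
Proof. by exists (y%:P + r *: 'X) => t; rewrite !hornerE mulrC. Qed.

(* G / wt i j is the local equation of the section G = A y1 - B y0 = 0 in the
   chart x_i <> 0, y_j <> 0; wt i j is a monomial of the same weight as G. *)
Definition cx (i : bool) (x0 x1 : k) := if i then x1 else x0.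
Definition wt (i j : bool) (x0 x1 y0 y1 : k) :=
  cx i x0 x1 ^+ (e + if j then d else 0) * cx j y0 y1.
Definition chart (i j : bool) (x0 x1 y0 y1 : k) := cx i x0 x1 * cx j y0 y1.

Lemma cx_scale i l x0 x1 : cx i (l * x0) (l * x1) = l * cx i x0 x1.
Proof. by case: i. Qed.

Lemma wt_act i j l m x0 x1 y0 y1 :
  wt i j (l * x0) (l * x1) (l ^+ d * m * y0) (m * y1) =
  l ^+ (e + d) * m * wt i j x0 x1 y0 y1.
Proof.
by rewrite /wt cx_scale exprMn; case: j => /=; rewrite ?addn0 !exprD; ring.
Qed.

Lemma wt_neq0 i j x0 x1 y0 y1 : chart i j x0 x1 y0 y1 != 0 -> wt i j x0 x1 y0 y1 != 0.
Proof.
by rewrite /chart /wt mulf_eq0 negb_or => /andP[? ?]; rewrite mulf_neq0 ?expf_neq0.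
Qed.

Lemma chart_invariant i j :
  cox_invariant d (fun x0 x1 y0 y1 => chart i j x0 x1 y0 y1 != 0).
Proof.
move=> l m x0 x1 y0 y1 l0 m0 _; rewrite /chart cx_scale !mulf_eq0 (negPf l0) /=.
by case: j; rewrite /= !mulf_eq0 ?expf_eq0 ?(negPf l0) (negPf m0) ?andbF.
Qed.

Lemma ratio_invariant i j (F : k -> k -> k -> k -> k) :
  (forall l m x0 x1 y0 y1, F (l * x0) (l * x1) (l ^+ d * m * y0) (m * y1) =
     l ^+ (e + d) * m * F x0 x1 y0 y1) ->
  cox_invariant d (fun x0 x1 y0 y1 => F x0 x1 y0 y1 / wt i j x0 x1 y0 y1).
Proof.
move=> FE l m x0 x1 y0 y1 l0 m0 _; rewrite FE wt_act -mulf_div divff ?mul1r //.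
by rewrite mulf_neq0 // expf_neq0.
Qed.

Lemma cx_polyfun i : mpolyfun4 (fun x0 x1 y0 y1 => cx i x0 x1) /\
  mpolyfun4 (fun x0 x1 y0 y1 => cx i y0 y1).
Proof. by case: i; split; apply: mpolyfun_coord. Qed.

Lemma wt_polyfun i j : mpolyfun4 (wt i j).
Proof.
have MA := @mpolyfun_fa k 4; apply: (fa_mul MA); last exact: (cx_polyfun j).2.
by apply: (fa_exp MA); exact: (cx_polyfun i).1.
Qed.

Lemma chart_polyfun i j : mpolyfun4 (chart i j).
Proof.
have MA := @mpolyfun_fa k 4; apply: (fa_mul MA); last exact: (cx_polyfun j).2.
exact: (cx_polyfun i).1.
Qed.

Definition chartU i j : set (hirzebruch k d) :=
  [set p | Hlift (fun x0 x1 y0 y1 => chart i j x0 x1 y0 y1 != 0) p].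

Lemma chartUE i j x0 x1 y0 y1 : coxp x0 x1 y0 y1 ->
  chartU i j (Hpt d x0 x1 y0 y1) = (chart i j x0 x1 y0 y1 != 0).
Proof. by move=> c; rewrite /chartU /= HliftE //; apply: chart_invariant. Qed.

Lemma zopen_chartU i j : zopen (chartU i j).
Proof. exact: Hlift_zopen (@chart_invariant i j) (@chart_polyfun i j). Qed.

Lemma ratio_regular i j (F : k -> k -> k -> k -> k) :
  (forall l m x0 x1 y0 y1, F (l * x0) (l * x1) (l ^+ d * m * y0) (m * y1) =
     l ^+ (e + d) * m * F x0 x1 y0 y1) -> mpolyfun4 F ->
  regular (chartU i j)
    (Hlift (fun x0 x1 y0 y1 => F x0 x1 y0 y1 / wt i j x0 x1 y0 y1)).
Proof.
move=> FE pF; apply: (@Hlift_regular k d _ _ F (wt i j)) => //.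
- exact: ratio_invariant.
- exact: wt_polyfun.
- by move=> x0 x1 y0 y1 c; rewrite chartUE // => /wt_neq0.
Qed.
End SectionCurve.

Section LocalData.
Variables (k : closedFieldType) (d e : nat) (A B : {poly k}).
Variable s : proj_space k 1 -> hirzebruch k d.
Hypothesis ms : morphism s.
Let FA := bform (e + d) A.
Let FB := bform e B.
Hypothesis sE : forall x0 x1 : k, (x0, x1) != (0, 0) ->
  (FA x0 x1, FB x0 x1) != (0, 0) /\
  s (P1pt x0 x1) = Hpt d x0 x1 (FA x0 x1) (FB x0 x1).
Let G := sec_eq d e A B.

Definition line0 (i : bool) (t : k) := if i then t else 1.
Definition line1 (i : bool) (t : k) := if i then 1 else t.

Lemma line_neq0 i t : (line0 i t, line1 i t) != (0, 0).
Proof. by case: i; rewrite pair_neq0 oner_eq0 ?orbT. Qed.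

Lemma line_poly i : polyfun (line0 i) /\ polyfun (line1 i).
Proof.
by case: i; split; (exact: polyfun_id || exact: (fa_cst (polyfun_fa k))).
Qed.

Lemma cx_line i t : cx i (line0 i t) (line1 i t) = 1.
Proof. by case: i. Qed.

(* A local equation of the divisor S + div f, normalized to the chart equation
   G / wt of S, together with the expansions along P^1 of its numerator and its
   denominator. *)
Definition local_datum (V : set (hirzebruch k d)) (f : hirzebruch k d -> k)
    (i j : bool) (c : k) (m : int)
    (U : set (hirzebruch k d)) (a b : hirzebruch k d -> k) (u v : nat)
    (Na Ea Nb Eb : {poly k}) : Prop :=
  [/\ [/\ zopen U, regular U a & regular U b],
      forall x0 x1 y0 y1 : k, coxp x0 x1 y0 y1 -> U (Hpt d x0 x1 y0 y1) ->
        chart i j x0 x1 y0 y1 != 0 /\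
        (V (Hpt d x0 x1 y0 y1) ->
         f (Hpt d x0 x1 y0 y1) * G x0 x1 y0 y1 * b (Hpt d x0 x1 y0 y1) =
         a (Hpt d x0 x1 y0 y1) * wt d e i j x0 x1 y0 y1),
      m = u%:Z - v%:Z,
      [&& Na.[c] != 0, Ea.[c] != 0, Nb.[c] != 0 & Eb.[c] != 0] &
      forall t, Ea.[t] != 0 -> Eb.[t] != 0 ->
        [/\ U (s (P1pt (line0 i t) (line1 i t))),
            a (s (P1pt (line0 i t) (line1 i t))) = (t - c) ^+ u * (Na.[t] / Ea.[t]) &
            b (s (P1pt (line0 i t) (line1 i t))) = (t - c) ^+ v * (Nb.[t] / Eb.[t])]].

Lemma vanishing_order_line i c g u :
  vanishing_order (P1pt (line0 i c) (line1 i c)) g u ->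
  exists N E : {poly k}, [/\ N.[c] != 0, E.[c] != 0 &
    forall t, E.[t] != 0 ->
      g (P1pt (line0 i t) (line1 i t)) = (t - c) ^+ u * (N.[t] / E.[t])].
Proof.
have [P0 P1] := line_poly i.
pose a0 : k := if i then 1 else - c; pose a1 : k := if i then - c else 1.
pose b0 : k := if i then 0 else 1; pose b1 : k := if i then 1 else 0.
apply: (@vanishing_order_curve k _ g u (line0 i) (line1 i) c a0 a1 b0 b1) => //.
- by move=> t; apply: line_neq0.
- by rewrite /a0 /a1; case: (i) => t; rewrite /line0 /line1 /=; ring.
- by rewrite /b0 /b1; case: (i) => t; rewrite /line0 /line1 /=; ring.
Qed.

(** The given local equation [h] generates the ideal, so the chart equation [G / wt] is [h * q],
    with [q] a unit at the point. Replacing [a] by [a * q] and shrinking to [q != 0] changes the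
    equation but not the vanishing orders. *)
Lemma local_datum_exists V f i j c m :
  local_intersection s V f (P1pt (line0 i c) (line1 i c)) m ->
  cx j (FA (line0 i c) (line1 i c)) (FB (line0 i c) (line1 i c)) != 0 ->
  exists U a b u v Na Ea Nb Eb, local_datum V f i j c m U a b u v Na Ea Nb Eb.
Proof.
move=> [U [h [a [b [u [v [[oU Up eqh] [ra rb] fab [va vb] mE]]]]]]] nj.
have [P0 P1] := line_poly i; have nl t := line_neq0 i t.
set x0 := line0 i c in nj *; set x1 := line1 i c in nj *.
have nx : (x0, x1) != (0, 0) := nl c.
have [nF sp] := sE nx; rewrite sp in Up.
have cx0 : coxp x0 x1 (FA x0 x1) (FB x0 x1) by rewrite /coxp nx.
have ch0 : chart i j x0 x1 (FA x0 x1) (FB x0 x1) != 0.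
  by rewrite /chart /x0 /x1 cx_line mul1r.
have [rh h0 gen] := eqh.
pose g := Hlift (fun x0 x1 y0 y1 => G x0 x1 y0 y1 / wt d e i j x0 x1 y0 y1)
  : hirzebruch k d -> k.
have Gact := @sec_eq_act k d e A B.
have rg : regular (chartU i j) g := ratio_regular Gact (@sec_eq_polyfun4 k d e A B).
have gE y0 y1 z0 z1 : coxp y0 y1 z0 z1 ->
    g (Hpt d y0 y1 z0 z1) = G y0 y1 z0 z1 / wt d e i j y0 y1 z0 z1.
  by move=> cy; rewrite /g HliftE //; apply: ratio_invariant.
have oUW : zopen (U `&` chartU i j) := zopenI oU (@zopen_chartU k d i j).
have rsub F : regular U F -> regular (U `&` chartU i j) F.
  by apply: regular_sub => y [].
have [|||q [rq gq]] := gen (U `&` chartU i j) g oUW.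
- by move=> y [].
- by apply: regular_sub rg => y [].
- move=> y _; have [y0 [y1 [z0 [z1 [cy ->]]]]] := Hpt_surj y.
  by move=> /(range_section sE cy) => G0; rewrite gE // /G G0 mul0r.
have UWp : (U `&` chartU i j) (Hpt d x0 x1 (FA x0 x1) (FB x0 x1)).
  by split=> //; rewrite chartUE.
(* along the fibre through the point, G is linear with nonzero slope *)
have qp : q (Hpt d x0 x1 (FA x0 x1) (FB x0 x1)) != 0.
  have [r0 [r1 rn]] := section_transversal sE nx.
  have pc z : polyfun (fun _ : k => z) := fa_cst (polyfun_fa k) z.
  have l0 := line_polyfun (FA x0 x1) r0; have l1 := line_polyfun (FB x0 x1) r1.
  have e0 y r : y + 0 * r = y :> k by rewrite mul0r addr0.
  have [||Nh [Eh [Eh0 hE]]] := H_curve (s := 0) oUW (rsub _ rh) (pc x0) (pc x1) l0 l1;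
    rewrite ?e0 //.
  have [||Nq [Eq [Eq0 qE]]] := H_curve (s := 0) oUW rq (pc x0) (pc x1) l0 l1;
    rewrite ?e0 //.
  have [_ _] := qE 0 Eq0; rewrite !e0 => ->.
  have [M eM] : polyfun (fun t => wt d e i j x0 x1 (FA x0 x1 + t * r0) (FB x0 x1 + t * r1)).
    apply: (fa_mul (polyfun_fa k)); first exact: pc.
    by case: (j).
  have /factor_theorem[N1 eN1] : root Nh 0.
    have [_ _] := hE 0 Eh0; rewrite !e0 h0 //; last by exists (P1pt x0 x1).
    by move/esym/eqP; rewrite mulf_eq0 invr_eq0 (negPf Eh0) orbF.
  have nzp (F : {poly k}) : F.[0] != 0 -> F != 0.
    by move=> Fc; apply: contraNneq Fc => ->; rewrite horner0.
  have M0 : M.[0] != 0 by rewrite -eM !e0; apply: wt_neq0.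
  (* On the line, [G] is [t] times the slope, [h] is [t * N1 / Eh] and [wt] is [M]: this is
     [G = h * q * wt] with [t] cancelled, and evaluation at 0 shows that [Nq] does not vanish
     there. *)
  have H : (FA x0 x1 * r1 - FB x0 x1 * r0) *: (Eh * Eq) = N1 * Nq * M.
    apply: (@poly_eq_cofinite k _ _ (Eh * Eq * M * 'X)).
      by rewrite !mulf_neq0 ?polyX_eq0 ?nzp.
    move=> t; rewrite hornerZ !hornerM hornerX !mulf_eq0 !negb_or.
    move=> /andP[/andP[/andP[ht qt] Mt] t0].
    have [ct Ut eh] := hE t ht; have [_ _ eq] := qE t qt.
    have := gq _ Ut; rewrite gE // eh eq eN1 eM hornerM hornerXsubC subr0 => /eqP.
    rewrite mulf_div eqr_div ?mulf_neq0 // => /eqP H.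
    apply: (mulIf t0).
    transitivity (G x0 x1 (FA x0 x1 + t * r0) (FB x0 x1 + t * r1) * (Eh.[t] * Eq.[t])).
      by rewrite /G /sec_eq -/FA -/FB; ring.
    by rewrite H; ring.
  have := congr1 (horner^~ 0) H; rewrite /= hornerZ !hornerM => H0.
  have : (FA x0 x1 * r1 - FB x0 x1 * r0) * (Eh.[0] * Eq.[0]) != 0 by rewrite !mulf_neq0.
  rewrite H0 !mulf_eq0 !negb_or => /andP[/andP[_ nq] _].
  by rewrite nq invr_eq0.
have [oU' _] := regularV oUW rq; set U' := _ `&` [set _ | _] in oU'.
have U'sub y : U' y -> U y by move=> [[]].
have [Na [Ea [Na0 Ea0 aE]]] := vanishing_order_line va.
have [Nb [Eb [Nb0 Eb0 bE]]] := vanishing_order_line vb.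
have [osU' rs] := ms oU'.
have rq' : regular U' q by apply: regular_sub rq => y [].
have U'p : U' (Hpt d x0 x1 (FA x0 x1) (FB x0 x1)) by split.
have [|Nq [Eq [Eq0 qE]]] := P1_curve osU' (rs _ rq') P0 P1 (nl c).
  by rewrite /preimage /= -/x0 -/x1 sp.
exists U', (fun y => a y * q y), b, u, v, (Na * Nq), (Ea * Eq), Nb, Eb.
have Nq0 : Nq.[c] != 0.
  have [_ _] := qE c Eq0; rewrite -/x0 -/x1 sp => H.
  by move: qp; rewrite H mulf_eq0 negb_or => /andP[].
split=> //.
- split=> //; last by apply: regular_sub rb.
  by apply: regularM => //; apply: regular_sub ra.
- move=> y0 y1 z0 z1 cy [[Uy Wy] qy]; rewrite chartUE // in Wy; split=> // Vy.
  have := fab _ Uy Vy; have := gq _ (conj Uy _); rewrite chartUE // => /(_ Wy).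
  rewrite gE // => H <-; have w0 := wt_neq0 d e Wy.
  have -> : G y0 y1 z0 z1 =
      h (Hpt d y0 y1 z0 z1) * q (Hpt d y0 y1 z0 z1) * wt d e i j y0 y1 z0 z1.
    by rewrite -H divfK.
  by ring.
- by rewrite !hornerM (mulf_neq0 Na0 Nq0) (mulf_neq0 Ea0 Eq0) Nb0 Eb0.
- move=> t; rewrite !hornerM mulf_eq0 negb_or => /andP[at0 qt0] bt.
  have [_ Ut qt] := qE t qt0; split=> //; last exact: bE.
  by rewrite aE // qt; field; rewrite at0 qt0.
Qed.
End LocalData.

Lemma sum_mup (k : closedFieldType) (P : {poly k}) (L : seq k) : P != 0 -> uniq L ->
  (forall c, root P c -> c \in L) -> (\sum_(c <- L) mup c P)%N = (size P).-1.
Proof.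
move=> P0 uL rL; have [r eP] := closed_field_poly_normal P.
have l0 : lead_coef P != 0 by rewrite lead_coef_eq0.
have sr : size r = (size P).-1.
  by rewrite eP size_scale // size_prod_XsubC.
have rr : {subset r <= L}.
  by move=> c cr; apply: rL; rewrite eP rootZ // root_prod_XsubC.
have mE c : mup c P = count_mem c r.
  rewrite eP -mul_polyC mupMr ?mu_prod_XsubC //.
  by rewrite /root hornerC.
under eq_bigr do rewrite mE; rewrite -sr; elim: r {eP sr mE} rr => [|x r IHr] rr.
  by rewrite big1.
have [xL rr'] : x \in L /\ {subset r <= L}.
  by split; [apply: rr; rewrite mem_head | move=> y yr; apply: rr; rewrite inE yr orbT].
rewrite /= big_split /= IHr // -[RHS]add1n; congr (_ + _)%N.
rewrite (bigD1_seq x) //= eqxx big1 ?addn0 // => y yx.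
by rewrite eq_sym (negPf yx).
Qed.

Lemma reversal (k : closedFieldType) (F : {poly k}) : F != 0 ->
  exists2 R : {poly k}, R.[0] != 0 &
    forall t, t != 0 -> R.[t] = t ^+ (size F).-1 * F.[t^-1].
Proof.
move=> F0; have sF : (size F <= (size F).-1.+1)%N by rewrite leqSpred.
have [R eR] : polyfun (fun t => bform (size F).-1 F 1 t).
  apply: (fa_bform _ _ (polyfun_fa k)); last exact: polyfun_id.
  exact: (fa_cst (polyfun_fa k)).
exists R => [|t t0]; last by rewrite -eR bformE // div1r.
by rewrite -eR bform_x0 expr1n mulr1 -/(lead_coef F) lead_coef_eq0.
Qed.

Lemma subz_addn (u v x y : nat) :
  (u + x = v + y)%N -> u%:Z - v%:Z = y%:Z - x%:Z.
Proof. lia. Qed.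

Section SelfIntersection.
Variables (k : closedFieldType) (d e : nat) (A B : {poly k}).
Variable s : proj_space k 1 -> hirzebruch k d.
Let FA := bform (e + d) A.
Let FB := bform e B.
Hypothesis sE : forall x0 x1 : k, (x0, x1) != (0, 0) ->
  (FA x0 x1, FB x0 x1) != (0, 0) /\
  s (P1pt x0 x1) = Hpt d x0 x1 (FA x0 x1) (FB x0 x1).
Hypotheses (sA : (size A <= (e + d).+1)%N) (sB : (size B <= e.+1)%N).
Let G := sec_eq d e A B.

Variables (V : set (hirzebruch k d)) (f : hirzebruch k d -> k).
Hypothesis
  dV : forall U : set (hirzebruch k d), zopen U -> U !=set0 -> U `&` V !=set0.

(** On [V] both sides, multiplied out with the defining relations, equal [f * G * b * b']. The
    difference divided by [wt] is regular, so by density of [V] it vanishes on all of [U] and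
    [U']. *)
Lemma local_datum_compare i j c m U a b u v Na Ea Nb Eb
    i' j' c' m' U' a' b' u' v' Na' Ea' Nb' Eb' (x0 x1 y0 y1 : k) :
  local_datum e A B s V f i j c m U a b u v Na Ea Nb Eb ->
  local_datum e A B s V f i' j' c' m' U' a' b' u' v' Na' Ea' Nb' Eb' ->
  coxp x0 x1 y0 y1 -> U (Hpt d x0 x1 y0 y1) -> U' (Hpt d x0 x1 y0 y1) ->
  a (Hpt d x0 x1 y0 y1) * b' (Hpt d x0 x1 y0 y1) * wt d e i j x0 x1 y0 y1 =
  a' (Hpt d x0 x1 y0 y1) * b (Hpt d x0 x1 y0 y1) * wt d e i' j' x0 x1 y0 y1.
Proof.
move=> [[oU ra rb] UE _ _ _] [[oU' ra' rb'] UE' _ _ _] cx Ux U'x.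
have act := @wt_act k d e i' j'.
pose r := Hlift (fun x0 x1 y0 y1 => wt d e i' j' x0 x1 y0 y1 / wt d e i j x0 x1 y0 y1)
  : hirzebruch k d -> k.
have rE y0' y1' z0 z1 : coxp y0' y1' z0 z1 -> r (Hpt d y0' y1' z0 z1) =
    wt d e i' j' y0' y1' z0 z1 / wt d e i j y0' y1' z0 z1.
  by move=> cy; rewrite /r HliftE //; apply: ratio_invariant.
have oUU := zopenI oU oU'.
have rr0 : regular (chartU i j) r :=
  @ratio_regular k d e i j (wt d e i' j') act (@wt_polyfun k d e i' j').
have rr : regular (U `&` U') r.
  apply: regular_sub rr0 => y [Uy _].
  have [y0' [y1' [z0 [z1 [cy ey]]]]] := Hpt_surj y.
  by rewrite ey chartUE //; apply: (UE _ _ _ _ cy _).1; rewrite -ey.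
pose w y := a y * b' y - a' y * b y * r y.
have rw : regular (U `&` U') w.
  apply: (fa_sub (regular_fa _)); apply: (fa_mul (regular_fa _)) => //.
  - by apply: regular_sub ra => y [].
  - by apply: regular_sub rb' => y [].
  apply: (fa_mul (regular_fa _)).
  - by apply: regular_sub ra' => y [].
  - by apply: regular_sub rb => y [].
have [oO _] := regularV oUU rw.
have wt0 y0' y1' z0 z1 : coxp y0' y1' z0 z1 -> U (Hpt d y0' y1' z0 z1) ->
    wt d e i j y0' y1' z0 z1 != 0.
  by move=> cy Uy; apply: wt_neq0; apply: (UE _ _ _ _ cy Uy).1.
have wE y0' y1' z0 z1 (p := Hpt d y0' y1' z0 z1) : coxp y0' y1' z0 z1 -> U p ->
    (w p == 0) = (a p * b' p * wt d e i j y0' y1' z0 z1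
      == a' p * b p * wt d e i' j' y0' y1' z0 z1).
  move=> cy Uy; rewrite /w subr_eq0 rE // mulrA.
  by rewrite -[in RHS](inj_eq (mulIf (invr_neq0 (wt0 _ _ _ _ cy Uy)))) mulfK ?wt0.
apply/eqP; rewrite -wE //; apply/negPn/negP => w0.
have [|y [[[Uy U'y] wy] Vy]] := dV oO; first by exists (Hpt d x0 x1 y0 y1).
have [y0' [y1' [z0 [z1 [cy ey]]]]] := Hpt_surj y; subst y.
move: wy; rewrite /= wE //; apply/negP/negPn/eqP.
have H1 := (UE _ _ _ _ cy Uy).2 Vy; have H2 := (UE' _ _ _ _ cy U'y).2 Vy.
by rewrite mulrAC -H1 -mulrA mulrAC (mulrAC _ (b _)) -H2; ring.
Qed.

Let W (j : bool) := if j then B else A.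

Lemma wt_affine j (x : k) : wt d e true j x 1 (FA x 1) (FB x 1) = (W j).[x].
Proof. by rewrite /wt /= expr1n mul1r /FA /FB !bform_x1 //; case: j. Qed.

(** Along the section each [wt] is a form of degree [e + d + e]; the value of the self-intersection
    originates in this exponent. *)
Lemma wt_infty j (t : k) : t != 0 -> wt d e true j 1 t (FA 1 t) (FB 1 t) =
  t ^+ (e + d + e) * (W j).[t^-1].
Proof.
move=> t0; rewrite /wt /FA /FB !bformE // div1r.
by case: j; rewrite /= mulrA -exprD; congr (_ ^+ _ * _); lia.
Qed.

Section Base.
Variables (j0 : bool) (m0 : int) (U0 : set (hirzebruch k d)).
Variables (a0 b0 : hirzebruch k d -> k) (u0 v0 : nat) (Na0 Ea0 Nb0 Eb0 : {poly k}).
Hypothesis data0 :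
  local_datum e A B s V f true j0 0 m0 U0 a0 b0 u0 v0 Na0 Ea0 Nb0 Eb0.
Hypothesis W0 : (W j0).[0] != 0.

(** The fraction [base_num / base_den] is [f * G] restricted to the section over the affine line,
    written from the datum at 0; all multiplicities are read off from it. *)
Definition base_num := 'X^u0 * Na0 * Eb0 * W j0.
Definition base_den := 'X^v0 * Nb0 * Ea0.

Let nzp c (F : {poly k}) : F.[c] != 0 -> F != 0.
Proof. by move=> Fc; apply: contraNneq Fc => ->; rewrite horner0. Qed.

Lemma base_neq0 : base_num != 0 /\ base_den != 0.
Proof.
have [_ _ _ /and4P[/nzp ? /nzp ? /nzp ? /nzp ?] _] := data0.
have Xn n : 'X^n != 0 :> {poly k} by rewrite monic_neq0 ?monicXn.
by split; rewrite !mulf_neq0 // (nzp W0).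
Qed.

Lemma multiplicity_affine j c m U a b u v Na Ea Nb Eb :
  local_datum e A B s V f true j c m U a b u v Na Ea Nb Eb ->
  (W j).[c] != 0 -> m = (mup c base_num)%:Z - (mup c base_den)%:Z.
Proof.
move=> D Wc; have [_ _ -> /and4P[Nac Eac Nbc Ebc] DE] := D.
have [_ _ _ /and4P[Na00 Ea00 Nb00 Eb00] DE0] := data0.
have [num0 den0] := base_neq0.
have H : ('X - c%:P) ^+ u * (Na * Eb * W j) * base_den =
         ('X - c%:P) ^+ v * (Nb * Ea) * base_num.
  apply: (@poly_eq_cofinite k _ _ (Ea * Eb * (Ea0 * Eb0))).
    by rewrite !mulf_neq0 ?(nzp (c := 0) Ea00) ?(nzp (c := 0) Eb00)
      ?(nzp (c := c) Eac) ?(nzp (c := c) Ebc).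
  move=> t; rewrite 3!hornerM !mulf_eq0 !negb_or.
  move=> /andP[/andP[at0 bt0] /andP[at1 bt1]].
  have [Ut ea eb] := DE t at0 bt0; have [U0t ea0 eb0] := DE0 t at1 bt1.
  have nt := line_neq0 true t; have [nF st] := sE nt.
  have ct : coxp t 1 (FA t 1) (FB t 1) by rewrite /coxp nt.
  rewrite /line0 /line1 /= in ea eb ea0 eb0 Ut U0t st; rewrite st in ea eb ea0 eb0 Ut U0t.
  have := local_datum_compare D data0 ct Ut U0t.
  rewrite !wt_affine // ea eb ea0 eb0 subr0 => HH.
  rewrite /base_num /base_den !hornerM !horner_exp hornerXsubC hornerX.
  transitivity ((t - c) ^+ u * (Na.[t] / Ea.[t]) * (t ^+ v0 * (Nb0.[t] / Eb0.[t])) *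
    (W j).[t] * (Ea.[t] * Eb.[t] * Ea0.[t] * Eb0.[t])).
    by field; rewrite ?at0 ?bt0 ?at1 ?bt1.
  by rewrite HH; field; rewrite ?at0 ?bt0 ?at1 ?bt1.
have r1 : ~~ root (Na * Eb * W j) c by rewrite /root !hornerM !mulf_neq0.
have r2 : ~~ root (Nb * Ea) c by rewrite /root !hornerM !mulf_neq0.
have split_mup (F1 F2 : {poly k}) n : ~~ root F1 c -> F2 != 0 ->
    mup c (('X - c%:P) ^+ n * F1 * F2) = (n + mup c F2)%N.
  move=> r0 F20; have F10 : F1 != 0 by apply: contraNneq r0 => ->; rewrite root0.
  rewrite mupM ?mulf_neq0 ?expf_neq0 ?polyXsubC_eq0 // mupMl //.
  by rewrite mup_XsubCX eqxx.
have := congr1 (mup c) H; rewrite !split_mup //.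
exact: subz_addn.
Qed.
(** In the parameter [t = 1 / x], reversing numerator and denominator contributes their degrees, and
    homogeneity of [wt] contributes [e + d + e]. *)
Lemma multiplicity_infty j m U a b u v Na Ea Nb Eb :
  local_datum e A B s V f false j 0 m U a b u v Na Ea Nb Eb ->
  cx j (FA 1 0) (FB 1 0) != 0 ->
  m = (e + d + e + (size base_den).-1)%N%:Z - (size base_num).-1%:Z.
Proof.
move=> D Wc; have [_ _ -> /and4P[Nac Eac Nbc Ebc] DE] := D.
have [_ _ _ /and4P[Na00 Ea00 Nb00 Eb00] DE0] := data0.
have [num0 den0] := base_neq0.
have [P [P0 eP]] : exists P : {poly k}, P.[0] != 0 /\
    forall t, cx j (FA 1 t) (FB 1 t) = P.[t].
  have pF n F : polyfun (fun t : k => bform n F 1 t).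
    apply: (fa_bform _ _ (polyfun_fa k)); last exact: polyfun_id.
    exact: (fa_cst (polyfun_fa k)).
  have [P eP] : polyfun (fun t => cx j (FA 1 t) (FB 1 t)).
    by rewrite /cx; case: (j); exact: pF.
  by exists P; split=> //; rewrite -eP.
have [Rn Rn0 eRn] := reversal num0; have [Rd Rd0 eRd] := reversal den0.
have [Ra Ra0 eRa] := reversal (nzp Ea00); have [Rb Rb0 eRb] := reversal (nzp Eb00).
set p := (size base_num).-1 in eRn *; set q := (size base_den).-1 in eRd *.
have H : ('X - (0 : k)%:P) ^+ (u + p) * (Na * Eb * P) * Rd =
         ('X - (0 : k)%:P) ^+ (v + (e + d + e + q)) * (Nb * Ea) * Rn.
  apply: (@poly_eq_cofinite k _ _ (Ea * Eb * (Ra * Rb) * 'X)).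
    by rewrite !mulf_neq0 ?polyX_eq0 ?(nzp Ra0) ?(nzp Rb0) ?(nzp Eac) ?(nzp Ebc).
  move=> t; rewrite 4!hornerM hornerX !mulf_eq0 !negb_or.
  move=> /andP[/andP[/andP[at0 bt0] /andP[at1 bt1]] t0].
  have {}at1 : Ea0.[t^-1] != 0.
    by move: at1; rewrite eRa // mulf_eq0 negb_or => /andP[].
  have {}bt1 : Eb0.[t^-1] != 0.
    by move: bt1; rewrite eRb // mulf_eq0 negb_or => /andP[].
  have [Ut ea eb] := DE t at0 bt0; have [U0t ea0 eb0] := DE0 t^-1 at1 bt1.
  have nt := line_neq0 false t; have [nF st] := sE nt.
  have ct : coxp 1 t (FA 1 t) (FB 1 t) by rewrite /coxp nt.
  have pt : P1pt t^-1 1 = P1pt 1 t.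
    by rewrite -(P1pt_scale t0 (line_neq0 true t^-1)) /= divff // mulr1.
  rewrite /line0 /line1 /= in ea eb ea0 eb0 Ut U0t st; rewrite pt in ea0 eb0 U0t.
  rewrite st in ea eb ea0 eb0 Ut U0t.
  have := local_datum_compare D data0 ct Ut U0t.
  rewrite wt_infty // /wt expr1n mul1r eP ea eb ea0 eb0 !subr0 => HH.
  rewrite !hornerM !horner_exp hornerX eRn // eRd //.
  rewrite /base_num /base_den !hornerM !horner_exp hornerX -/base_num -/base_den -/p -/q.
  transitivity (t ^+ u * (Na.[t] / Ea.[t]) * (t^-1 ^+ v0 * (Nb0.[t^-1] / Eb0.[t^-1])) *
    P.[t] * (Ea.[t] * Eb.[t] * Ea0.[t^-1] * Eb0.[t^-1] * t ^+ p * t ^+ q)).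
    by rewrite exprD; field; rewrite ?at0 ?bt0 ?at1 ?bt1 ?t0.
  by rewrite HH !exprD; field; rewrite ?at0 ?bt0 ?at1 ?bt1 ?t0.
have r1 : ~~ root (Na * Eb * P) 0 by rewrite /root !hornerM !mulf_neq0.
have r2 : ~~ root (Nb * Ea) 0 by rewrite /root !hornerM !mulf_neq0.
have split_mup (F1 F2 : {poly k}) n : ~~ root F1 0 -> ~~ root F2 0 ->
    mup 0 (('X - (0 : k)%:P) ^+ n * F1 * F2) = n.
  by move=> r0 r0'; rewrite !mupMl // mup_XsubCX eqxx.
have := congr1 (mup 0) H; rewrite !split_mup //.
exact: subz_addn.
Qed.
End Base.

End SelfIntersection.

Lemma sum_subset_support (T : eqType) (Z L : seq T) (F : T -> int) : uniq Z -> uniq L ->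
  {subset Z <= L} -> (forall p, p \notin Z -> F p = 0) ->
  \sum_(p <- Z) F p = \sum_(p <- L) F p.
Proof.
move=> uZ uL ZL F0; rewrite [RHS](bigID (mem Z)) /= [X in _ + X]big1 ?addr0 //.
rewrite -[RHS]big_filter; apply: perm_big; apply: uniq_perm => //.
  exact: filter_uniq.
move=> p; rewrite mem_filter; apply/idP/andP => [pZ|[//]]; split=> //.
exact: ZL.
Qed.

Lemma self_intersection_section (k : closedFieldType) (d e : nat) (A B : {poly k})
    (s : proj_space k 1 -> hirzebruch k d) (n : int) :
  morphism s ->
  (forall x0 x1 : k, (x0, x1) != (0, 0) ->
    (bform (e + d) A x0 x1, bform e B x0 x1) != (0, 0) /\
    s (P1pt x0 x1) = Hpt d x0 x1 (bform (e + d) A x0 x1) (bform e B x0 x1)) ->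
  (size A <= (e + d).+1)%N -> (size B <= e.+1)%N ->
  self_intersection s n -> n = (e + d + e)%N.
Proof.
move=> ms sE sA sB [V [f [mult [Z [[oV dV] rf loc [uZ mZ] ->]]]]].
have cxE (i : bool) (c : k) : exists j, cx j
    (bform (e + d) A (line0 i c) (line1 i c)) (bform e B (line0 i c) (line1 i c)) != 0.
  have [+ _] := sE _ _ (line_neq0 i c); rewrite pair_neq0 => /orP[H|H].
    by exists false.
  by exists true.
have [j0 W0] := cxE true 0.
have [U0 [a0 [b0 [u0 [v0 [Na0 [Ea0 [Nb0 [Eb0 D0]]]]]]]]] :=
  local_datum_exists ms sE (loc _) W0.
have WE j (c : k) : cx j (bform (e + d) A (line0 true c) (line1 true c))
    (bform e B (line0 true c) (line1 true c)) = (if j then B else A).[c].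
  by rewrite /= !bform_x1 //; case: j.
rewrite WE in W0.
set P := base_num A B j0 u0 Na0 Eb0; set Q := base_den v0 Ea0 Nb0.
have [P0 Q0] : P != 0 /\ Q != 0 := base_neq0 D0 W0.
have maff (c : k) : mult (P1pt c 1) = (mup c P)%:Z - (mup c Q)%:Z.
  have [j Wc] := cxE true c.
  have [U [a [b [u [v [Na [Ea [Nb [Eb D]]]]]]]]] := local_datum_exists ms sE (loc _) Wc.
  rewrite WE in Wc.
  exact: (multiplicity_affine sE sA sB dV D0 W0 D Wc).
have minf : mult (P1pt 1 0) = (e + d + e + (size Q).-1)%N%:Z - (size P).-1%:Z.
  have [j Wc] := cxE false 0.
  have [U [a [b [u [v [Na [Ea [Nb [Eb D]]]]]]]]] := local_datum_exists ms sE (loc _) Wc.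
  exact: (multiplicity_infty sE sA sB dV D0 W0 D Wc).
have [rP eP] := closed_field_poly_normal P.
have [rQ eQ] := closed_field_poly_normal Q.
pose coord (p : projpt k 1) : k := val (repr p) 0 0 / val (repr p) 0 1.
(* All affine points of nonzero multiplicity or in [Z]. A point at infinity gets a junk coordinate
   through division by 0, which is harmless since [L] only has to be large enough. *)
pose L := undup (rP ++ rQ ++ map coord Z).
have n1 (x : k) : (x, 1) != (0, 0) := line_neq0 true x.
have inj : injective (fun c : k => P1pt c 1 : projpt k 1).
  move=> c c' /= /(P1pt_eq (n1 c) (n1 c'))[l _ []]; rewrite mulr1 => -> <-.
  by rewrite mul1r.
rewrite (@sum_subset_support _ Z
  ((P1pt 1 0 : projpt k 1) :: map (fun c => P1pt c 1) L)) //; last first.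
- move=> p pZ; rewrite inE; apply/orP.
  have [a [b [nab ep]]] : exists a b : k, (a, b) != (0, 0) /\ p = P1pt a b.
    exact: P1pt_surj.
  have ep' : p = P1pt (val (repr p) 0 0) (val (repr p) 0 1) by rewrite P1ptE reprK.
  have nr : (val (repr p) 0 0, val (repr p) 0 1) != (0, 0).
    by rewrite -row2_neq0 -row2E; have /set_mem := valP (repr p).
  have [r1|r1] := eqVneq (val (repr p) 0 1) 0.
    left; rewrite {1}ep' r1; apply/eqP.
    have r0 : val (repr p) 0 0 != 0 by move: nr; rewrite pair_neq0 r1 eqxx orbF.
    by have := P1pt_scale r0 (line_neq0 false 0); rewrite /= mulr1 mulr0.
  right; apply/mapP; exists (coord p).
    by rewrite mem_undup !mem_cat map_f ?orbT.
  by rewrite {1}ep' -(P1pt_scale r1 (n1 (coord p))) mulr1 mulrC divfK.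
- rewrite /= map_inj_uniq ?undup_uniq // andbT; apply/mapP => -[c _].
  move=> /(P1pt_eq (line_neq0 false 0) (n1 c))[l _ []] _; rewrite /= mulr0 => /eqP.
  by rewrite oner_eq0.
rewrite big_cons big_map minf; under eq_bigr do rewrite maff.
have sumz (F : k -> nat) : \sum_(c <- L) (F c)%:Z = (\sum_(c <- L) F c)%N%:Z.
  by rewrite (big_morph Posz PoszD (erefl _)).
(* The affine points contribute [deg P - deg Q], which cancels against the degrees in the
   multiplicity at infinity. *)
rewrite sumrB !sumz !sum_mup ?undup_uniq //.
- by rewrite PoszD addrA subrK addrK.
- move=> c; rewrite eQ rootZ ?lead_coef_eq0 // root_prod_XsubC => cr.
  by rewrite mem_undup !mem_cat cr orbT.
- move=> c; rewrite eP rootZ ?lead_coef_eq0 // root_prod_XsubC => cr.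
  by rewrite mem_undup !mem_cat cr.
Qed.

Theorem ample_section_form (k : closedFieldType) (d : nat)
    (s : proj_space k 1 -> hirzebruch k d) :
  is_section s -> ample (range s) ->
  exists (A B : {poly k}) (e : nat),
    [/\ (0 < e)%N, coprimep A B /\ B != 0,
        (size B <= e.+1)%N /\ (size A <= (e + d).+1)%N,
        (size B == e.+1) || (size A == (e + d).+1) &
    forall x0 x1 : k, (x0, x1) != (0, 0) ->
      (bform (e + d) A x0 x1, bform e B x0 x1) != (0, 0) /\
      s (P1pt x0 x1) = Hpt d x0 x1 (bform (e + d) A x0 x1) (bform e B x0 x1)].
Proof.
move=> hs ams; have n10 : (1, 0) != (0, 0) :> k * k by rewrite pair_neq0 oner_eq0.
have n01 : (0, 1) != (0, 0) :> k * k by rewrite pair_neq0 oner_eq0 orbT.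
have [[A [B [e [cAB B0 [sB sA] sAB sE]]]]|sE] := section_form hs.
  exists A, B, e; split=> //; rewrite lt0n; apply/eqP => e0; subst e.
  (* For [e = 0] the form [B] is a nonzero constant, and the curve [y1 = 0] misses the section. *)
  apply: (@ample_meets k d (range s) 1 0) ams => //.
  - exact: zopen_compl_section sE.
  - move=> l x0 x1 l0 nx; rewrite -[RHS](@Hpt_act k d x0 x1 _ _ l (l ^- d) l0).
    + by rewrite divff ?expf_neq0 // mulr1 mulr0.
    + by rewrite invr_eq0 expf_neq0.
    + by rewrite /coxp nx n10.
  - move=> x0 x1 nx; have cx : coxp x0 x1 1 0 by rewrite /coxp nx n10.
    move=> /(range_section sE cx); rewrite /sec_eq /bform big_ord1.
    rewrite mulr0 !mulr1 sub0r => /eqP.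
    rewrite oppr_eq0 => /eqP B00; case/eqP: B0.
    by rewrite (size1_polyC sB) B00.
have rE x0 x1 y0 y1 : coxp x0 x1 y0 y1 ->
    range s (Hpt d x0 x1 y0 y1) <-> y1 = 0.
  move=> cx; have /andP[nx ny] := cx; split=> [[p _ ep]|y10].
    have [a [b [nab eab]]] := P1pt_surj p; move: ep; rewrite eab sE // => H.
    have [|l [m [_ _ [_ _ _ ->]]]] := (Hpt_eq d _ cx).1 H; last by rewrite mulr0.
    by rewrite /coxp nab n10.
  exists (P1pt x0 x1) => //; rewrite sE //; apply/Hpt_eq_fibre => //.
  by rewrite y10; ring.
(* Here the section is [y1 = 0], and the curve [y0 = 0] misses it. *)
exfalso; apply: (@ample_meets k d (range s) 0 1) ams => //.
- have iy : cox_invariant d (fun x0 x1 y0 y1 : k => y1 != 0).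
    by move=> l m x0 x1 y0 y1 l0 m0 _; rewrite mulf_eq0 (negPf m0).
  have := Hlift_zopen iy (@mpolyfun_coord k 4 3); congr zopen.
  apply/funext => p; apply/propext.
  have [x0 [x1 [y0 [y1 [cx ->]]]]] := Hpt_surj p.
  rewrite /= HliftE //; split; first by move/eqP => H /(rE _ _ _ _ cx).
  by move=> H; apply/eqP => /(rE _ _ _ _ cx).
- move=> l x0 x1 l0 nx; rewrite -[RHS](@Hpt_act k d x0 x1 _ _ l _ l0 (oner_neq0 k)).
    by rewrite !mulr1 mulr0.
  by rewrite /coxp nx n01.
- move=> x0 x1 nx; have cx : coxp x0 x1 0 1 by rewrite /coxp nx n01.
  move=> /(rE _ _ _ _ cx)/eqP; by rewrite oner_eq0.
Qed.

(** * Choice of a fibre *)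

Section Generic.
Variable k : closedFieldType.
Hypothesis char0 : [pchar k] =i pred0.
Implicit Types (P Q C D F H : {poly k}).

(** Reduction modulo [P] bounds [D]; the bound on [C] follows from [P * C = F + Q * D] because the
    degree of [P] is exactly [p]. *)
Lemma bezout_bounded P Q F p q : coprimep P Q -> size P = p.+1 ->
  (size Q <= q.+1)%N -> (size F <= p + q)%N ->
  exists C D, [/\ (size C <= q)%N, (size D <= p)%N & P * C - Q * D = F].
Proof.
move=> cPQ sP sQ sF; have [[u v] /= uv] := Bezout_eq1_coprimepP _ _ cPQ.
have P0 : P != 0 by rewrite -size_poly_gt0 sP.
pose D1 := - (v * F); pose D := D1 %% P; pose C := u * F - Q * (D1 %/ P).
have e : P * C - Q * D = F.
  have eD : D = D1 - D1 %/ P * P by rewrite {1}(divp_eq D1 P) addrAC subrr add0r.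
  rewrite /C eD /D1 -[RHS]mul1r -uv; ring.
have sD : (size D <= p)%N by rewrite -ltnS -sP ltn_modp.
exists C, D; split=> //; have [->|C0] := eqVneq C 0; first by rewrite size_poly0.
have : (size (P * C)%R <= p + q)%N.
  rewrite -[P * C](subrK (Q * D)) e; apply: leq_trans (size_polyD _ _) _.
  rewrite geq_max sF; apply: leq_trans (size_polyMleq _ _) _.
  by move: (size Q) (size D) sQ sD => x y; lia.
by rewrite size_mul // sP /= leq_add2l.
Qed.

(** With [u * P + v * Q = 1], take the coefficient of degree [p - 1] of [F * v] modulo [P]. On
    [P * C - Q * D] it is minus that coefficient of [D], so it detects whether [D] has the largest
    allowed degree. *)
Lemma top_coefficient_functional P Q p q : coprimep P Q -> size P = p.+1 ->
  (0 < p)%N -> (0 < q)%N -> exists lam : {poly k} -> k,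
  [/\ forall c F F', lam (c *: F + F') = c * lam F + lam F',
      forall C D, (size D < p)%N -> lam (P * C - Q * D) = 0 &
      exists2 F : {poly k}, (size F <= (p + q).-1)%N & lam F != 0].
Proof.
move=> cPQ sP p0 q0; have [[u v] /= uv] := Bezout_eq1_coprimepP _ _ cPQ.
have P0 : P != 0 by rewrite -size_poly_gt0 sP.
exists (fun F => ((F * v) %% P)`_(p.-1)); split.
- move=> c F F'; rewrite mulrDl modpD coefD -scalerAl modpZl coefZ //.
- move=> C D sD; have -> : (P * C - Q * D) * v = (C * v + D * u) * P - D.
    have eD : D = (u * P + v * Q) * D by rewrite uv mul1r.
    rewrite [in X in _ = _ - X]eD; ring.
  rewrite modpD modp_mull add0r modp_small; last by rewrite size_polyN sP ltnS ltnW.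
  by rewrite coefN nth_default ?oppr0 // -ltnS prednK.
- exists ((Q * 'X^(p.-1)) %% P).
    have : (size ((Q * 'X^(p.-1)) %% P)%R < size P)%N by rewrite ltn_modp.
    by rewrite sP; move: (size _) => x; lia.
  have -> : ((Q * 'X^(p.-1)) %% P * v) %% P = 'X^(p.-1).
    rewrite mulrC modp_mul mulrA.
    have -> : v * Q * 'X^(p.-1) = - (u * 'X^(p.-1)) * P + 'X^(p.-1).
      rewrite -[X in _ + X]mul1r -uv; ring.
    by rewrite modpD modp_mull add0r modp_small // size_polyXn sP; lia.
  by rewrite coefXn eqxx oner_eq0.
Qed.

Lemma natr_neq0 n : (0 < n)%N -> n%:R != 0 :> k.
Proof. by move=> n0; rewrite ((pcharf0P _).1 char0) -lt0n. Qed.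

(* The powers of linear forms span the binary forms, in characteristic 0. *)
Lemma functional_power (lam : {poly k} -> k) m F H :
  (forall c F F', lam (c *: F + F') = c * lam F + lam F') ->
  (size F <= m.+1)%N -> lam F != 0 -> H != 0 ->
  exists t : k, H.[t] != 0 /\ lam (('X - t%:P) ^+ m) != 0.
Proof.
move=> lin sF lF H0.
have lam0 : lam 0 = 0.
  by have := lin (-1) 0 0; rewrite scaler0 addr0 mulN1r addNr.
have lam_sum n (c : 'I_n -> k) (E : 'I_n -> {poly k}) :
    lam (\sum_(i < n) c i *: E i) = \sum_(i < n) c i * lam (E i).
  elim/big_rec2: _ => // i x y _ <-; exact: lin.
(* [L] is the image under [lam] of the [m]-th power of ['X - t], as a polynomial in [t]. Its
   binomial coefficients are invertible, so [L = 0] would kill every monomial and hence [F]. *)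
pose L := \poly_(i < m.+1) ((-1) ^+ i * 'C(m, i)%:R * lam 'X^(m - i)).
have L0 : L != 0.
  apply: contraNneq lF => L0.
  have lX (j : 'I_m.+1) : lam 'X^j = 0.
    have := congr1 (fun G : {poly k} => G`_(m - j)) L0.
    have jm : (j <= m)%N by rewrite -ltnS.
    rewrite coef_poly coef0 ltnS leq_subr subKn // => /eqP.
    rewrite !mulf_eq0 signr_eq0 /= => /orP[|/eqP //].
    by rewrite (negPf (natr_neq0 _)) // bin_gt0 leq_subr.
  have -> : F = \sum_(i < m.+1) F`_i *: 'X^i.
    rewrite -poly_def; apply/polyP => i; rewrite coef_poly; case: ltnP => // mi.
    by rewrite nth_default // (leq_trans sF).
  by rewrite lam_sum big1 // => i _; rewrite lX mulr0.
have [t] := nonroot (mulf_neq0 L0 H0).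
rewrite hornerM mulf_eq0 negb_or => /andP[Lt Ht]; exists t; split=> //.
have -> : ('X - t%:P) ^+ m =
    \sum_(i < m.+1) ((-1) ^+ i * 'C(m, i)%:R * t ^+ i) *: 'X^(m - i).
  rewrite exprBn; apply: eq_bigr => i _.
  rewrite -mulr_natr -!mul_polyC !polyCM !polyC_exp polyCN polyCMn; ring.
rewrite lam_sum; apply: contraNneq Lt => <-; apply/eqP.
rewrite horner_poly; apply: eq_bigr => i _; ring.
Qed.

(** If [C] and [D] had the common root [t], dividing it out would write the power of exponent
    [p + q - 2] with a second coefficient of smaller degree; the functional [lam] excludes this for
    general [t]. *)
Lemma generic_point P Q H p q : coprimep P Q -> size P = p.+1 ->
  (size Q <= q.+1)%N -> (0 < p)%N -> (0 < q)%N -> H != 0 ->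
  exists (t : k) C D, [/\ H.[t] != 0, (size C <= q)%N /\ (size D <= p)%N,
    P * C - Q * D = ('X - t%:P) ^+ (p + q).-1 & (C.[t], D.[t]) != (0, 0)].
Proof.
move=> cPQ sP sQ p0 q0 H0.
have [lam [lin lam0 [F sF lF]]] := top_coefficient_functional cPQ sP p0 q0.
have pq : ((p + q).-2.+1 = (p + q).-1)%N by lia.
have [|t [Ht lt]] := @functional_power lam (p + q).-2 F H lin _ lF H0.
  by rewrite pq.
have [|C [D [sC sD e]]] := @bezout_bounded P Q (('X - t%:P) ^+ (p + q).-1) p q cPQ sP sQ.
  by rewrite size_exp_XsubC; lia.
exists t, C, D; split=> //; rewrite pair_neq0 -negb_and; apply: contra lt.
move=> /andP[/eqP/rootP/factor_theorem[C' eC] /eqP/rootP/factor_theorem[D' eD]].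
have X0 : 'X - t%:P != 0 by rewrite polyXsubC_eq0.
apply/eqP; have -> : ('X - t%:P) ^+ (p + q).-2 = P * C' - Q * D'.
  apply: (mulIf X0); rewrite -exprSr pq -e eC eD; ring.
apply: lam0; have [->|D0] := eqVneq D' 0; first by rewrite size_poly0.
by move: sD; rewrite eD size_mul // size_XsubC addn2.
Qed.

Theorem generic_section_point (A B : {poly k}) (e d : nat) : (0 < e)%N ->
  coprimep A B -> B != 0 -> (size B <= e.+1)%N -> (size A <= (e + d).+1)%N ->
  (size B == e.+1) || (size A == (e + d).+1) ->
  exists (t : k) C D, [/\ B.[t] != 0, D.[t] != 0,
    (size C <= e + d)%N, (size D <= e)%N &
    B * C - A * D = ('X - t%:P) ^+ (e + d + e).-1].
Proof.
move=> e0 cAB B0 sB sA szAB.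
have [t [C [D [Bt [sC sD] E nz]]]] : exists (t : k) C D,
    [/\ B.[t] != 0, (size C <= e + d)%N /\ (size D <= e)%N,
    B * C - A * D = ('X - t%:P) ^+ (e + d + e).-1 & (C.[t], D.[t]) != (0, 0)].
  case/orP: szAB => /eqP sz.
    have cBA : coprimep B A by rewrite coprimep_sym.
    have [|t [C [D [Bt sCD E nz]]]] := generic_point cBA sz sA e0 _ B0.
      by rewrite addn_gt0 e0.
    by exists t, C, D; split=> //; rewrite E addnC.
  have [|t [C [D [Bt [sC sD] E nz]]]] := generic_point cAB sz sB _ e0 B0.
    by rewrite addn_gt0 e0.
  exists t, (- D), (- C); split=> //; rewrite ?size_polyN //.
    by rewrite -E; ring.
  by move: nz; rewrite !pair_neq0 !hornerN !oppr_eq0 orbC.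
(* If [D] vanished at [t], the identity would give [B.[t] * C.[t] = 0], hence a common zero of [C]
   and [D]. *)
exists t, C, D; split=> //; apply: contraTneq nz => Dt.
have := congr1 (horner^~ t) E; rewrite /= hornerD hornerN !hornerM Dt mulr0 subr0.
rewrite horner_exp hornerXsubC subrr expr0n.
have -> : ((e + d + e).-1 == 0)%N = false by lia.
by move=> /eqP; rewrite mulf_eq0 (negPf Bt) /= => /eqP ->; rewrite eqxx.
Qed.
End Generic.

(** * Characters of the ring of invariants *)

Section SpecInvariants.
Variables (k : closedFieldType) (b : nat).
Local Notation IR := (inv_ring k b).
Local Notation F := (threefold_pt k b).

Definition point_eval (x : F) (f : IR) : k := val f x.

Section Eval.
Variable x : F.
Fact point_eval_zmod : zmod_morphism (point_eval x).
Proof. by move=> f g; rewrite /point_eval rmorphB. Qed.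
Fact point_eval_monoid : monoid_morphism (point_eval x).
Proof. by split=> [|f g]; rewrite /point_eval ?rmorph1 ?rmorphM. Qed.
Fact point_eval_scalable : scalable_for *%R (point_eval x).
Proof. by move=> c f; rewrite /point_eval linearZ. Qed.
HB.instance Definition _ :=
  GRing.isZmodMorphism.Build IR k (point_eval x) point_eval_zmod.
HB.instance Definition _ :=
  GRing.isMonoidMorphism.Build IR k (point_eval x) point_eval_monoid.
HB.instance Definition _ :=
  GRing.isScalable.Build k IR k *%R (point_eval x) point_eval_scalable.
End Eval.
Definition evr (x : F) : Spec IR := (point_eval x : {lrmorphism IR -> k | *%R}).
Lemma evrE x (f : IR) : evr x f = val f x. Proof. by []. Qed.

Lemma val_invP (f : IR) : polynomial_fun (val f) /\ torus_invariant (val f).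
Proof. exact/asboolP/(valP f). Qed.

(** The hypothesis is the vanishing of the torus weight [j + l - i - b m], written without
    subtraction. *)
Lemma inv_monomial (i j m l : nat) : (i + b * m = j + l)%N ->
  exists f : IR, forall x : F,
    val f x = val x 0 0 ^+ i * val x 0 1 ^+ j * val x 0 2 ^+ m * val x 0 3 ^+ l.
Proof.
move=> w; pose h (x : F) : k^o :=
  val x 0 0 ^+ i * val x 0 1 ^+ j * val x 0 2 ^+ m * val x 0 3 ^+ l.
have hP : h \in @invariants k b.
  apply/asboolP; split.
    exists ('X_0 ^+ i * 'X_1 ^+ j * 'X_2 ^+ m * 'X_3 ^+ l) => x.
    by rewrite !rmorphM /= !rmorphXn /= !mevalXU.
  move=> t t0 x y e; rewrite /h e /torus_act !row4C !exprMn -exprVn -exprM.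
  have : t^-1 ^+ i * t ^+ j * t^-1 ^+ (b * m) * t ^+ l = 1.
    transitivity (t^-1 ^+ (i + b * m) * t ^+ (j + l)); first by rewrite !exprD; ring.
    by rewrite w exprVn mulVf // expf_neq0.
  by move=> H; rewrite -[RHS]mul1r -H; ring.
by exists (exist (fun f => f \in @invariants k b) h hP).
Qed.

Lemma inv_ring_eq (f g : IR) : (forall x, val f x = val g x) -> f = g.
Proof. by move=> fg; apply: val_inj; apply/funext. Qed.

Lemma val_invM (f g : IR) x : val (f * g) x = val f x * val g x.
Proof. by rewrite rmorphM. Qed.
Lemma val_invB (f g : IR) x : val (f - g) x = val f x - val g x.
Proof. by rewrite rmorphB. Qed.
Lemma val_invD (f g : IR) x : val (f + g) x = val f x + val g x.
Proof. by rewrite rmorphD. Qed.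
Lemma val_inv1 x : val (1 : IR) x = 1.
Proof. by rewrite rmorph1. Qed.
Lemma val_invX (f : IR) n x : val (f ^+ n) x = val f x ^+ n.
Proof. by elim: n => [|n IHn]; rewrite ?expr0 ?val_inv1 // !exprS val_invM IHn. Qed.

(* Clearing denominators: a character of the invariant ring that does not kill
   g is determined on the localization at g, where every invariant is a
   polynomial in the fractions r_i / g^N_i. *)
Lemma character_at_point (phi : {lrmorphism IR -> k | *%R}) (g : IR)
    (r : 'I_4 -> IR) (N : 'I_4 -> nat) (y : F) :
  phi g != 0 ->
  (forall x : F, val g x != 0 -> exists2 t, t != 0 &
     forall i, torus_act b t (val x) 0 i = val (r i) x / val g x ^+ N i) ->
  (forall i, val y 0 i = phi (r i) / phi g ^+ N i) ->
  forall f, phi f = val f y.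
Proof.
move=> pg0 rE yE f; have [[P fP] fT] := val_invP f.
(* [None] stands for the character and [Some x] for evaluation at [x]. [S] is the algebra of
   functions that a single fraction [Q / g ^+ M] of invariants represents on both; it contains the
   coordinates [al], hence [P] in these coordinates. *)
pose S : set (option F -> k) := [set h | exists M Q,
  (forall x, val g x != 0 -> val Q x = val g x ^+ M * h (Some x)) /\
  phi Q = phi g ^+ M * h None].
have SA : function_algebra S.
  split=> [c|h h' [M [Q [hQ pQ]]] [M' [Q' [hQ' pQ']]]
    |h h' [M [Q [hQ pQ]]] [M' [Q' [hQ' pQ']]]].
  - exists 0%N, (c *: 1); split=> [x _|]; last by rewrite linearZ /= rmorph1 mulr1 mul1r.
    by rewrite -/(point_eval x (c *: 1)) linearZ /= rmorph1 mulr1 mul1r.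
  - exists (M + M')%N, (Q * g ^+ M' + Q' * g ^+ M); split=> [x gx|].
      by rewrite val_invD !val_invM !val_invX hQ // hQ' // exprD; ring.
    by rewrite rmorphD !rmorphM !rmorphXn /= pQ pQ' exprD; ring.
  - exists (M + M')%N, (Q * Q'); split=> [x gx|].
      by rewrite val_invM hQ // hQ' // exprD; ring.
    by rewrite rmorphM /= pQ pQ' exprD; ring.
pose al (i : 'I_4) (o : option F) := if o is Some x then val (r i) x / val g x ^+ N i
  else phi (r i) / phi g ^+ N i.
have Sal i : S (al i).
  exists (N i), (r i); split=> [x gx|]; first by rewrite /al mulrC divfK ?expf_neq0.
  by rewrite /al mulrC divfK ?expf_neq0.
have [M [Q [hQ pQ]]] := fa_meval SA P Sal.
(* The factor [g] makes the equality hold where [g] vanishes; elsewhere the torus moves [x] to the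
   point with coordinates [al], and [f] does not change. *)
have : g * (Q - g ^+ M * f) = 0.
  apply: inv_ring_eq => x; rewrite val_invM val_invB val_invM val_invX.
  rewrite -[RHS]/(point_eval x 0) rmorph0.
  have [->|gx] := eqVneq (val g x) 0; first by rewrite mul0r.
  rewrite hQ //; have [t t0 et] := rE x gx.
  have tF : threefold b (torus_act b t (val x)).
    by apply: torus_actP => //; apply/set_mem/(valP x).
  have -> : val f x = val f (exist (fun a => a \in threefold b) _ (mem_set tF)).
    by apply/esym/(fT t).
  rewrite fP /=; have -> : P.@[fun i => torus_act b t (val x) 0 i] =
      P.@[fun i => al i (Some x)].
    by apply: meval_eq => i; rewrite et.
  by rewrite subrr mulr0.
move=> /(congr1 phi); rewrite rmorphM rmorphB rmorphM rmorphXn rmorph0 /= => /eqP.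
rewrite mulf_eq0 (negPf pg0) /= subr_eq0 pQ => /eqP.
move=> /(mulfI (expf_neq0 M pg0)) <-; rewrite fP.
by apply: meval_eq => i; rewrite yE.
Qed.
End SpecInvariants.

(** * The isomorphism *)

Lemma Spec_eq (k : closedFieldType) (R : comAlgType k) (phi psi : Spec R) :
  (forall a, phi a = psi a) -> phi = psi.
Proof.
case: phi psi => [f [m1 m2 m3]] [g [n1 n2 n3]] /= fg.
have e : f = g by apply/funext.
subst g; congr (GRing.LRMorphism.Pack (GRing.LRMorphism.Class _ _ _)).
- by case: m1 n1 => p [p']; congr (_ _); apply: Prop_irrelevance.
- by case: m2 n2 => p [p']; congr (_ _); apply: Prop_irrelevance.
- by case: m3 n3 => p [p']; congr (_ _); apply: Prop_irrelevance.
Qed.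

Lemma Spec_regular (k : closedFieldType) (R : comAlgType k) (a : R)
    (U : set (Spec R)) : regular U (fun phi : Spec R => phi a).
Proof.
move=> phi _; exists a, 1; rewrite /= rmorph1 oner_eq0; split=> // psi _ _.
by rewrite /= rmorph1 divr1.
Qed.

Lemma Spec_zopen (k : closedFieldType) (R : comAlgType k) (a : R) :
  zopen [set phi : Spec R | phi a != 0].
Proof. by move=> phi pa; exists a. Qed.

(** No invariance of [h] is asked, as needed for lifts to the threefold, which are well defined only
    up to the torus. *)
Lemma Hlift_act (k : closedFieldType) (d : nat) (x0 x1 y0 y1 : k) :
  coxp x0 x1 y0 y1 -> exists l m : k, [/\ l != 0, m != 0 &
    forall T (h : k -> k -> k -> k -> T), Hlift h (Hpt d x0 x1 y0 y1) =
      h (l * x0) (l * x1) (l ^+ d * m * y0) (m * y1)].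
Proof.
move=> cx; have [v ev eq] := HptP d cx; rewrite eq /Hlift.
set w := repr _; have cw : coxp (val w 0 0) (val w 0 1) (val w 0 2) (val w 0 3).
  by apply/cox_row4; rewrite -row4E; apply/set_mem/(valP w).
have [|l [m [l0 m0 [-> -> -> ->]]]] := (Hpt_eq d cx cw).1; last by exists l, m.
by rewrite HptE reprK eq.
Qed.

Lemma H_regular_affine (k : closedFieldType) (d : nat) (O : set 'rV[k]_4)
    (f : hirzebruch k d -> k) (h : 'rV[k]_4 -> k)
    (W := [set p | exists x0 x1 y0 y1 : k, [/\ coxp x0 x1 y0 y1,
      O (row4 x0 x1 y0 y1) & p = Hpt d x0 x1 y0 y1]]) :
  zopen (s := affine k 4) O -> regular (s := affine k 4) O h ->
  (forall l m x0 x1 y0 y1 : k, l != 0 -> m != 0 -> O (row4 x0 x1 y0 y1) ->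
     O (row4 (l * x0) (l * x1) (l ^+ d * m * y0) (m * y1))) ->
  (forall x0 x1 y0 y1 : k, coxp x0 x1 y0 y1 -> O (row4 x0 x1 y0 y1) ->
     f (Hpt d x0 x1 y0 y1) = h (row4 x0 x1 y0 y1)) ->
  zopen W /\ regular W f.
Proof.
move=> oO rh actO fh.
have WO (x0 x1 y0 y1 : k) : coxp x0 x1 y0 y1 -> W (Hpt d x0 x1 y0 y1) ->
    O (row4 x0 x1 y0 y1).
  move=> cx [z0 [z1 [w0 [w1 [cz Oz /esym e]]]]].
  have [l [m [l0 m0 [-> -> -> ->]]]] := (Hpt_eq d cz cx).1 e.
  exact: actO.
have mp4 (P : {mpoly k[4]}) : mpolyfun4 (fun x0 x1 y0 y1 => peval (row4 x0 x1 y0 y1) P).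
  by exists P => x; rewrite -row4E.
split.
  apply: H_zopenI => x0 x1 y0 y1 cx /(WO _ _ _ _ cx) Ox.
  have [b bx bO] := oO _ Ox.
  exists (fun x0 x1 y0 y1 => peval (row4 x0 x1 y0 y1) b); split=> //.
  by move=> z0 z1 w0 w1 cz /bO Oz; exists z0, z1, w0, w1.
apply: H_regularI => x0 x1 y0 y1 cx /(WO _ _ _ _ cx) Ox.
have [a [b [bx ab]]] := rh _ Ox.
exists (fun x0 x1 y0 y1 => peval (row4 x0 x1 y0 y1) a).
exists (fun x0 x1 y0 y1 => peval (row4 x0 x1 y0 y1) b); split=> //.
move=> z0 z1 w0 w1 cz /(WO _ _ _ _ cz) Oz bz.
by rewrite fh // ab.
Qed.

Section ThreefoldPoint.
Variables (k : closedFieldType) (b : nat).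

Definition threefold_mk (a : 'rV[k]_4) : threefold_pt k b :=
  if pselect (threefold b a) is left h
  then exist (fun a => a \in threefold b) _ (mem_set h) else point.

Lemma threefold_mkE a : threefold b a -> val (threefold_mk a) = a.
Proof. by move=> h; rewrite /threefold_mk; case: pselect. Qed.

Lemma threefold_row4 (a1 a2 a3 a4 : k) :
  threefold b (row4 a1 a2 a3 a4) <-> a1 * a4 - a2 ^+ b * a3 = 1.
Proof. by rewrite /threefold /= !row4C. Qed.
End ThreefoldPoint.

(** * Charts of the complement of the section, with [r = e - 1] and [b = 2 e + d - 1] *)

Section Charts.
Variables (k : closedFieldType) (d r : nat) (A B C D : {poly k}) (tau : k).
Let b := (r + d + r.+1)%N.
Hypotheses (sA : (size A <= (r.+1 + d).+1)%N) (sB : (size B <= r.+2)%N).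
Hypotheses (sC : (size C <= (r + d).+1)%N) (sD : (size D <= r.+1)%N).
Hypotheses (Bt : B.[tau] != 0) (Dt : D.[tau] != 0).
Hypothesis bez : B * C - A * D = ('X - tau%:P) ^+ b.
Implicit Types u v w x z l : k.

(* The form P in the coordinates u = x0 - tau x1, v = x1. *)
Definition shifted m (P : {poly k}) u v := bform m P (u + tau * v) v.

Lemma shifted_scale m (P : {poly k}) l u v :
  shifted m P (l * u) (l * v) = l ^+ m * shifted m P u v.
Proof. by rewrite /shifted mulrCA -mulrDr bform_scale. Qed.

Lemma shifted_0 m (P : {poly k}) v : (size P <= m.+1)%N ->
  shifted m P 0 v = v ^+ m * P.[tau].
Proof.
move=> sP; have := shifted_scale m P v 0 1; rewrite mulr0 mulr1 => ->.
by rewrite /shifted add0r mulr1 bform_x1.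
Qed.

Lemma fa_shifted (Y : Type) (S : set (Y -> k)) m P (f g : Y -> k) :
  function_algebra S -> S f -> S g -> S (fun y => shifted m P (f y) (g y)).
Proof.
move=> SA Sf Sg; apply: (fa_bform _ _ SA) => //.
by apply: (fa_add SA) => //; apply: (fa_mul SA) => //; apply: (fa_cst SA).
Qed.

Let fA := shifted (r.+1 + d) A.
Let fB := shifted r.+1 B.
Let fC := shifted (r + d) C.
Let fD := shifted r D.

Lemma shifted_det u v : fB u v * fC u v - fA u v * fD u v = u ^+ b.
Proof.
have PA := polyfun_fa k.
have pu : polyfun (fun _ : k => u) := fa_cst PA u.
have pf m P : polyfun (fun v => shifted m P u v).
  by apply: (fa_shifted _ _ PA) => //; apply: polyfun_id.
apply: (@polyfun_eq k (fun v => fB u v * fC u v - fA u v * fD u v) (fun=> u ^+ b) 'X).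
- by apply: (fa_sub PA); apply: (fa_mul PA); apply: pf.
- exact: (fa_cst PA).
- by rewrite polyX_eq0.
move=> {}v; rewrite hornerX => v0.
rewrite /fA /fB /fC /fD /shifted !bformE //.
have -> : (u + tau * v) / v = u / v + tau by rewrite mulrDl mulfK.
have := congr1 (horner^~ (u / v + tau)) bez.
rewrite /= hornerD hornerN !hornerM horner_exp hornerXsubC addrK => H.
have -> : u ^+ b = v ^+ b * (u / v) ^+ b by rewrite -exprMn mulrC divfK.
rewrite -H /b.
have -> : v ^+ (r + d + r.+1) = v ^+ r.+1 * v ^+ (r + d) by rewrite addnC exprD.
by rewrite addSn !exprS !exprD; ring.
Qed.

(* poly3 E says that E is polynomial, without naming a polynomial: E preserves every
   algebra of functions, be it polynomial functions or regular functions. *)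
Definition poly3 (E : k -> k -> k -> k) : Prop :=
  forall (Y : Type) (S : set (Y -> k)) f g h, function_algebra S ->
    S f -> S g -> S h -> S (fun y => E (f y) (g y) (h y)).

(** Divisibility of an increment in [v] by [w] is stable under sums and products, so difference
    quotients of forms come from those of the two coordinates, without expanding powers. *)
Definition has_quotient : set (k * k -> k) := [set F |
  (forall (Y : Type) (S : set (Y -> k)) f g, function_algebra S ->
    S f -> S g -> S (fun y => F (f y, g y))) /\
  exists2 E, poly3 E & forall u v w, F (u, v + w) - F (u, v) = w * E u v w].

Lemma has_quotient_fa : function_algebra has_quotient.
Proof.
split=> [c|F F' [pF [E pE eE]] [pF' [E' pE' eE']]|F F' [pF [E pE eE]] [pF' [E' pE' eE']]].
- split; first by move=> Y S f g SA _ _; apply: (fa_cst SA).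
  exists (fun _ _ _ => 0); first by move=> Y S f g h SA _ _ _; apply: (fa_cst SA).
  by move=> u v w; rewrite subrr mulr0.
- split; first by move=> Y S f g SA Sf Sg; apply: (fa_add SA); [apply: pF|apply: pF'].
  exists (fun u v w => E u v w + E' u v w).
    by move=> Y S f g h SA Sf Sg Sh; apply: (fa_add SA); [apply: pE|apply: pE'].
  by move=> u v w; rewrite mulrDr -eE -eE'; ring.
- split; first by move=> Y S f g SA Sf Sg; apply: (fa_mul SA); [apply: pF|apply: pF'].
  exists (fun u v w => E u v w * F' (u, v + w) + F (u, v) * E' u v w).
    move=> Y S f g h SA Sf Sg Sh; apply: (fa_add SA); apply: (fa_mul SA).
    + exact: pE.
    + by apply: (pF' Y S f (fun y => g y + h y) SA) => //; apply: (fa_add SA).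
    + exact: (pF Y S f g SA).
    + exact: pE'.
  by move=> u v w; rewrite mulrDr [w * (F _ * _)]mulrCA mulrA -eE -eE'; ring.
Qed.

Lemma shifted_quotient m P m' P' : exists2 E, poly3 E & forall u v w,
  shifted m P u (v + w) - shifted m' P' u (v + w) -
  (shifted m P u v - shifted m' P' u v) = w * E u v w.
Proof.
have HA := has_quotient_fa.
have h1 : has_quotient (fun y : k * k => y.1).
  split; first by move=> Y S f g SA.
  exists (fun _ _ _ => 0); first by move=> Y S f g h SA _ _ _; apply: (fa_cst SA).
  by move=> u v w; rewrite /= subrr mulr0.
have h2 : has_quotient (fun y : k * k => y.2).
  split; first by move=> Y S f g SA.
  exists (fun _ _ _ => 1); first by move=> Y S f g h SA _ _ _; apply: (fa_cst SA).
  by move=> u v w; rewrite /= addrAC subrr add0r mulr1.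
have [_ [E pE eE]] := fa_sub HA (fa_shifted m P HA h1 h2) (fa_shifted m' P' HA h1 h2).
by exists E.
Qed.

Lemma poly3_polyfun E f g h : poly3 E -> polyfun f -> polyfun g -> polyfun h ->
  polyfun (fun x => E (f x) (g x) (h x)).
Proof. by move=> pE pf pg ph; apply: pE => //; apply: polyfun_fa. Qed.

(** At [u = 0] the equation [fB = fD] reads [v ^ r * (v * B(tau) - D(tau)) = 0]; this is its simple
    nonzero root. *)
Definition root0 := D.[tau] / B.[tau].

Lemma root0_neq0 : root0 != 0.
Proof. by rewrite mulf_neq0 ?invr_eq0. Qed.

Lemma polyfun_hornerC (P : {poly k}) : polyfun (fun x : k => P.[x]).
Proof. by exists P. Qed.

Lemma polyfun_zero (f : k -> k) : polyfun f -> f 0 = 0 ->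
  exists g : {poly k}, forall x, f x = x * g.[x].
Proof.
move=> [P eP] f0; have /factor_theorem[g eg] : root P 0 by rewrite /root -eP f0.
by exists g => x; rewrite eP eg hornerM hornerXsubC subr0 mulrC.
Qed.

(** Newton's iteration, one power of [x] at a time. The value [E 0 root0 0] is the derivative at the
    root, and the difference quotient [E] replaces a Taylor expansion. *)
Lemma hensel_root E m : poly3 E ->
  (forall u v w, fB u (v + w) - fD u (v + w) - (fB u v - fD u v) = w * E u v w) ->
  E 0 root0 0 != 0 /\ exists rho th : {poly k}, rho.[0] = root0 /\
    forall x, fB x rho.[x] - fD x rho.[x] = x ^+ m.+1 * th.[x].
Proof.
move=> pE eE; have PA := polyfun_fa k.
have H0 v : fB 0 v - fD 0 v = v ^+ r * (v * B.[tau] - D.[tau]).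
  by rewrite /fB /fD !shifted_0 // exprS; ring.
have Hr : fB 0 root0 - fD 0 root0 = 0 by rewrite H0 /root0 divfK // subrr mulr0.
have E0 w : E 0 root0 w = (root0 + w) ^+ r * B.[tau].
  apply: (@polyfun_eq k (E 0 root0) (fun w => (root0 + w) ^+ r * B.[tau]) 'X).
  - apply: (poly3_polyfun pE (fa_cst PA 0) (fa_cst PA root0)); exact: polyfun_id.
  - apply: (fa_mul PA); last exact: (fa_cst PA).
    by apply: (fa_exp PA); apply: (fa_add PA); [apply: (fa_cst PA) | apply: polyfun_id].
  - by rewrite polyX_eq0.
  move=> {}w; rewrite hornerX => w0; apply: (mulfI w0).
  by rewrite -eE Hr subr0 H0 mulrDl /root0 divfK //; ring.
have En0 : E 0 root0 0 != 0.
  by rewrite E0 addr0 mulf_neq0 // expf_neq0 // root0_neq0.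
have pH (f : k -> k) : polyfun f -> polyfun (fun x => fB x (f x) - fD x (f x)).
  move=> pf; apply: (fa_sub PA); apply: (fa_shifted _ _ PA) => //; exact: polyfun_id.
split=> //; elim: m => [|m [rho [th [rho0 eth]]]].
  have [|th eth] := polyfun_zero (pH _ (fa_cst PA root0)) _; first exact: Hr.
  by exists root0%:P, th; rewrite hornerC; split=> // x; rewrite hornerC expr1 eth.
(* Chosen so that the new remainder [th + c * E] vanishes at 0 and yields one more factor [x]. *)
pose c := - (th.[0] / E 0 root0 0).
have [||th' eth'] := @polyfun_zero (fun x => th.[x] + c * E x rho.[x] (x ^+ m.+1 * c)).
- apply: (fa_add PA); first exact: polyfun_hornerC.
  apply: (fa_mul PA); first exact: (fa_cst PA).
  apply: (poly3_polyfun pE (@polyfun_id k) (polyfun_hornerC rho)).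
  apply: (fa_mul PA); last exact: (fa_cst PA).
  by apply: (fa_exp PA); apply: polyfun_id.
- by rewrite rho0 exprS !mul0r /c mulNr divfK // subrr.
exists (rho + c *: 'X^(m.+1)), th'; split.
  by rewrite hornerD hornerZ hornerXn exprS mul0r mulr0 addr0.
move=> x; rewrite hornerD hornerZ hornerXn (mulrC c) [x ^+ m.+2]exprSr -mulrA -eth' mulrDr.
by rewrite mulrA -eE -eth; ring.
Qed.

(** Divisibility by [x ^ b] passes from [fB - fD] to [fA - fC]: the determinant gives
    [B (A - C) = A (B - D) - x ^ b], and [B] along [rho] is nonzero at [x = 0]. *)
Lemma chart_data : exists (rho th ka Pi : {poly k}) (E E' : k -> k -> k -> k),
  [/\ [/\ poly3 E, poly3 E',
    forall u v w, fB u (v + w) - fD u (v + w) - (fB u v - fD u v) = w * E u v w &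
    forall u v w, fA u (v + w) - fC u (v + w) - (fA u v - fC u v) = w * E' u v w],
    E 0 root0 0 != 0, rho.[0] = root0,
    (forall x, fB x rho.[x] - fD x rho.[x] = x ^+ b * th.[x]) /\
    (forall x, fA x rho.[x] - fC x rho.[x] = x ^+ b * ka.[x]) &
    forall x, 1 - root0^-1 * rho.[x] = x * Pi.[x]].
Proof.
have [E pE eE] := shifted_quotient r.+1 B r D.
have [E' pE' eE'] := shifted_quotient (r.+1 + d) A (r + d) C.
have [En0 [rho [th [rho0 eth]]]] := hensel_root (r + d + r) pE eE.
rewrite -addnS -/b in eth.
have PA := polyfun_fa k.
have ps m P : polyfun (fun x => shifted m P x rho.[x]).
  by apply: (fa_shifted _ _ PA); [apply: polyfun_id | exists rho].
have [Ap eA] := ps (r.+1 + d)%N A; have [Bp eB] := ps r.+1 B.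
have [Kp eK] := fa_sub PA (ps (r.+1 + d)%N A) (ps (r + d)%N C).
have HK : Bp * Kp = 'X^b * (Ap * th - 1).
  apply: (@poly_eq_cofinite k _ _ 1); first exact: oner_neq0.
  move=> x _; rewrite !hornerM hornerD hornerN hornerM hornerXn hornerC.
  rewrite -eA -eB -eK [RHS]mulrBr mulr1 mulrCA -eth -(shifted_det x rho.[x]).
  by rewrite -/fA -/fB -/fC; ring.
have /dvdpP[ka eka] : 'X^b %| Kp.
  rewrite -(@Gauss_dvdpr _ _ Bp); first by rewrite HK dvdp_mulr.
  apply: coprimep_expl; rewrite coprimep_sym -[X in coprimep _ X]subr0 coprimep_XsubC.
  rewrite /root -eB rho0 shifted_0 // mulf_neq0 // expf_neq0 //.
  exact: root0_neq0.
have [||Pi ePi] := @polyfun_zero (fun x => 1 - root0^-1 * rho.[x]).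
- apply: (fa_sub PA); first exact: (fa_cst PA).
  by apply: (fa_mul PA); [apply: (fa_cst PA) | exists rho].
- by rewrite rho0 mulVf ?subrr ?root0_neq0.
exists rho, th, ka, Pi, E, E'; split=> //; split=> // x.
by rewrite [LHS]eK eka hornerM hornerXn mulrC.
Qed.

Section ChartMaps.
Variables (rho th ka Pi : {poly k}) (E E' : k -> k -> k -> k).
Hypotheses (pE : poly3 E) (pE' : poly3 E').
Hypothesis eE : forall u v w,
  fB u (v + w) - fD u (v + w) - (fB u v - fD u v) = w * E u v w.
Hypothesis eE' : forall u v w,
  fA u (v + w) - fC u (v + w) - (fA u v - fC u v) = w * E' u v w.
Hypotheses (En0 : E 0 root0 0 != 0) (rho0 : rho.[0] = root0).
Hypothesis eth : forall x, fB x rho.[x] - fD x rho.[x] = x ^+ b * th.[x].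
Hypothesis eka : forall x, fA x rho.[x] - fC x rho.[x] = x ^+ b * ka.[x].
Hypothesis ePi : forall x, 1 - root0^-1 * rho.[x] = x * Pi.[x].
Let q := root0.
Let q0 : q != 0 := root0_neq0.

(* Chart of the quotient F / T where a1 <> 0, in the coordinates x = a1 a2 and
   z = a1^-b a3, lifted to the normalization A y1 - B y0 = 1. *)
Definition sv x z := rho.[x] + x ^+ b * (z * q).
Definition sy1 x z := th.[x] + z * q * E x rho.[x] (x ^+ b * (z * q)).
Definition sy0 x z := ka.[x] + z * q * E' x rho.[x] (x ^+ b * (z * q)).

(** For [x != 0] this determines [y1]; [th] and [E] carry out the division by [x ^ b] polynomially,
    so that the chart also covers [x = 0]. The summand [x ^ b * (z * q)] of [sv] comes from solving
    [a1 a4 = 1 + x ^ b * z] with [a1 = 1]. *)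
Lemma sy1E x z : x ^+ b * sy1 x z = fB x (sv x z) - fD x (sv x z).
Proof. by rewrite /sy1 mulrDr -eth mulrA -eE /sv; ring. Qed.

Lemma sy0E x z : x ^+ b * sy0 x z = fA x (sv x z) - fC x (sv x z).
Proof. by rewrite /sy0 mulrDr -eka mulrA -eE' /sv; ring. Qed.

Lemma sv_fa (Y : Type) (S : set (Y -> k)) f g : function_algebra S ->
  S f -> S g -> [/\ S (fun y => sv (f y) (g y)), S (fun y => sy1 (f y) (g y)) &
    S (fun y => sy0 (f y) (g y))].
Proof.
move=> SA Sf Sg.
have Sr P : S (fun y => P.[f y]) by apply: (fa_horner SA).
have Szq : S (fun y => g y * q) by apply: (fa_mul SA) => //; apply: (fa_cst SA).
have Sx : S (fun y => f y ^+ b * (g y * q)).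
  by apply: (fa_mul SA) => //; apply: (fa_exp SA).
split; apply: (fa_add SA) => //; apply: (fa_mul SA) => //.
- exact: (pE SA).
- exact: (pE' SA).
Qed.

Lemma polyfun_eqX (f g : k -> k) : polyfun f -> polyfun g ->
  (forall x, x != 0 -> f x = g x) -> forall x, f x = g x.
Proof.
move=> pf pg fg; apply: (polyfun_eq (N := 'X)) => //; first by rewrite polyX_eq0.
by move=> x; rewrite hornerX; apply: fg.
Qed.

(** Multiplied by [x ^ b], both equations become the determinant identity; they extend to [x = 0]
    because all terms are polynomial in [x]. *)
Lemma s_normalized x z :
  fA x (sv x z) * sy1 x z - fB x (sv x z) * sy0 x z = 1 /\
  fC x (sv x z) * sy1 x z - fD x (sv x z) * sy0 x z = 1.
Proof.
have PA := polyfun_fa k.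
have [p1 p2 p3] := sv_fa PA (@polyfun_id k) (fa_cst PA z).
have ps m P : polyfun (fun x => shifted m P x (sv x z)).
  by apply: (fa_shifted _ _ PA) => //; apply: polyfun_id.
pose fst x := fA x (sv x z) * sy1 x z - fB x (sv x z) * sy0 x z.
pose snd x := fC x (sv x z) * sy1 x z - fD x (sv x z) * sy0 x z.
split; [apply: (polyfun_eqX (f := fst) (g := fun=> 1))
       |apply: (polyfun_eqX (f := snd) (g := fun=> 1))]; rewrite /fst /snd.
- by apply: (fa_sub PA); apply: (fa_mul PA) => //; apply: ps.
- exact: (fa_cst PA).
- move=> {}x x0; apply: (mulfI (expf_neq0 b x0)).
  rewrite mulr1 -[RHS](shifted_det x (sv x z)) mulrBr mulrCA sy1E.
  by rewrite [x ^+ b * (fB _ _ * _)]mulrCA sy0E; ring.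
- by apply: (fa_sub PA); apply: (fa_mul PA) => //; apply: ps.
- exact: (fa_cst PA).
- move=> {}x x0; apply: (mulfI (expf_neq0 b x0)).
  rewrite mulr1 -[RHS](shifted_det x (sv x z)) mulrBr mulrCA sy1E.
  by rewrite [x ^+ b * (fD _ _ * _)]mulrCA sy0E; ring.
Qed.

(* Chart where a2 <> 0, in the coordinates p = a1 a2 and w = a4 / a2. *)
Definition tv p w := q * (w - Pi.[p]).
Definition ty1 p w := fB 1 (tv p w) * p - fD 1 (tv p w).
Definition ty0 p w := fA 1 (tv p w) * p - fC 1 (tv p w).

Lemma tv_fa (Y : Type) (S : set (Y -> k)) f g : function_algebra S ->
  S f -> S g -> [/\ S (fun y => tv (f y) (g y)), S (fun y => ty1 (f y) (g y)) &
    S (fun y => ty0 (f y) (g y))].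
Proof.
move=> SA Sf Sg; have St : S (fun y => tv (f y) (g y)).
  apply: (fa_mul SA); first exact: (fa_cst SA).
  by apply: (fa_sub SA) => //; apply: (fa_horner SA).
have Ss m P : S (fun y => shifted m P 1 (tv (f y) (g y))).
  by apply: (fa_shifted _ _ SA) => //; apply: (fa_cst SA).
by split=> //; apply: (fa_sub SA); try exact: Ss; apply: (fa_mul SA) => //; apply: Ss.
Qed.

(** At [u = 1] the determinant is 1, and [ty0], [ty1] solve the two linear equations by Cramer's
    rule. *)
Lemma t_normalized p w :
  fA 1 (tv p w) * ty1 p w - fB 1 (tv p w) * ty0 p w = 1 /\
  fC 1 (tv p w) * ty1 p w - fD 1 (tv p w) * ty0 p w = p.
Proof.
have := shifted_det 1 (tv p w); rewrite expr1n => H.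
by split; [rewrite -[RHS]H | rewrite -[RHS]mulr1 -[X in _ = _ * X]H];
  rewrite /ty1 /ty0; ring.
Qed.

Let G := sec_eq d r.+1 A B.

Lemma shifted_sub m P (x0 x1 : k) : shifted m P (x0 - tau * x1) x1 = bform m P x0 x1.
Proof. by rewrite /shifted subrK. Qed.

Lemma sec_eq_coxp (x0 x1 y0 y1 : k) : G x0 x1 y0 y1 != 0 -> coxp x0 x1 y0 y1.
Proof.
move=> G0; apply/andP; split; apply: contraNneq G0 => -[-> ->].
  rewrite /G /sec_eq !bform_x0 !expr0n /=.
  by rewrite addSn /= !mulr0 !mul0r subrr.
by rewrite /G /sec_eq !mulr0 subrr.
Qed.

(* The coordinates a1, ..., a4 on F as functions on the complement of the
   section; g3 is given by two formulas, the second being valid near a2 = 0. *)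
Definition g2 (x0 x1 y0 y1 : k) := x0 - tau * x1.
Definition g1 (x0 x1 y0 y1 : k) :=
  (bform (r + d) C x0 x1 * y1 - bform r D x0 x1 * y0) / G x0 x1 y0 y1.
Definition g12 x0 x1 y0 y1 := g1 x0 x1 y0 y1 * g2 x0 x1 y0 y1.
Definition g4 x0 x1 y0 y1 :=
  q^-1 * x1 + g2 x0 x1 y0 y1 * Pi.[g12 x0 x1 y0 y1].
(** The difference quotient of [fB - fD] between the approximate root [rho] and [a1 x1]. On [a2 = 0]
    it is the derivative at the simple root, hence nonzero. *)
Definition gden x0 x1 y0 y1 := E (g12 x0 x1 y0 y1) rho.[g12 x0 x1 y0 y1]
  (g1 x0 x1 y0 y1 * x1 - rho.[g12 x0 x1 y0 y1]).
(** The chart coordinate [a1 ^- b * a3], obtained by solving the formula of [sy1] for [z] instead of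
    dividing by [a2 ^ b]. *)
Definition zeta x0 x1 y0 y1 :=
  q^-1 * (y1 / (G x0 x1 y0 y1 * g1 x0 x1 y0 y1 ^+ (r.+1 + d))
          - th.[g12 x0 x1 y0 y1]) / gden x0 x1 y0 y1.
Definition g3 x0 x1 y0 y1 :=
  if g2 x0 x1 y0 y1 == 0 then g1 x0 x1 y0 y1 ^+ b * zeta x0 x1 y0 y1
  else (g1 x0 x1 y0 y1 * g4 x0 x1 y0 y1 - 1) / g2 x0 x1 y0 y1 ^+ b.

Section AtPoint.
Variables x0 x1 y0 y1 : k.
Hypothesis G0 : G x0 x1 y0 y1 != 0.
Let u := g2 x0 x1 y0 y1.
Let a1 := g1 x0 x1 y0 y1.
Let x := a1 * u.

Let xb : x ^+ b = a1 ^+ b * u ^+ b. Proof. exact: exprMn. Qed.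

Let det : bform r.+1 B x0 x1 * bform (r + d) C x0 x1 -
  bform (r.+1 + d) A x0 x1 * bform r D x0 x1 = u ^+ b.
Proof. by rewrite -(shifted_det u x1) /u /g2 /fA /fB /fC /fD !shifted_sub. Qed.

(** Cramer's rule eliminates [y0]. Multiplied by [a1 ^ r], this is the equation of [rho], satisfied
    by [a1 x1] modulo [u ^ b]. *)
Lemma g1_eq1 : bform r.+1 B x0 x1 * a1 - bform r D x0 x1 = u ^+ b * y1 / G x0 x1 y0 y1.
Proof.
rewrite -det /a1 /g1; apply: (mulIf G0); rewrite mulrBl mulrA divfK // divfK //.
by rewrite /G /sec_eq; ring.
Qed.

Lemma g1_eq0 : bform (r.+1 + d) A x0 x1 * a1 - bform (r + d) C x0 x1 =
  u ^+ b * y0 / G x0 x1 y0 y1.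
Proof.
rewrite -det /a1 /g1; apply: (mulIf G0); rewrite mulrBl mulrA divfK // divfK //.
by rewrite /G /sec_eq; ring.
Qed.

(** On this fibre [x1] is nonzero, so the factor [x1 ^ r] cancels and only the nonzero root is left.
    In particular [a1] and [a2] have no common zero. *)
Lemma g1_at0 : u = 0 -> a1 * x1 = q.
Proof.
move=> u0; have := g1_eq1; rewrite u0 {1}/b addnS exprS !mul0r => /eqP.
have x0E : x0 = tau * x1 by apply/eqP; rewrite -subr_eq0 -/(g2 x0 x1 y0 y1) -/u u0.
rewrite -!shifted_sub x0E subrr !shifted_0 // subr_eq0 => /eqP H.
have x10 : x1 != 0.
  apply: contraNneq G0 => x10; rewrite x0E x10 mulr0 /G /sec_eq !bform_x0.
  by rewrite addSn !exprS !mul0r !mulr0 !mul0r subrr.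
rewrite /q /root0; apply: (mulIf (mulf_neq0 (expf_neq0 r x10) Bt)).
transitivity (x1 ^+ r.+1 * B.[tau] * a1); first by rewrite exprS; ring.
by rewrite H mulrCA divfK.
Qed.

Lemma g1_at0_neq0 : u = 0 -> a1 != 0.
Proof. by move=> /g1_at0 H; apply: contraNneq q0 => a10; rewrite -H a10 mul0r. Qed.

Lemma g14_eq : a1 * g4 x0 x1 y0 y1 - 1 = q^-1 * (a1 * x1 - rho.[x]).
Proof.
rewrite /g4 /g12 -/a1 -/u -/x.
have -> : a1 * (q^-1 * x1 + u * Pi.[x]) = q^-1 * (a1 * x1) + x * Pi.[x].
  by rewrite /x; ring.
by rewrite -ePi; ring.
Qed.

Lemma g_threefold : a1 * g4 x0 x1 y0 y1 - u ^+ b * g3 x0 x1 y0 y1 = 1.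
Proof.
rewrite /g3 -/u; case: eqVneq => [u0|u0].
  rewrite u0 {1}/b addnS exprS !mul0r subr0 -[LHS](subrK 1) g14_eq /x u0 mulr0 rho0.
  by rewrite g1_at0 // subrr mulr0 add0r.
by rewrite -/a1 [u ^+ b * _]mulrC divfK ?expf_neq0 //; ring.
Qed.

(** The increment of [fB - fD] from [rho] to [a1 x1], computed once through [E] and once from its
    values at both ends, [eth] and [g1_eq1]. *)
Lemma zeta_key : a1 != 0 ->
  x ^+ b * (y1 / (G x0 x1 y0 y1 * a1 ^+ (r.+1 + d)) - th.[x]) =
  (a1 * x1 - rho.[x]) * gden x0 x1 y0 y1.
Proof.
move=> a10; rewrite /gden /g12 -/a1 -/u -/x -eE mulrBr -eth.
have er : rho.[x] + (a1 * x1 - rho.[x]) = a1 * x1 by rewrite addrC subrK.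
congr (_ - _); rewrite er.
have -> : fB x (a1 * x1) - fD x (a1 * x1) = a1 ^+ r * (u ^+ b * y1 / G x0 x1 y0 y1).
  rewrite -g1_eq1 /fB /fD /x !shifted_scale /u /g2 !shifted_sub exprS; ring.
rewrite xb.
have -> : a1 ^+ b = a1 ^+ r * a1 ^+ (r.+1 + d) by rewrite -exprD /b -addnA (addnC d).
have := expf_neq0 (r.+1 + d)%N a10; move: (a1 ^+ (r.+1 + d)) => y yn.
by field; rewrite yn G0.
Qed.

Lemma gden_at0 : u = 0 -> gden x0 x1 y0 y1 != 0.
Proof.
by move=> u0; rewrite /gden /g12 -/a1 -/u u0 mulr0 rho0 g1_at0 // subrr.
Qed.

Lemma g3_alt : a1 != 0 -> gden x0 x1 y0 y1 != 0 ->
  g3 x0 x1 y0 y1 = a1 ^+ b * zeta x0 x1 y0 y1.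
Proof.
move=> a10 e0; rewrite /g3 -/u; case: eqVneq => // u0.
have x00 : x != 0 by rewrite mulf_neq0.
rewrite -/a1 g14_eq; apply: (mulIf (expf_neq0 b u0)); rewrite divfK ?expf_neq0 //.
have -> : a1 ^+ b * zeta x0 x1 y0 y1 * u ^+ b = x ^+ b * zeta x0 x1 y0 y1.
  by rewrite xb mulrAC.
apply: (mulIf e0); rewrite -mulrA -zeta_key // /zeta /g12 -/a1 -/u -/x.
by field; rewrite e0 q0 G0 expf_neq0.
Qed.

(** The torus element [l = a1], [m = gm] normalizes both [a1] and [G] to 1, which brings the point
    into the form of the chart. *)
Lemma chart1_pt : a1 != 0 -> Hpt d (x + tau * sv x (a1 ^- b * g3 x0 x1 y0 y1))
    (sv x (a1 ^- b * g3 x0 x1 y0 y1))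
    (sy0 x (a1 ^- b * g3 x0 x1 y0 y1)) (sy1 x (a1 ^- b * g3 x0 x1 y0 y1)) =
  Hpt d x0 x1 y0 y1.
Proof.
move=> a10; set z := _ * g3 _ _ _ _.
have ezq : x ^+ b * (z * q) = a1 * x1 - rho.[x].
  rewrite /z xb.
  have -> : a1 ^+ b * u ^+ b * (a1 ^- b * g3 x0 x1 y0 y1 * q) = u ^+ b * g3 x0 x1 y0 y1 * q.
    have := expf_neq0 b a10; move: (a1 ^+ b) => y yn.
    by field; rewrite yn.
  have -> : u ^+ b * g3 x0 x1 y0 y1 = a1 * g4 x0 x1 y0 y1 - 1 by rewrite -g_threefold; ring.
  by rewrite g14_eq mulrAC mulVf // mul1r.
have ev : sv x z = a1 * x1 by rewrite /sv ezq addrC subrK.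
set gm := (G x0 x1 y0 y1 * a1 ^+ (r.+1 + d))^-1.
have gm0 : gm != 0 by rewrite invr_eq0 mulf_neq0 ?expf_neq0.
have ey1 : sy1 x z = gm * y1.
  (* At [u = 0] the factor [x ^ b] cannot be cancelled; there [z] is [zeta], which inverts [sy1]. *)
  have [u0|u0] := eqVneq u 0.
    rewrite /sy1 ezq -/(gden _ _ _ _); have e0 := gden_at0 u0.
    have -> : z = zeta x0 x1 y0 y1.
      by rewrite /z g3_alt // mulrA mulVf ?mul1r ?expf_neq0.
    rewrite /zeta /gden /g12 -/a1 -/u -/x in e0 *.
    rewrite mulrAC divfK // mulrAC mulVf // mul1r addrC subrK /gm mulrC //.
  have x00 : x != 0 by rewrite mulf_neq0.
  apply: (mulfI (expf_neq0 b x00)); rewrite sy1E ev.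
  have := zeta_key a10; rewrite mulrBr -eth /gden /g12 -/a1 -/u -/x -eE.
  have -> : rho.[x] + (a1 * x1 - rho.[x]) = a1 * x1 by rewrite addrC subrK.
  move=> /addIr.
  by rewrite -/gm => <-; ring.
have [s1 _] := s_normalized x z.
have ey0 : sy0 x z = a1 ^+ d * gm * y0.
  have a1e : a1 ^+ d * gm = (G x0 x1 y0 y1 * a1 ^+ r.+1)^-1.
    have := expf_neq0 r.+1 a10; have := expf_neq0 d a10; rewrite /gm exprD.
    by move: (a1 ^+ d) (a1 ^+ r.+1) => y z' y0' z0'; field; rewrite y0' z0' G0.
  (* At [u = 0] the form [B] is nonzero, so [y0] follows from [y1] and the normalized equation. *)
  rewrite a1e; have [u0|u0] := eqVneq u 0.
    have FB0 : bform r.+1 B x0 x1 != 0.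
      have x10 : x1 != 0.
        by have := q0; rewrite -(g1_at0 u0) mulf_eq0 negb_or => /andP[].
      rewrite -shifted_sub -/(g2 x0 x1 y0 y1) -/u u0 shifted_0 //.
      by rewrite mulf_neq0 ?expf_neq0.
    move: s1; rewrite ev ey1 /fA /fB /x !shifted_scale /u /g2 !shifted_sub => s1.
    have a1r : a1 ^+ r.+1 != 0 by rewrite expf_neq0.
    apply: (mulIf (mulf_neq0 (mulf_neq0 a1r FB0) G0)).
    transitivity (G x0 x1 y0 y1 *
      (a1 ^+ (r.+1 + d) * bform (r.+1 + d) A x0 x1 * (gm * y1) - 1)).
      by rewrite -{}s1 /x; ring.
    have -> : a1 ^+ (r.+1 + d) * bform (r.+1 + d) A x0 x1 * (gm * y1) =
        bform (r.+1 + d) A x0 x1 * y1 / G x0 x1 y0 y1.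
      have := expf_neq0 (r.+1 + d)%N a10; rewrite /gm.
      by move: (a1 ^+ (r.+1 + d)) => y yn; field; rewrite G0 yn.
    rewrite mulrBr mulrCA mulfV // !mulr1.
    transitivity (bform r.+1 B x0 x1 * y0); first by rewrite /G /sec_eq; ring.
    by field; rewrite G0 a1r.
  have x00 : x != 0 by rewrite mulf_neq0.
  apply: (mulfI (expf_neq0 b x00)); rewrite sy0E ev /fA /fC /x !shifted_scale.
  rewrite /u /g2 !shifted_sub -/(g2 x0 x1 y0 y1) -/u.
  transitivity (a1 ^+ (r + d) * (u ^+ b * y0 / G x0 x1 y0 y1)).
    by rewrite -g1_eq0 addSn exprS; ring.
  have -> : (a1 * u) ^+ b = a1 ^+ (r + d) * a1 ^+ r.+1 * u ^+ b.
    by rewrite -/x xb /b exprD.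
  have a1r : a1 ^+ r.+1 != 0 by rewrite expf_neq0.
  by move: (a1 ^+ r.+1) a1r => y yn; field; rewrite G0 yn.
rewrite ev ey1 ey0 -[RHS](@Hpt_act k d x0 x1 y0 y1 a1 gm) //; last exact: sec_eq_coxp.
by congr Hpt; rewrite /x /u /g2; ring.
Qed.

(** Here [l = u^-1] normalizes [a2] to 1, and [gm] normalizes [G] to 1. *)
Lemma chart2_pt (w := g4 x0 x1 y0 y1 / u) : u != 0 ->
  Hpt d (1 + tau * tv x w) (tv x w) (ty0 x w) (ty1 x w) = Hpt d x0 x1 y0 y1.
Proof.
move=> u0; have ev : tv x w = u^-1 * x1.
  rewrite /tv /w /g4 /g12 -/a1 -/u -/x; move: (Pi.[x]) => y.
  by field; rewrite u0 q0.
have fE m P : shifted m P 1 (u^-1 * x1) = u ^- m * bform m P x0 x1.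
  by rewrite -{1}(mulVf u0) shifted_scale exprVn /u /g2 shifted_sub.
have ur n : u ^+ n != 0 by rewrite expf_neq0.
set gm := u ^+ (r.+1 + d) / G x0 x1 y0 y1.
have ey1 : ty1 x w = gm * y1.
  rewrite /ty1 ev /fB /fD !fE.
  transitivity (u ^- r * (u ^+ b * y1 / G x0 x1 y0 y1)).
    rewrite -g1_eq1 /x exprS; have := ur r; move: (u ^+ r) => y yn.
    by field; rewrite yn u0.
  rewrite /gm /b -addnA (addnC d) exprD; have := ur r; move: (u ^+ r) => y yn.
  by field; rewrite yn G0.
have ey0 : ty0 x w = u^-1 ^+ d * gm * y0.
  rewrite /ty0 ev /fA /fC !fE.
  transitivity (u ^- (r + d) * (u ^+ b * y0 / G x0 x1 y0 y1)).
    rewrite -g1_eq0 /x addSn exprS; have := ur (r + d)%N; move: (u ^+ (r + d)) => y yn.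
    by field; rewrite yn u0.
  rewrite /gm /b (exprD u (r + d) r.+1) (exprD u r.+1 d) exprVn.
  have := ur (r + d)%N; have := ur d.
  move: (u ^+ d) (u ^+ (r + d)) => y y' yn yn'.
  by field; rewrite yn' yn G0.
have gm0 : gm != 0 by rewrite mulf_neq0 ?invr_eq0.
rewrite ev ey1 ey0 -[RHS](@Hpt_act k d x0 x1 y0 y1 u^-1 gm) ?invr_eq0 //.
  by congr Hpt; rewrite /u /g2; field; rewrite /u /g2 in u0.
exact: sec_eq_coxp.
Qed.

Section Act.
Variables l m : k.
Hypotheses (l0 : l != 0) (m0 : m != 0).

(** In this group of lemmas [m] drops out and [l] acts on [g1], ..., [g4] with the weights of the
    torus, so a point of the surface determines an orbit on the threefold. *)
Lemma g2_act : g2 (l * x0) (l * x1) (l ^+ d * m * y0) (m * y1) = l * u.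
Proof. by rewrite /g2 /u /g2; ring. Qed.

Lemma g1_act : g1 (l * x0) (l * x1) (l ^+ d * m * y0) (m * y1) = l^-1 * a1.
Proof.
rewrite /g1 /a1 /g1 /G sec_eq_act !bform_scale -/G !exprD exprS.
have := expf_neq0 d l0; have := expf_neq0 r l0.
move: (l ^+ d) (l ^+ r) => y y' yn yn'.
by field; rewrite yn' yn l0 m0 G0.
Qed.

Lemma g12_act : g12 (l * x0) (l * x1) (l ^+ d * m * y0) (m * y1) = x.
Proof. by rewrite /g12 g1_act g2_act /x; move: a1 u => y z; field. Qed.

Lemma g4_act : g4 (l * x0) (l * x1) (l ^+ d * m * y0) (m * y1) = l * g4 x0 x1 y0 y1.
Proof. by rewrite /g4 g12_act g2_act /g12 -/a1 -/u -/x; ring. Qed.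

Lemma gden_act : gden (l * x0) (l * x1) (l ^+ d * m * y0) (m * y1) = gden x0 x1 y0 y1.
Proof.
rewrite /gden g12_act g1_act /g12 -/a1 -/u -/x; congr (E _ _ (_ - _)).
by move: a1 => y; field.
Qed.

Lemma zeta_act : zeta (l * x0) (l * x1) (l ^+ d * m * y0) (m * y1) = zeta x0 x1 y0 y1.
Proof.
rewrite /zeta gden_act g12_act g1_act /G sec_eq_act -/G /g12 -/a1 -/u -/x.
congr (_ * (_ - _) / _); rewrite exprMn exprVn.
have ln := expf_neq0 (r.+1 + d)%N l0.
move: (a1 ^+ _) (l ^+ _) ln => y z zn.
(* Where [a1] vanishes, both sides rely on the inverse of 0 being 0. *)
have [->|yn] := eqVneq y 0; first by rewrite !mulr0 !invr0 !mulr0.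
by field; rewrite yn zn m0 G0.
Qed.

Lemma g3_act : g3 (l * x0) (l * x1) (l ^+ d * m * y0) (m * y1) = l ^- b * g3 x0 x1 y0 y1.
Proof.
rewrite /g3 g2_act g1_act g4_act zeta_act -/a1 -/u mulf_eq0 (negPf l0) /=.
have ln := expf_neq0 b l0.
case: eqVneq => u0; first by rewrite (exprMn b l^-1 a1) exprVn [RHS]mulrA.
have -> : l^-1 * a1 * (l * g4 x0 x1 y0 y1) = a1 * g4 x0 x1 y0 y1.
  by move: a1 (g4 _ _ _ _) => y z; field.
have un := expf_neq0 b u0; rewrite [X in _ / X](exprMn b l u) invfM.
by rewrite mulrCA mulrA.
Qed.
End Act.
End AtPoint.

Lemma g_chart1 x z (v := sv x z) (y0 := sy0 x z) (y1 := sy1 x z) :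
  [/\ G (x + tau * v) v y0 y1 = 1, g1 (x + tau * v) v y0 y1 = 1,
      g2 (x + tau * v) v y0 y1 = x, g3 (x + tau * v) v y0 y1 = z &
      g4 (x + tau * v) v y0 y1 = 1 + x ^+ b * z].
Proof.
have [s1 s2] := s_normalized x z.
have eG : G (x + tau * v) v y0 y1 = 1 by [].
have e1 : g1 (x + tau * v) v y0 y1 = 1 by rewrite /g1 eG divr1.
have e2 : g2 (x + tau * v) v y0 y1 = x by rewrite /g2 addrK.
have e12 : g12 (x + tau * v) v y0 y1 = x by rewrite /g12 e1 e2 mul1r.
have e4 : g4 (x + tau * v) v y0 y1 = 1 + x ^+ b * z.
  rewrite /g4 e2 e12 -ePi /v /sv -/q; move: (rho.[x]) (x ^+ b) => y y'.
  by field.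
split=> //; rewrite /g3 e1 e2 e4 expr1n !mul1r; case: eqVneq => [x00|x0].
  rewrite /zeta /gden eG e1 e12 expr1n !mul1r divr1.
  have -> : v - rho.[x] = x ^+ b * (z * q) by rewrite /v /sv addrC addKr.
  rewrite /y1 /sy1 [th.[x] + _]addrC addrK.
  have : E x rho.[x] (x ^+ b * (z * q)) != 0.
    by rewrite x00 rho0 /b addnS exprS !mul0r.
  by move: (E _ _ _) => y yn; field; rewrite yn q0.
by rewrite [1 + _]addrC addrK mulrC mulKf ?expf_neq0.
Qed.

Lemma g_chart2 p w (v := tv p w) (y0 := ty0 p w) (y1 := ty1 p w) :
  [/\ G (1 + tau * v) v y0 y1 = 1, g1 (1 + tau * v) v y0 y1 = p,
      g2 (1 + tau * v) v y0 y1 = 1, g3 (1 + tau * v) v y0 y1 = p * w - 1 &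
      g4 (1 + tau * v) v y0 y1 = w].
Proof.
have [s1 s2] := t_normalized p w.
have eG : G (1 + tau * v) v y0 y1 = 1 by [].
have e1 : g1 (1 + tau * v) v y0 y1 = p by rewrite /g1 eG divr1.
have e2 : g2 (1 + tau * v) v y0 y1 = 1 by rewrite /g2 addrK.
have e12 : g12 (1 + tau * v) v y0 y1 = p by rewrite /g12 e1 e2 mulr1.
have e4 : g4 (1 + tau * v) v y0 y1 = w.
  by rewrite /g4 e2 e12 /v /tv; field.
by split=> //; rewrite /g3 e1 e2 e4 expr1n divr1 oner_eq0.
Qed.

(** * The complement of the section and the spectrum of the invariants *)

Section Isomorphism.
Variable S : set (hirzebruch k d).
Hypothesis SE : forall x0 x1 y0 y1 : k, coxp x0 x1 y0 y1 ->
  S (Hpt d x0 x1 y0 y1) <-> G x0 x1 y0 y1 = 0.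
Local Notation IR := (inv_ring k b).
Variables ix iv ip0 ip1 ipb : IR.
Hypothesis ixE : forall a : threefold_pt k b, val ix a = val a 0 0 * val a 0 1.
Hypothesis ivE : forall a : threefold_pt k b, val iv a = val a 0 0 * val a 0 3.
Hypothesis ip0E : forall a : threefold_pt k b, val ip0 a = val a 0 2 * val a 0 3 ^+ b.
Hypothesis ip1E : forall a : threefold_pt k b,
  val ip1 a = val a 0 1 ^+ (r + d + r) * val a 0 2 * val a 0 3.
Hypothesis ipbE : forall a : threefold_pt k b, val ipb a = val a 0 1 ^+ b * val a 0 2.

Let threefold_eq (a : threefold_pt k b) :
  val a 0 0 * val a 0 3 = 1 + val a 0 1 ^+ b * val a 0 2.
Proof.
have /set_mem := valP a; rewrite /threefold /= => /eqP.
by rewrite subr_eq => /eqP.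
Qed.

Let expb (y : k) : y ^+ b = y * y ^+ (r + d + r).
Proof. by rewrite /b addnS exprS. Qed.

Lemma inv_rel1 : iv = 1 + ipb.
Proof. by apply: inv_ring_eq => a; rewrite val_invD val_inv1 ivE ipbE threefold_eq. Qed.

Lemma inv_rel2 : ix ^+ b * ip0 = iv ^+ b * ipb.
Proof.
apply: inv_ring_eq => a; rewrite !val_invM !val_invX ixE ivE ip0E ipbE !exprMn; ring.
Qed.

Lemma inv_rel3 : ix * ip1 = iv * ipb.
Proof.
by apply: inv_ring_eq => a; rewrite !val_invM ixE ivE ip1E ipbE expb; ring.
Qed.

Definition fpt x0 x1 y0 y1 : threefold_pt k b := threefold_mk b
  (row4 (g1 x0 x1 y0 y1) (g2 x0 x1 y0 y1) (g3 x0 x1 y0 y1) (g4 x0 x1 y0 y1)).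

Lemma fptE x0 x1 y0 y1 : G x0 x1 y0 y1 != 0 -> val (fpt x0 x1 y0 y1) =
  row4 (g1 x0 x1 y0 y1) (g2 x0 x1 y0 y1) (g3 x0 x1 y0 y1) (g4 x0 x1 y0 y1).
Proof. by move=> G0; apply/threefold_mkE/threefold_row4/g_threefold. Qed.

Definition to_Spec (p : hirzebruch k d) : Spec IR :=
  Hlift (fun x0 x1 y0 y1 => evr (fpt x0 x1 y0 y1)) p.

Lemma to_SpecE x0 x1 y0 y1 : G x0 x1 y0 y1 != 0 ->
  to_Spec (Hpt d x0 x1 y0 y1) = evr (fpt x0 x1 y0 y1).
Proof.
move=> G0; have [l [m [l0 m0 H]]] := Hlift_act d (sec_eq_coxp G0).
rewrite /to_Spec H; apply: Spec_eq => f; rewrite !evrE.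
apply: ((val_invP f).2 l l0); rewrite !fptE //; last first.
  by rewrite /G sec_eq_act !mulf_neq0 // expf_neq0.
by rewrite /torus_act !row4C g1_act // g2_act // g3_act // g4_act.
Qed.

(** The fractions [ip0 / iv ^ b] and [ip1 / ipb] are the chart coordinates [a1 ^- b * a3] and
    [a4 / a2]. The conditions [a1 != 0] and [a2 != 0] are not expressed by invariants, but [iv] and
    [ipb] cannot both vanish since [iv = 1 + ipb]. *)
Definition of_Spec (phi : Spec IR) : hirzebruch k d :=
  if phi iv != 0 then
    let x := phi ix in let z := phi ip0 / phi iv ^+ b in
    Hpt d (x + tau * sv x z) (sv x z) (sy0 x z) (sy1 x z)
  else
    let p := phi ix in let w := phi ip1 / phi ipb in
    Hpt d (1 + tau * tv p w) (tv p w) (ty0 p w) (ty1 p w).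

Lemma to_Spec_chart1 (phi : Spec IR) (x := phi ix) (z := phi ip0 / phi iv ^+ b) :
  phi iv != 0 ->
  to_Spec (Hpt d (x + tau * sv x z) (sv x z) (sy0 x z) (sy1 x z)) = phi.
Proof.
move=> v0; have [eG e1 e2 e3 e4] := g_chart1 x z.
have G0 : G (x + tau * sv x z) (sv x z) (sy0 x z) (sy1 x z) != 0 by rewrite eG oner_eq0.
rewrite to_SpecE //; apply: Spec_eq => f; rewrite evrE; apply/esym.
(* Acting by [t = a1] moves a point with [a1 a4 != 0] to [(1, a1 a2, a1 ^- b * a3, a1 a4)], whose
   entries are these fractions. *)
pose ri (i : 'I_4) : IR := [:: 1; ix; ip0; iv]`_i.
pose N (i : 'I_4) : nat := nth 0%N [:: 0; 0; b; 0]%N i.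
have vE : phi iv = 1 + x ^+ b * z.
  rewrite {1}inv_rel1 rmorphD rmorph1; congr (1 + _).
  have := congr1 phi inv_rel2; rewrite !rmorphM !rmorphXn /= => H.
  by rewrite /z mulrA H mulrC mulKf ?expf_neq0.
apply: (@character_at_point k b phi iv ri N _ v0).
  move=> a va; have /andP[a1 a4] : (val a 0 0 != 0) && (val a 0 3 != 0).
    by rewrite -negb_or -mulf_eq0 -ivE.
  exists (val a 0 0) => // i; rewrite mxE.
  have E0 : (val a 0 0)^-1 * val a 0 0 = val (1 : IR) a / val iv a ^+ 0.
    by rewrite val_inv1 expr0 divr1 mulVf.
  have E1 : val a 0 0 * val a 0 1 = val ix a / val iv a ^+ 0.
    by rewrite ixE expr0 divr1.
  have E2 : val a 0 0 ^- b * val a 0 2 = val ip0 a / val iv a ^+ b.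
    rewrite ip0E ivE exprMn; have := expf_neq0 b a1; have := expf_neq0 b a4.
    by move: (_ ^+ b) (_ ^+ b) => y y' yn yn'; field; rewrite yn yn'.
  have E3 : val a 0 0 * val a 0 3 = val iv a / val iv a ^+ 0.
    by rewrite expr0 divr1 ivE.
  by case: i => [[|[|[|[|//]]]] h].
move=> i; rewrite fptE // e1 e2 e3 e4 mxE.
case: i => [[|[|[|[|//]]]] h]; rewrite /ri /N /= ?expr0 ?divr1 //.
by rewrite rmorph1.
Qed.

Lemma to_Spec_chart2 (phi : Spec IR) (p := phi ix) (w := phi ip1 / phi ipb) :
  phi ipb != 0 ->
  to_Spec (Hpt d (1 + tau * tv p w) (tv p w) (ty0 p w) (ty1 p w)) = phi.
Proof.
move=> v0; have [eG e1 e2 e3 e4] := g_chart2 p w.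
have G0 : G (1 + tau * tv p w) (tv p w) (ty0 p w) (ty1 p w) != 0 by rewrite eG oner_eq0.
rewrite to_SpecE //; apply: Spec_eq => f; rewrite evrE; apply/esym.
(* Acting by [t = a2^-1] gives [(a1 a2, 1, a2 ^ b * a3, a4 / a2)]. *)
pose ri (i : 'I_4) : IR := [:: ix; 1; ipb; ip1]`_i.
pose N (i : 'I_4) : nat := nth 0%N [:: 0; 0; 0; 1]%N i.
have pwE : p * w - 1 = phi ipb.
  have := congr1 phi inv_rel3; rewrite !rmorphM inv_rel1 rmorphD rmorph1 => H.
  by rewrite /w mulrA H mulfK // addrC addKr.
apply: (@character_at_point k b phi ipb ri N _ v0).
  move=> a va; have /andP[a2b a3] : (val a 0 1 ^+ b != 0) && (val a 0 2 != 0).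
    by rewrite -negb_or -mulf_eq0 -ipbE.
  have a2 : val a 0 1 != 0 by move: a2b; rewrite expb mulf_eq0 negb_or => /andP[].
  exists (val a 0 1)^-1; rewrite ?invr_eq0 // => i; rewrite mxE.
  have E0 : (val a 0 1)^-1^-1 * val a 0 0 = val ix a / val ipb a ^+ 0.
    by rewrite ixE expr0 divr1 invrK mulrC.
  have E1 : (val a 0 1)^-1 * val a 0 1 = val (1 : IR) a / val ipb a ^+ 0.
    by rewrite val_inv1 expr0 divr1 mulVf.
  have E2 : (val a 0 1)^-1 ^- b * val a 0 2 = val ipb a / val ipb a ^+ 0.
    by rewrite ipbE expr0 divr1 exprVn invrK.
  have E3 : (val a 0 1)^-1 * val a 0 3 = val ip1 a / val ipb a ^+ 1.
    rewrite ip1E ipbE expr1 expb; have := expf_neq0 (r + d + r) a2.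
    by move: (_ ^+ (r + d + r)) => y yn; field; rewrite yn a2 a3.
  by case: i => [[|[|[|[|//]]]] h].
move=> i; rewrite fptE // e1 e2 e3 e4 mxE.
case: i => [[|[|[|[|//]]]] h]; rewrite /ri /N /= ?expr0 ?divr1 //.
by rewrite rmorph1.
Qed.

Lemma ipb_neq0 (phi : Spec IR) : phi iv = 0 -> phi ipb != 0.
Proof.
rewrite inv_rel1 rmorphD rmorph1 => /eqP; rewrite addrC addr_eq0 => /eqP ->.
by rewrite oppr_eq0 oner_eq0.
Qed.

Lemma of_SpecK phi : to_Spec (of_Spec phi) = phi.
Proof.
rewrite /of_Spec; case: eqVneq => [/ipb_neq0|] ?; first exact: to_Spec_chart2.
exact: to_Spec_chart1.
Qed.

Lemma to_SpecK x0 x1 y0 y1 : G x0 x1 y0 y1 != 0 ->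
  of_Spec (to_Spec (Hpt d x0 x1 y0 y1)) = Hpt d x0 x1 y0 y1.
Proof.
move=> G0; rewrite to_SpecE // /of_Spec !evrE ivE ixE ip0E ip1E ipbE fptE // !row4C.
have := g_threefold G0; set a1 := g1 _ _ _ _; set a2 := g2 _ _ _ _.
set a3 := g3 _ _ _ _; set a4 := g4 _ _ _ _ => tF.
case: eqVneq => [a14|].
  move: tF; rewrite a14 sub0r => /eqP; rewrite eqr_oppLR => /eqP H.
  have : a2 ^+ b * a3 != 0 by rewrite H oppr_eq0 oner_eq0.
  rewrite mulf_eq0 negb_or => /andP[a2b a30].
  have a20 : a2 != 0 by move: a2b; rewrite expb mulf_eq0 negb_or => /andP[].
  have -> : a2 ^+ (r + d + r) * a3 * a4 / (a2 ^+ b * a3) = a4 / a2.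
    rewrite expb; have := expf_neq0 (r + d + r) a20.
    by move: (_ ^+ (r + d + r)) => y yn; field; rewrite yn a20 a30.
  exact: (chart2_pt G0 a20).
rewrite mulf_eq0 negb_or => /andP[a10 a40].
have -> : a3 * a4 ^+ b / (a1 * a4) ^+ b = a1 ^- b * a3.
  rewrite (exprMn b a1 a4); have := expf_neq0 b a10; have := expf_neq0 b a40.
  by move: (a1 ^+ b) (a4 ^+ b) => y y' yn yn'; field; rewrite yn yn'.
exact: (chart1_pt G0 a10).
Qed.

Let on4 (h : k -> k -> k -> k -> k) (z : 'rV[k]_4) := h (z 0 0) (z 0 1) (z 0 2) (z 0 3).

Let act_open (O : set 'rV[k]_4) := forall l m x0 x1 y0 y1 : k,
  l != 0 -> m != 0 -> O (row4 x0 x1 y0 y1) ->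
  O (row4 (l * x0) (l * x1) (l ^+ d * m * y0) (m * y1)).

Lemma to_Spec_regular_on (O : set 'rV[k]_4) (h3 : 'rV[k]_4 -> k) (f : IR) :
  zopen (s := affine k 4) O -> act_open O -> (forall z : 'rV[k]_4, O z -> on4 G z != 0) ->
  regular (s := affine k 4) O (on4 g1) -> regular (s := affine k 4) O (on4 g2) ->
  regular (s := affine k 4) O h3 -> regular (s := affine k 4) O (on4 g4) ->
  (forall z : 'rV[k]_4, O z -> on4 g3 z = h3 z) ->
  forall x0 x1 y0 y1, O (row4 x0 x1 y0 y1) -> exists W : set (hirzebruch k d),
    [/\ zopen W, W (Hpt d x0 x1 y0 y1) & regular W (fun p => to_Spec p f)].
Proof.
move=> oO aO OG r1 r2 r3 r4 e3 x0 x1 y0 y1 Ox.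
have [[P fP] _] := val_invP f.
pose al (i : 'I_4) (z : 'rV[k]_4) := nth 0 [:: on4 g1 z; on4 g2 z; h3 z; on4 g4 z] i.
have ral i : regular (s := affine k 4) O (al i) by case: i => [[|[|[|[|//]]]] h].
have rP := fa_meval (regular_fa (X := affine k 4) O) P ral.
have [|oW rW] := H_regular_affine (f := fun p => to_Spec p f) oO rP aO.
  move=> z0 z1 w0 w1 cz Oz; have Gz := OG _ Oz; have e3z := e3 _ Oz.
  rewrite /on4 !row4C in Gz e3z; rewrite to_SpecE // evrE fP fptE //.
  by apply: meval_eq => i; rewrite mxE /al -e3z /on4 !row4C.
exists [set p | exists x0 x1 y0 y1 : k, [/\ coxp x0 x1 y0 y1,
  O (row4 x0 x1 y0 y1) & p = Hpt d x0 x1 y0 y1]]; split=> //.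
have G0 := OG _ Ox; rewrite /on4 !row4C in G0.
by exists x0, x1, y0, y1; split=> //; apply: sec_eq_coxp.
Qed.

Lemma to_Spec_regular (f : IR) x0 x1 y0 y1 : G x0 x1 y0 y1 != 0 ->
  exists W : set (hirzebruch k d),
    [/\ zopen W, W (Hpt d x0 x1 y0 y1) & regular W (fun p => to_Spec p f)].
Proof.
move=> G0; have MA := @mpolyfun_fa k 4.
have rpol (U : set 'rV[k]_4) (h : 'rV[k]_4 -> k) :
    mpolyfun h -> regular (s := affine k 4) U h.
  move=> [P eP] z _; exists P, 1; rewrite rmorph1 oner_eq0; split=> // y _ _.
  by rewrite rmorph1 divr1 eP.
have pf m (P : {poly k}) : mpolyfun (fun z : 'rV[k]_4 => bform m P (z 0 0) (z 0 1)).
  by apply: (fa_bform _ _ MA); apply: mpolyfun_coord.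
have rsub (U V : set 'rV[k]_4) (h : 'rV[k]_4 -> k) : V `<=` U ->
    regular (s := affine k 4) U h -> regular (s := affine k 4) V h.
  exact: (regular_sub (s := affine k 4)).
pose U0 : set 'rV[k]_4 := [set z : 'rV[k]_4 | on4 G z != 0].
have [oU0 rGi] : zopen (s := affine k 4) U0 /\
    regular (s := affine k 4) U0 (fun z : 'rV[k]_4 => (on4 G z)^-1).
  have := regularV (zopenT (affine k 4)) (rpol setT _ (@sec_eq_polyfun4 k d r.+1 A B)).
  by rewrite setTI.
have RA U := regular_fa (X := affine k 4) U.
have r1 : regular (s := affine k 4) U0 (on4 g1).
  apply: (fa_mul (RA U0)) => //; apply: rpol; fa MA; exact: pf.
have p2 : mpolyfun (on4 g2).
  by rewrite /on4 /g2; fa MA.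
have r2 U := rpol U _ p2.
have r12 : regular (s := affine k 4) U0 (on4 g12) := fa_mul (RA U0) r1 (r2 U0).
have rX1 U : regular (s := affine k 4) U (fun z : 'rV[k]_4 => z 0 1).
  by apply: rpol; apply: mpolyfun_coord.
have r4 : regular (s := affine k 4) U0 (on4 g4).
  apply: (fa_add (RA U0)); apply: (fa_mul (RA U0)) => //; first exact: (fa_cst (RA U0)).
  exact: (fa_horner (RA U0)).
have Gact l m z0 z1 w0 w1 : l != 0 -> m != 0 -> G z0 z1 w0 w1 != 0 ->
    G (l * z0) (l * z1) (l ^+ d * m * w0) (m * w1) != 0.
  by move=> l0 m0 Gz; rewrite /G sec_eq_act !mulf_neq0 // expf_neq0.
(* Near [a2 = 0] both [a1] and [gden] are invertible and the formula through [zeta] is regular;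
   elsewhere one divides by [a2 ^ b]. *)
have [u0|u0] := eqVneq (g2 x0 x1 y0 y1) 0.
  have [oU1 ri1] := regularV oU0 r1; set U1 := U0 `&` _ in oU1 ri1.
  have U1sub : U1 `<=` U0 by move=> z [].
  have r12' := rsub _ _ _ U1sub r12.
  have rr : regular (s := affine k 4) U1 (fun z : 'rV[k]_4 => rho.[on4 g12 z]).
    exact: (fa_horner (RA U1)).
  have rden : regular (s := affine k 4) U1 (on4 gden).
    apply: (pE (RA U1)) => //; apply: (fa_sub (RA U1)) => //.
    by apply: (fa_mul (RA U1)) => //; apply: rsub r1.
  have [oU2 riden] := regularV oU1 rden; set U2 := U1 `&` _ in oU2 riden.
  have U2sub : U2 `<=` U1 by move=> z [].
  have U2sub0 : U2 `<=` U0 by move=> z [[]].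
  have X1 := rsub _ _ _ U2sub ri1.
  have X2 := rsub _ _ _ U2sub0 r1.
  have X3 := rsub _ _ _ U2sub0 rGi.
  have X4 := rsub _ _ _ U2sub0 r12.
  have XY : regular (s := affine k 4) U2 (fun z : 'rV[k]_4 => z 0 3).
    by apply: rpol; apply: mpolyfun_coord.
  apply: (@to_Spec_regular_on U2 (fun z : 'rV[k]_4 => on4 g1 z ^+ b *
    (q^-1 * (z 0 3 * ((on4 G z)^-1 * ((on4 g1 z)^-1) ^+ (r.+1 + d)) - th.[on4 g12 z]) *
      (on4 gden z)^-1)) f) => //.
  - move=> l m z0 z1 w0 w1 l0 m0 [[Gz g1z] gdz].
    rewrite /U0 /= /on4 !row4C in Gz; rewrite /= /on4 !row4C in g1z gdz.
    split; last by rewrite /= /on4 !row4C gden_act.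
    split; first by rewrite /U0 /= /on4 !row4C; apply: Gact.
    by rewrite /= /on4 !row4C g1_act // mulf_neq0 // invr_eq0.
  - apply: (fa_mul (RA U2)); first exact: (fa_exp (RA U2)).
    apply: (fa_mul (RA U2)) => //; apply: (fa_mul (RA U2)); first exact: (fa_cst (RA U2)).
    apply: (fa_sub (RA U2)); last exact: (fa_horner (RA U2)).
    apply: (fa_mul (RA U2)) => //; apply: (fa_mul (RA U2)) => //.
    exact: (fa_exp (RA U2)).
  - exact: rsub r4.
  - move=> z [[Gz g1z] gdz]; rewrite /on4 (g3_alt Gz g1z gdz) /zeta.
    by rewrite exprVn -(invfM (G _ _ _ _)).
  - rewrite /U2 /U1 /U0; split; last by rewrite /= /on4 !row4C gden_at0.
    by split; rewrite /= /on4 !row4C // g1_at0_neq0.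
have [oU1 ri2] := regularV oU0 (r2 U0); set U1 := U0 `&` _ in oU1 ri2.
have U1sub : U1 `<=` U0 by move=> z [].
apply: (@to_Spec_regular_on U1 (fun z : 'rV[k]_4 =>
  (on4 g1 z * on4 g4 z - 1) * ((on4 g2 z)^-1) ^+ b) f) => //.
- move=> l m z0 z1 w0 w1 l0 m0 [Gz g2z].
  rewrite /U0 /= /on4 !row4C in Gz; rewrite /= /on4 !row4C in g2z.
  split; first by rewrite /U0 /= /on4 !row4C; apply: Gact.
  by rewrite /= /on4 !row4C g2_act mulf_neq0.
- exact: rsub r1.
- apply: (fa_mul (RA U1)); last exact: (fa_exp (RA U1)).
  apply: (fa_sub (RA U1)); last exact: (fa_cst (RA U1)).
  by apply: (fa_mul (RA U1)); [apply: rsub r1 | apply: rsub r4].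
- exact: rsub r4.
- by move=> z [Gz g2z]; rewrite /on4 /g3 (negPf g2z) exprVn.
- by split; rewrite /U0 /= /on4 !row4C.
Qed.

Lemma of_Spec_morphism : morphism of_Spec.
Proof.
pose q0pt : hirzpt k d :=
  \pi_(hirzpt k d) (exist (fun a : 'rV[k]_4 => a \in @cox k) _ (row4_1001_in k) : coxpt k).
apply: (@morphism_to_quot k 4 (@cox k) (hirzpt k d)
  (fun x : coxpt k => \pi_(hirzpt k d) x) q0pt (Spec IR) of_Spec) => phi.
have RA U := regular_fa (X := Spec IR) U.
have rdiv (f g : IR) n : regular [set psi : Spec IR | psi g != 0]
    (fun psi : Spec IR => psi f / psi g ^+ n).
  apply: (fa_mul (RA _)); first exact: Spec_regular.
  have rg : regular (s := Spec IR) setT (fun psi : Spec IR => psi g).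
    exact: Spec_regular.
  have [_ rV] := regularV (zopenT (Spec IR)) rg.
  rewrite setTI in rV; have := fa_exp (RA _) n rV.
  by congr regular; apply/funext => psi; rewrite exprVn.
have coords (W : set (Spec IR)) (h : 'I_4 -> Spec IR -> k) (h0 h1 h2 h3 : Spec IR -> k) :
    regular W h0 -> regular W h1 -> regular W h2 -> regular W h3 ->
    forall i, regular W (fun psi => row4 (h0 psi) (h1 psi) (h2 psi) (h3 psi) 0 i).
  move=> r0 r1 r2 r3 i; have [->|[->|[->|->]]] : i = 0 \/ i = 1 \/ i = 2 \/ i = 3.
  - case: i => [[|[|[|[|//]]]] h']; [left|right;left|do 2!right;left|do 3!right];
      exact: val_inj.
  - by under eq_fun do rewrite row4_0.
  - by under eq_fun do rewrite row4_1.
  - by under eq_fun do rewrite row4_2.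
  - by under eq_fun do rewrite row4_3.
have [v0|v0] := eqVneq (phi iv) 0.
  have rw := rdiv ip1 ipb 1%N; set W := [set psi : Spec IR | _] in rw.
  have rp : regular W (fun psi : Spec IR => psi ix) by apply: Spec_regular.
  have [t1 t2 t3] := tv_fa (RA W) rp rw.
  exists W, (fun psi : Spec IR => let p := psi ix in let w := psi ip1 / psi ipb ^+ 1 in
    row4 (1 + tau * tv p w) (tv p w) (ty0 p w) (ty1 p w)); split.
  - exact: Spec_zopen.
  - exact: ipb_neq0.
  - apply: coords => //; apply: (fa_add (RA W)); first exact: (fa_cst (RA W)).
    by apply: (fa_mul (RA W)) => //; apply: (fa_cst (RA W)).
  - move=> psi pb0; rewrite expr1 /=.
    have [eG _ _ _ _] := g_chart2 (psi ix) (psi ip1 / psi ipb).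
    have G0 : G (1 + tau * tv (psi ix) (psi ip1 / psi ipb))
      (tv (psi ix) (psi ip1 / psi ipb))
      (ty0 (psi ix) (psi ip1 / psi ipb)) (ty1 (psi ix) (psi ip1 / psi ipb)) != 0.
      by rewrite eG oner_eq0.
    split; first exact/cox_row4/sec_eq_coxp.
    (* On this open set [of_Spec] may still use the first chart. The point of the second chart maps
       to [psi], so [to_SpecK] identifies it with [of_Spec psi]. *)
    by rewrite -{1}(to_Spec_chart2 pb0) (to_SpecK G0).
have rz := rdiv ip0 iv b; set W := [set psi : Spec IR | _] in rz.
have rx : regular W (fun psi : Spec IR => psi ix) by apply: Spec_regular.
have [t1 t2 t3] := sv_fa (RA W) rx rz.
exists W, (fun psi : Spec IR => let x := psi ix in let z := psi ip0 / psi iv ^+ b in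
  row4 (x + tau * sv x z) (sv x z) (sy0 x z) (sy1 x z)); split.
- exact: Spec_zopen.
- exact: v0.
- apply: coords => //; apply: (fa_add (RA W)) => //.
  by apply: (fa_mul (RA W)) => //; apply: (fa_cst (RA W)).
- move=> psi pv0; have [eG _ _ _ _] := g_chart1 (psi ix) (psi ip0 / psi iv ^+ b).
  split; last by rewrite /of_Spec ifT.
  by apply/cox_row4; apply: sec_eq_coxp; rewrite eG oner_eq0.
Qed.

Lemma of_Spec_compl phi : (~` S) (of_Spec phi).
Proof.
have H x0 x1 y0 y1 : G x0 x1 y0 y1 = 1 -> ~ S (Hpt d x0 x1 y0 y1).
  move=> eG; have G0 : G x0 x1 y0 y1 != 0 by rewrite eG oner_eq0.
  by move=> /(SE (sec_eq_coxp G0)) /eqP; rewrite (negPf G0).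
rewrite /of_Spec; case: ifP => _; apply: H.
  by have [] := g_chart1 (phi ix) (phi ip0 / phi iv ^+ b).
by have [] := g_chart2 (phi ix) (phi ip1 / phi ipb).
Qed.

Lemma complement_isomorphic : isomorphic (sub_space (~` S)) (Spec IR).
Proof.
have Spt (p : sub_space (~` S)) : exists x0 x1 y0 y1 : k,
    G x0 x1 y0 y1 != 0 /\ val p = Hpt d x0 x1 y0 y1.
  have [x0 [x1 [y0 [y1 [cx ep]]]]] := Hpt_surj (val p).
  exists x0, x1, y0, y1; split=> //; apply/eqP => G0.
  by have /set_mem := valP p; rewrite ep; apply; apply/SE.
exists (fun p : sub_space (~` S) => to_Spec (val p)); split.
  apply: morphism_Spec => f p _; have [x0 [x1 [y0 [y1 [G0 ep]]]]] := Spt p.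
  have [W [oW Wp rW]] := to_Spec_regular f G0.
  by exists W, (fun p => to_Spec p f); rewrite ep.
exists (fun phi : Spec IR =>
  exist (fun p => p \in ~` S) _ (mem_set (@of_Spec_compl phi))); split.
- by apply: morphism_sub; apply: of_Spec_morphism.
- move=> p; apply: val_inj => /=; have [x0 [x1 [y0 [y1 [G0 ep]]]]] := Spt p.
  by rewrite ep to_SpecK.
- by move=> phi /=; rewrite of_SpecK.
Qed.
End Isomorphism.
End ChartMaps.
End Charts.

Theorem theorem2 (R : realType) (n : nat) (hn : (2 <= n)%N) (d : nat)
    (s : proj_space R[i] 1 -> hirzebruch R[i] d)
    (hs : is_section s)
    (hample : ample (range s))
    (hself : self_intersection s n%:Z) :
  isomorphic
    (sub_space (~` range s : set (hirzebruch R[i] d)))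
    (Spec (inv_ring R[i] n.-1)).
Proof.
have [A [B [e [e0 [cAB B0] [sB sA] szAB sE]]]] := ample_section_form hs hample.
case: e e0 sB sA szAB sE => // r _ sB sA szAB sE.
(* With [e = r + 1], the predecessor of [n] computes to [r + d + r.+1], the exponent [b] of the
   charts. *)
have [en] : n%:Z = (r.+1 + d + r.+1)%N := self_intersection_section hs.1 sE sA sB hself.
have char0 : [pchar R[i]] =i pred0 := Num.Theory.pchar_num _.
have [t [C [D [Bt Dt sC sD bez]]]] :=
  generic_section_point char0 (ltn0Sn r) cAB B0 sB sA szAB.
have [rho [th [ka [Pi [E [E' [[pE pE' eE eE'] En0 rho0 [eth eka] ePi]]]]]]] :=
  chart_data sA sB sC sD Bt Dt bez.
rewrite en; pose b := (r + d + r.+1)%N.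
have [ix ixE] : exists f : inv_ring R[i] b, forall a, val f a = val a 0 0 * val a 0 1.
  have [|f fE] := @inv_monomial R[i] b 1 1 0 0; first by rewrite muln0.
  by exists f => a; rewrite fE !expr0 !expr1 !mulr1.
have [iv ivE] : exists f : inv_ring R[i] b, forall a, val f a = val a 0 0 * val a 0 3.
  have [|f fE] := @inv_monomial R[i] b 1 0 0 1; first by rewrite muln0.
  by exists f => a; rewrite fE !expr0 !expr1 !mulr1.
have [ip0 ip0E] : exists f : inv_ring R[i] b, forall a,
    val f a = val a 0 2 * val a 0 3 ^+ b.
  have [|f fE] := @inv_monomial R[i] b 0 0 1 b; first by rewrite muln1.
  by exists f => a; rewrite fE !expr0 !expr1 !mul1r.
have [ip1 ip1E] : exists f : inv_ring R[i] b, forall a,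
    val f a = val a 0 1 ^+ (r + d + r) * val a 0 2 * val a 0 3.
  have [|f fE] := @inv_monomial R[i] b 0 (r + d + r) 1 1.
    by rewrite muln1 /b addnS addn1.
  by exists f => a; rewrite fE !expr0 !expr1 mul1r.
have [ipb ipbE] : exists f : inv_ring R[i] b, forall a,
    val f a = val a 0 1 ^+ b * val a 0 2.
  have [|f fE] := @inv_monomial R[i] b 0 b 1 0; first by rewrite muln1 addn0.
  by exists f => a; rewrite fE !expr0 !expr1 mul1r mulr1.
apply: (complement_isomorphic sA sB sC sD Bt Dt bez pE pE' eE eE' En0 rho0 eth eka ePi
  _ ixE ivE ip0E ip1E ipbE).
by move=> x0 x1 y0 y1 cx; apply: range_section.
Qed.
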